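(* Let $T>0$ and let $\psi$ be a solution of the linear transport problem $$\partial_t\psi+\Omega\cdot\nabla_x\psi=\mathcal L(\psi)\ \text{ on } [0,T]\times \mathrm X\times\mathbb S^2,\qquad \psi(0,x,\Omega)=\psi_0(x,\Omega),\qquad \psi(t,x,\Omega)=h(t,x,\Omega)\ \text{ for } t\in[0,T],\ (x,\Omega)\in\gamma_-,$$ and assume that $\psi$ is of class $C^1$ in $t\in[0,T]$ and of class $C^1$ in $x$, in the sense that $\psi,\partial_t\psi,\nabla_x\psi$ exist and are continuous on $[0,T]\times\overline{\mathrm X}\times\mathbb S^2$. Then there exists a sequence of neural network parameters $\{(m_{[j]},w_{[j]},b_{[j]})\}_{j=1}^\infty$ such that the corresponding neural network functions $\psi_j(t,x,\Omega)=\psi^{nn}(t,x,\Omega;m_{[j]},w_{[j]},b_{[j]})$ satisfy $$Loss_{\mathrm{Total}}(\psi_j)\to 0\qquad\text{as } j\to\infty .$$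
   Context: Setting. $\mathrm X\subset\mathbb R^3$ is a bounded domain with Lipschitz boundary and outward unit normal $n_x$ on $\partial\mathrm X$; $x\in\mathrm X$ is position, $\Omega\in\mathbb S^2$ is direction. The incoming boundary is $\gamma_-=\{(x,\Omega)\in\partial\mathrm X\times\mathbb S^2: n_x\cdot\Omega<0\}$, with measure $ds$ the product of the surface measures on $\partial\mathrm X$ and $\mathbb S^2$. Operators. $\sigma_a,\sigma_s\ge 0$ are constants (absorption and scattering cross-sections), $\sigma_t=\sigma_a+\sigma_s$. The scattering operator is $$(\mathcal S f)(x,\Omega)=\int_{\mathbb S^2} g(x,\Omega\cdot\Omega')f(x,\Omega')\,d\Omega',$$ where $g$ is normalized: $\int_{\mathbb S^2}g(x,\Omega\cdot\Omega')\,d\Omega'=2\pi\int_{-1}^1 g(x,\mu)\,d\mu=1$ for all $x\in\mathrm X$. For each $x$, $\mathcal S$ is a bounded linear operator on $L^2(\mathbb S^2)$. Set $\mathcal L(\psi)=\sigma_s\mathcal S\psi-\sigma_t\psi$; $\mathcal L$ is assumed to be a bounded linear operator on $L^2(\mathrm X\times\mathbb S^2)$. Neural networks. Fix a number of layers $L\ge 2$ and activation functions $\bar\sigma_l\in C^1(\mathbb R)$, $l=1,\dots,L-1$, each non-polynomial. Let $m=(m_0,m_1,\dots,m_{L-1})$ be the layer widths, where $m_0=7$ is the number of scalar inputs of $(t,x,\Omega)\in\mathbb R\times\mathbb R^3\times\mathbb R^3$, and let $m_L=1$. With weights $w=\{w^{(k)}_{ji}\}$ and biases $b=\{b^{(k)}_j\}$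 ($1\le k\le L$, $1\le i\le m_{k-1}$, $1\le j\le m_k$, real numbers), define $\theta^{(1)}_j=\sum_{i=1}^{m_0}w^{(1)}_{ji}y_i+b^{(1)}_j$ with $y=(t,x,\Omega)$, and $$\theta^{(l+1)}_j=\sum_{i=1}^{m_l}w^{(l+1)}_{ji}\,\bar\sigma_l(\theta^{(l)}_i)+b^{(l+1)}_j,\qquad l=1,\dots,L-1 .$$ The network function is $\psi^{nn}(t,x,\Omega;m,w,b)=\theta^{(L)}_1$. The widths $m_1,\dots,m_{L-1}$, the weights and the biases are free parameters. Loss functions. For a network function $\phi$, $$Loss_{\mathrm{GE}}(\phi)=\int_0^T\!\int_{\mathrm X}\int_{\mathbb S^2}\big|\partial_t\phi+\Omega\cdot\nabla_x\phi-\mathcal L(\phi)\big|^2\,d\Omega\,dx\,dt,$$ $$Loss_{\mathrm{IC}}(\phi)=\int_{\mathrm X}\int_{\mathbb S^2}|\phi(0,x,\Omega)-\psi_0(x,\Omega)|^2\,d\Omega\,dx,\qquad Loss_{\mathrm{BC}}(\phi)=\int_0^T\!\int_{\gamma_-}|\phi(t,x,\Omega)-h(t,x,\Omega)|^2\,ds\,dt,$$ and $Loss_{\mathrm{Total}}=Loss_{\mathrm{GE}}+Loss_{\mathrm{IC}}+Loss_{\mathrm{BC}}$. *)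

(* Defs.v *)
From HB Require Import structures.
From mathcomp Require Import all_boot all_order all_algebra.
From mathcomp Require Import all_classical all_reals all_analysis.
From mathcomp Require Import measurable_realfun ring lra.

Set Implicit Arguments.
Unset Strict Implicit.
Unset Printing Implicit Defensive.
Import Order.TTheory GRing.Theory Num.Theory.
Import numFieldNormedType.Exports.

Local Open Scope classical_set_scope.
Local Open Scope ring_scope.

(* measurableTypeR R is R with the Borel sigma-algebra on which
   lebesgue_measure is defined *)
Notation R3 R :=
  (measurableTypeR R * measurableTypeR R * measurableTypeR R)%type.

Section euclidean.
Context {R : realType}.
Implicit Types x y : R3 R.

Definition dot x y : R := x.1.1 * y.1.1 + x.1.2 * y.1.2 + x.2 * y.2.

Definition enorm x : R := Num.sqrt (dot x x).

Definition e1 : R3 R := (1, 0, 0).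
Definition e2 : R3 R := (0, 1, 0).
Definition e3 : R3 R := (0, 0, 1).

Definition sphere : set (R3 R) := [set x | enorm x = 1].

Lemma enorm_ge0 x : 0 <= enorm x. Proof. exact: sqrtr_ge0. Qed.

Lemma le_enorm1 x : `|x.1.1| <= enorm x.
Proof.
rewrite -sqrtr_sqr /enorm /dot ler_wsqrtr// expr2.
by rewrite -addrA lerDl -!expr2 addr_ge0// sqr_ge0.
Qed.

Lemma le_enorm2 x : `|x.1.2| <= enorm x.
Proof.
rewrite -sqrtr_sqr /enorm /dot ler_wsqrtr// expr2.
by rewrite addrAC lerDr -!expr2 addr_ge0// sqr_ge0.
Qed.

Lemma le_enorm3 x : `|x.2| <= enorm x.
Proof.
rewrite -sqrtr_sqr /enorm /dot ler_wsqrtr// expr2.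
by rewrite lerDr -!expr2 addr_ge0// sqr_ge0.
Qed.

Lemma measurable_dot_self : measurable_fun setT (fun x => dot x x).
Proof.
have m11 : measurable_fun setT (fun x : R3 R => x.1.1 : R).
  exact: (measurableT_comp measurable_fst measurable_fst).
have m12 : measurable_fun setT (fun x : R3 R => x.1.2 : R).
  exact: (measurableT_comp measurable_snd measurable_fst).
have m2 : measurable_fun setT (fun x : R3 R => x.2 : R).
  exact: measurable_snd.
by apply: measurable_funD; [apply: measurable_funD|]; apply: measurable_funM.
Qed.

Lemma measurable_sphere : measurable sphere.
Proof.
have -> : sphere = (fun x => dot x x) @^-1` [set 1].
  apply/seteqP; split => x /=; rewrite /sphere /enorm /=.
    by move=> x1; rewrite -[LHS]sqr_sqrtr ?x1 ?expr1n// /dot -!expr2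
      !addr_ge0// sqr_ge0.
  by move=> ->; rewrite sqrtr1.
rewrite -[X in measurable X]setTI.
exact: (measurable_dot_self measurableT (measurable_set1 _)).
Qed.

End euclidean.

Section hausdorff_measure.
Local Open Scope ereal_scope.
Context {R : realType}.
Implicit Types (A B X : set (R3 R)) (U : (set (R3 R))^nat) (d : R).

Definition diam A : \bar R :=
  ereal_sup (0 |` [set (enorm (x - y))%:E | x in A & y in A]).

Definition delta_cover d A : set (set (R3 R))^nat :=
  [set U | A `<=` \bigcup_i U i /\ forall i, diam (U i) <= d%:E].

(* pi / 4 is the area of a disk of diameter 1: with this factor the
   two-dimensional Hausdorff measure is the usual area on surfaces *)
Definition disk_area A : \bar R := (pi / 4)%:E * diam A ^+ 2.

Definition hausdorff_pre d A : \bar R :=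
  ereal_inf [set \sum_(i <oo) disk_area (U i) | U in delta_cover d A].

Definition hausdorff2 A : \bar R :=
  ereal_sup [set hausdorff_pre d A | d in [set d | (0 < d)%R]].

Lemma diam_ge0 A : 0 <= diam A.
Proof. by apply: ereal_sup_ubound; left. Qed.

Lemma diam0 : diam set0 = 0.
Proof.
apply/eqP; rewrite eq_le diam_ge0 andbT; apply: ge_ereal_sup => z [->//|].
by case=> x xF.
Qed.

Lemma disk_area_ge0 A : 0 <= disk_area A.
Proof.
by apply: mule_ge0; [rewrite lee_fin divr_ge0// pi_ge0|
  exact/expe_ge0/diam_ge0].
Qed.

Lemma disk_area0 : disk_area set0 = 0.
Proof. by rewrite /disk_area diam0 expe2 mule0 mule0. Qed.

Hint Resolve disk_area_ge0 : core.

Lemma hausdorff_pre_ge0 d A : 0 <= hausdorff_pre d A.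
Proof.
by apply: le_ereal_inf_tmp => _ [U _ <-]; apply: nneseries_ge0 => *.
Qed.

Lemma le_hausdorff_pre d A B : A `<=` B ->
  hausdorff_pre d A <= hausdorff_pre d B.
Proof.
move=> AB; apply: ereal_inf_le_tmp => _ [U [BU dU] <-]; exists U => //.
by split=> //; exact: subset_trans BU.
Qed.

Lemma ge_hausdorff_pre d d' A : (d <= d')%R ->
  hausdorff_pre d' A <= hausdorff_pre d A.
Proof.
move=> dd'; apply: ereal_inf_le_tmp => _ [U [AU dU] <-]; exists U => //.
by split=> // i; rewrite (le_trans (dU i))// lee_fin.
Qed.

Lemma hausdorff_pre0 d : (0 < d)%R -> hausdorff_pre d set0 = 0.
Proof.
move=> d0; apply/eqP; rewrite eq_le hausdorff_pre_ge0 andbT.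
apply: ereal_inf_lbound; exists (fun=> set0).
  by split => // i; rewrite diam0 lee_fin ltW.
by apply: eseries0 => i _ _; exact: disk_area0.
Qed.

Lemma hausdorff_pre_sigma_subadditive d : sigma_subadditive (hausdorff_pre d).
Proof.
move=> A; have [[i ioo]|] := pselect (exists i, hausdorff_pre d (A i) = +oo).
  rewrite (eseries_pinfty _ _ ioo) ?leey// => n _.
  by rewrite -ltNye (lt_le_trans _ (hausdorff_pre_ge0 _ _)).
rewrite -forallNE => Aoo.
apply/lee_addgt0Pr => _/posnumP[e].
rewrite (le_trans _ (epsilon_trick _ _ _))//; last first.
  by move=> n; exact: hausdorff_pre_ge0.
pose P n U := delta_cover d (A n) U /\
  \sum_(k <oo) disk_area (U k) <=
  hausdorff_pre d (A n) + (e%:num / (2 ^ n.+1)%:R)%:E.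
have [G PG] : {G : ((set (R3 R))^nat)^nat & forall n, P n (G n)}.
  apply: (@choice _ _ P) => n; rewrite /P.
  have fA : hausdorff_pre d (A n) \is a fin_num.
    by rewrite ge0_fin_numE ?hausdorff_pre_ge0// ltey; exact/eqP/Aoo.
  have en1 : (0 < e%:num / (2 ^ n.+1)%:R)%R by [].
  have [_ [U AU <-] /ltW Ue] := lb_ereal_inf_adherent en1 fA.
  by exists U.
have G_ge0 x : 0 <= (disk_area \o uncurry G) x by exact: disk_area_ge0.
apply: (@le_trans _ _ (\esum_(i in setT) (disk_area \o uncurry G) i)).
  apply: ereal_inf_lbound => /=.
  have /card_esym/ppcard_eqP[f] := card_nat2.
  exists (uncurry G \o f).
    split => [|i /=]; last first.
      by case: (f i) => n k; exact: (PG n).1.2.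
    apply: (@subset_trans _  (\bigcup_n \bigcup_k G n k)) => [t [i _]|].
      by move=> /(PG i).1.1 -[j _ ?]; exists i => //; exists j.
    move=> t [i _ [j _ Bijt]]; exists (f^-1%FUN (i, j)) => //=.
    by rewrite invK ?inE.
  rewrite -(esum_pred_image (disk_area \o uncurry G) _ xpredT);
    rewrite ?[fun=> _]set_true//.
  by rewrite image_eq.
rewrite (_ : esum _ _ = \sum_(i <oo) \sum_(j <oo) disk_area (G i j));
    last first.
  pose J : nat -> set (nat * nat) := fun i => [set (i, j) | j in setT].
  rewrite (_ : setT = \bigcup_k J k); last first.
    by rewrite predeqE => -[a b]; split => // _; exists a => //; exists b.
  rewrite esum_bigcupT /=; last 2 first.
    - apply/trivIsetP => i j _ _ ij.
      rewrite predeqE => -[n m] /=; split => //= -[] [_] _ [<-{n} _].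
      by move=> [m' _] [] /esym/eqP; rewrite (negbTE ij).
    - by move=> ?; exact: disk_area_ge0.
  rewrite -(image_id [set: nat]) -fun_true esum_pred_image//; last first.
    by move=> n _; exact: esum_ge0.
  apply: eq_eseriesr => /= j _.
  rewrite -(esum_pred_image (disk_area \o uncurry G) (pair j) predT)//=;
      last first.
    by move=> ? ? _ _; exact: (@can_inj _ _ _ snd).
  by congr esum; rewrite predeqE => -[a b]; split; move=> [i _ <-]; exists i.
by apply: lee_nneseries => [i _ _|i _];
  [exact: nneseries_ge0|exact: (PG i).2].
Qed.

Let hausdorff20 : hausdorff2 set0 = 0.
Proof.
apply/eqP; rewrite eq_le; apply/andP; split.
  by apply: ge_ereal_sup => _ [d d0 <-]; rewrite hausdorff_pre0.
rewrite -(hausdorff_pre0 ltr01); apply: ereal_sup_ubound.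
by exists 1%R => //=; rewrite ltr01.
Qed.

Lemma le_hausdorff_pre2 d A : (0 < d)%R -> hausdorff_pre d A <= hausdorff2 A.
Proof. by move=> d0; apply: ereal_sup_ubound; exists d. Qed.

Let hausdorff2_ge0 A : 0 <= hausdorff2 A.
Proof. exact: le_trans (hausdorff_pre_ge0 1 A) (le_hausdorff_pre2 _ ltr01). Qed.

Let le_hausdorff2 : {homo hausdorff2 : A B / A `<=` B >-> A <= B}.
Proof.
move=> A B AB; apply: ge_ereal_sup => _ [d d0 <-].
exact: le_trans (le_hausdorff_pre d AB) (le_hausdorff_pre2 _ d0).
Qed.

Let hausdorff2_sigma_subadditive : sigma_subadditive hausdorff2.
Proof.
move=> F; apply: ge_ereal_sup => _ [d d0 <-].
apply: (le_trans (hausdorff_pre_sigma_subadditive d F)).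
by apply: lee_nneseries => i *; [exact: hausdorff_pre_ge0|
  exact: le_hausdorff_pre2].
Qed.

HB.instance Definition _ := isOuterMeasure.Build R (R3 R) hausdorff2
  hausdorff20 hausdorff2_ge0 le_hausdorff2 hausdorff2_sigma_subadditive.

Lemma hausdorff_preU d (e : R) A B : (0 < d < e)%R ->
  (forall x y, A x -> B y -> (e <= enorm (x - y))%R) ->
  hausdorff_pre d A + hausdorff_pre d B <= hausdorff_pre d (A `|` B).
Proof.
move=> /andP[d0 de] AB; apply: le_ereal_inf_tmp => _ [U [ABU dU] <-].
pose V C i := if `[< U i `&` C !=set0 >] then U i else set0.
have VE C : C `<=` A `|` B -> hausdorff_pre d C <= \sum_(i <oo) disk_area (V C i).
  move=> CAB; apply: ereal_inf_lbound; exists (V C) => //; split => [x Cx|i].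
    have [i _ Uix] := ABU _ (CAB _ Cx).
    by exists i => //; rewrite /V asboolT//; exists x.
  by rewrite /V; case: ifP => // _; rewrite diam0 lee_fin ltW.
apply: (@le_trans _ _ (\sum_(i <oo) disk_area (V A i) +
                       \sum_(i <oo) disk_area (V B i))).
  by apply: leeD; apply: VE => x ?; [left|right].
rewrite -nneseriesD//; apply: lee_nneseries => [i _ _|i _].
  exact: adde_ge0.
rewrite /V; case: asboolP => [[x [Ux Ax]]|_]; last first.
  by rewrite disk_area0 add0e; case: ifP => // _; rewrite disk_area0.
case: asboolP => [[y [Uy By]]|_]; last by rewrite disk_area0 adde0.
suff : e%:E <= d%:E by rewrite lee_fin leNgt de.
apply: le_trans (dU i); apply: (@le_trans _ _ (enorm (x - y))%:E).
  by rewrite lee_fin AB.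
by apply: ereal_sup_ubound; right; exists x => //; exists y.
Qed.

Lemma hausdorff2U (e : R) A B : (0 < e)%R ->
  (forall x y, A x -> B y -> (e <= enorm (x - y))%R) ->
  hausdorff2 A + hausdorff2 B <= hausdorff2 (A `|` B).
Proof.
move=> e0 AB.
have H d d' : (0 < d)%R -> (0 < d')%R ->
    hausdorff_pre d A + hausdorff_pre d' B <= hausdorff2 (A `|` B).
  move=> d0 d'0; pose m : R := Num.min (e / 2)%R (Num.min d d').
  have m0 : (0 < m)%R by rewrite !lt_min d0 d'0 divr_gt0.
  have me : (m < e)%R by rewrite gt_min ltr_pdivrMr// ltr_pMr// ltr1n.
  apply: le_trans (le_hausdorff_pre2 _ m0).
  apply: le_trans (hausdorff_preU _ AB); last by rewrite m0 me.
  by apply: leeD; apply: ge_hausdorff_pre; rewrite /m !ge_min lexx ?orbT.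
have [->|] := eqVneq (hausdorff2 (A `|` B)) +oo; first exact: leey.
rewrite -ltey => ABoo.
have fB : hausdorff2 B \is a fin_num.
  rewrite ge0_fin_numE//; apply: le_lt_trans ABoo.
  by apply: le_hausdorff2; exact: subsetUr.
rewrite -leeBrDr//; apply: ge_ereal_sup => _ [d d0 <-].
have fA : hausdorff_pre d A \is a fin_num.
  rewrite ge0_fin_numE ?hausdorff_pre_ge0//.
  apply: le_lt_trans ABoo; apply: (le_trans (le_hausdorff_pre2 _ d0)).
  by apply: le_hausdorff2; exact: subsetUl.
rewrite leeBrDr// addeC -leeBrDr//; apply: ge_ereal_sup => _ [d' d'0 <-].
by rewrite leeBrDr// addeC; exact: H.
Qed.

Lemma enorm_sep (p : R3 R -> R) (a b : R) A B : (a < b)%R ->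
  (forall x y, (`|p x - p y| <= enorm (x - y))%R) ->
  (forall x, A x -> (b <= p x)%R) -> (forall y, B y -> (p y <= a)%R) ->
  hausdorff2 A + hausdorff2 B <= hausdorff2 (A `|` B).
Proof.
move=> ab p1 Ab Ba; apply: (@hausdorff2U (b - a)%R); first by rewrite subr_gt0.
move=> x y /Ab bx /Ba ya; apply: le_trans (p1 _ _).
by apply: le_trans (ler_norm _); rewrite lerB.
Qed.

Lemma hausdorff2_halfspace (p : R3 R -> R) (c : R) :
  (forall x y, (`|p x - p y| <= enorm (x - y))%R) ->
  hausdorff2.-caratheodory [set x | (c < p x)%R].
Proof.
move=> p1; set A := [set x | _]; apply: le_caratheodory_measurable => X /=.
have [->|] := eqVneq (hausdorff2 X) +oo; first exact: leey.
rewrite -ltey => Xoo.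
pose t n : R := (c + n.+1%:R^-1)%R.
have t_lt m n : (m < n)%N -> (t n < t m)%R.
  by move=> mn; rewrite ltrD2l ltf_pV2 ?posrE ?ltr0n// ltr_nat ltnS.
pose D n := X `&` [set x | (t n < p x)%R].
pose S n := X `&` [set x | (t n.+1 < p x <= t n)%R].
have D0 n : hausdorff2 (D n) + hausdorff2 (X `&` ~` A) <= hausdorff2 X.
  apply: (@le_trans _ _ (hausdorff2 (D n `|` X `&` ~` A))).
    apply: (@enorm_sep p c (t n)) => //.
    - by rewrite ltrDl invr_gt0 ltr0n.
    - by move=> x [_ /ltW].
    - by move=> y [_ /negP]; rewrite -leNgt.
  by apply: le_hausdorff2 => x [[]|[]].
have DS n : hausdorff2 (D n) + hausdorff2 (S n.+1) <= hausdorff2 (D n.+2).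
  apply: (@le_trans _ _ (hausdorff2 (D n `|` S n.+1))).
    apply: (@enorm_sep p (t n.+1) (t n)) => //; first exact: t_lt.
    - by move=> x [_ /ltW].
    - by move=> y [_ /andP[]].
  apply: le_hausdorff2 => x [[Xx tx]|[Xx /andP[]]//]; split=> //=.
  by apply: lt_trans tx; exact: t_lt.
have SX b n : \sum_(k < n) hausdorff2 (S (b + k.*2)%N) <= hausdorff2 X.
  suff : \sum_(k < n.+1) hausdorff2 (S (b + k.*2)%N) <=
         hausdorff2 (D (b + n.*2).+1).
    move=> H; apply: le_trans (_ : hausdorff2 (D (b + n.*2).+1) <= _).
      by apply: le_trans H; rewrite big_ord_recr/= leeDl.
    by apply: le_hausdorff2 => x [].
  elim: n => [|n ih].
    rewrite big_ord_recl big_ord0 adde0 addn0; apply: le_hausdorff2.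
    by move=> x [Xx /andP[]].
  rewrite big_ord_recr/= doubleS !addnS; apply: le_trans (DS _).
  exact: leeD2r.
have Sfin : \sum_(k <oo) hausdorff2 (S k) < +oo.
  apply: (@le_lt_trans _ _ (hausdorff2 X + hausdorff2 X)); last first.
    by rewrite lte_add_pinfty.
  apply: lime_le; first exact: is_cvg_nneseries.
  near=> n.
  have half m : \sum_(k < m.*2) hausdorff2 (S k) =
      \sum_(k < m) hausdorff2 (S (0 + k.*2)%N) +
      \sum_(k < m) hausdorff2 (S (1 + k.*2)%N).
    elim: m => [|m ih]; first by rewrite !big_ord0 adde0.
    rewrite doubleS !big_ord_recr/= ih !add0n !add1n -!addeA; congr (_ + _).
    by rewrite addeCA.
  rewrite big_mkord; apply: (@le_trans _ _ (\sum_(k < n.*2) hausdorff2 (S k))).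
    rewrite -!(big_mkord xpredT (fun k => hausdorff2 (S k))).
    by apply: lee_sum_nneg_natr => //; rewrite -addnn leq_addr.
  by rewrite half; apply: leeD; exact: SX.
have AD n : hausdorff2 (X `&` A) + hausdorff2 (X `&` ~` A) <=
    hausdorff2 X + \sum_(n <= k <oo) hausdorff2 (S k).
  apply: le_trans (leeD2r _ (D0 n)); rewrite addeAC; apply: leeD2r.
  apply: (@le_trans _ _ (hausdorff2 (D n `|` \bigcup_(k in ~` `I_n) S k))).
    apply: le_hausdorff2 => x [Xx Ax].
    have [tx|tx] := ltP (t n) (p x); first by left.
    right.
    have [m tm] : exists m, (t m < p x)%R.
      have pxc : (0 < p x - c)%R by rewrite subr_gt0.
      exists (Num.bound (p x - c)^-1); rewrite /t -ltrBrDl invf_plt ?posrE//.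
      apply: lt_trans (_ : (Num.bound (p x - c)^-1)%:R < _)%R.
        by rewrite archi_boundP// invr_ge0 ltW.
      by rewrite ltr_nat.
    have [k tk kmin] := ex_minnP (ex_intro (fun m => t m < p x)%R m tm).
    case: k tk kmin => [|k] tk kmin.
      have := lt_le_trans tk tx; rewrite ltNge; case: n tx => [|n] _.
        by rewrite lexx.
      by rewrite ltW// t_lt.
    have kn : (n <= k)%N.
      rewrite leqNgt; apply/negP => kn.
      have : (t n <= t k.+1)%R.
        move: kn; rewrite leq_eqVlt => /predU1P[->//|kn].
        by rewrite ltW// t_lt.
      by move=> /le_lt_trans /(_ tk); rewrite ltNge tx.
    exists k; first by rewrite /= ltnNge kn.
    split=> //=; rewrite tk/= leNgt; apply/negP => /kmin.
    by rewrite ltnn.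
  apply: (le_trans (outer_measureU2 _ _ _)); apply: leeD2l.
  exact: outer_measure_sigma_subadditive_tail.
have tail0 : (fun n => \sum_(n <= k <oo) hausdorff2 (S k)) @ \oo --> 0.
  by apply: nneseries_tail_cvg Sfin _ => k _; exact: hausdorff2_ge0.
have : (fun n => hausdorff2 X + \sum_(n <= k <oo) hausdorff2 (S k)) @ \oo -->
    hausdorff2 X + 0.
  apply: cvgeD => //; [|exact: cvg_cst].
  by rewrite fin_num_adde_defl.
rewrite adde0 => cX; rewrite -(cvg_lim _ cX)//; apply: lime_ge.
  by apply/cvg_ex; exists (hausdorff2 X).
by near=> n; exact: AD.
Unshelve. all: by end_near. Qed.

Let measurable_coord_cara (p : R3 R -> measurableTypeR R) :
  (forall x y, (`|p x - p y| <= enorm (x - y))%R) ->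
  measurable_fun setT (p : caratheodory_type hausdorff2 -> measurableTypeR R).
Proof.
move=> p1; apply: (measurability _ (RGenOInfty.measurableE R)) => //.
move=> /= _ [_ [c ->] <-]; rewrite setTI.
have -> : p @^-1` `]c, +oo[ = [set x | (c < p x)%R].
  by apply/seteqP; split=> x /=; rewrite in_itv/= andbT.
exact: hausdorff2_halfspace.
Qed.

Let measurable_cara (A : set (R3 R)) :
  measurable A -> hausdorff2.-caratheodory A.
Proof.
move=> mA.
have mid : measurable_fun setT
    (fun x : caratheodory_type hausdorff2 => ((x.1.1, x.1.2), x.2) : R3 R).
  apply: measurable_fun_pair; first apply: measurable_fun_pair.
  - by apply: measurable_coord_cara => x y; exact: (le_enorm1 (x - y)%R).
  - by apply: measurable_coord_cara => x y; exact: (le_enorm2 (x - y)%R).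
  - by apply: measurable_coord_cara => x y; exact: (le_enorm3 (x - y)%R).
have := mid measurableT _ mA; rewrite setTI.
by congr (_.-caratheodory _); apply/seteqP; split=> -[[]].
Qed.

Let hausdorff2_sigma_additive : semi_sigma_additive hausdorff2.
Proof.
move=> F mF tF mUF; apply: caratheodory_measure_sigma_additive => //.
- by move=> i; exact: measurable_cara.
- exact: measurable_cara.
Qed.

HB.instance Definition _ := isMeasure.Build _ _ _ hausdorff2
  hausdorff20 hausdorff2_ge0 hausdorff2_sigma_additive.


End hausdorff_measure.

Section lipschitz_domain.
Context {R : realType}.
Implicit Types (X : set (R3 R)) (x y p n w : R3 R).

Definition boundary X : set (R3 R) := closure X `\` interior X.

(* around each boundary point, in suitable orthonormal coordinates, X is the
   strict epigraph of a Lipschitz function of two variables *)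
Definition lipschitz_boundary X := forall p, boundary X p ->
  exists (a b c : R3 R) (zeta : R * R -> R) (r : R),
    [/\ [/\ enorm a = 1, enorm b = 1 & enorm c = 1],
        [/\ dot a b = 0, dot a c = 0 & dot b c = 0],
        lipschitz zeta, 0 < r &
        forall x, enorm (x - p) < r ->
          (X x <-> zeta (dot (x - p) a, dot (x - p) b) < dot (x - p) c)].

Definition bounded_lipschitz_domain X :=
  [/\ X !=set0, open X, connected X, bounded_set X & lipschitz_boundary X].

(* n is a unit vector and, to first order at x, X is the half-space
   (y - x) . n < 0 *)
Definition is_outward_normal X x n := enorm n = 1 /\
  forall eps : R, 0 < eps -> exists2 r : R, 0 < r &
    forall y, 0 < enorm (y - x) < r ->
      (dot (y - x) n < - eps * enorm (y - x) -> X y) /\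
      (dot (y - x) n > eps * enorm (y - x) -> ~ X y).

(* n_x; it is 0 on the (null) set of boundary points with no normal, which
   are therefore not in gamma_minus *)
Definition outward_normal X x : R3 R := xget 0 (is_outward_normal X x).

Definition gamma_minus X : set (R3 R * R3 R) :=
  [set z | [/\ boundary X z.1, sphere z.2 &
               dot (outward_normal X z.1) z.2 < 0]].

End lipschitz_domain.

Section measures.
Local Open Scope ereal_scope.
Context {R : realType}.

Lemma sigma_finite_prod d1 d2 (T1 : measurableType d1) (T2 : measurableType d2)
  (m1 : {measure set T1 -> \bar R}) (m2 : {sigma_finite_measure set T2 -> \bar R}) :
  sigma_finite setT m1 -> sigma_finite setT (m1 \x m2).
Proof.
move=> /sigma_finiteP[F [TF ndF Foo]].
have /sigma_finiteP[G [TG ndG Goo]] := sigma_finiteT m2.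
exists (fun n => F n `*` G n).
  rewrite -setXTT TF TG predeqE => -[x y]; split.
    move=> [/= [n _ Fnx] [k _ Gky]]; exists (maxn n k) => //; split.
    - by move: x Fnx; exact/subsetPset/ndF/leq_maxl.
    - by move: y Gky; exact/subsetPset/ndG/leq_maxr.
  by move=> [n _ []/= ? ?]; split; exists n.
move=> k; have [? ?] := Foo k; have [? ?] := Goo k.
split; first exact: measurableX.
by rewrite product_measure1E// lte_mul_pinfty// ge0_fin_numE.
Qed.

Definition lebesgue3 : set (R3 R) -> \bar R :=
  lebesgue_measure \x lebesgue_measure \x lebesgue_measure.
Let l := @lebesgue_measure R.
Let l3 : {measure set (R3 R) -> \bar R} := l \x l \x l.

HB.instance Definition _ := isMeasure.Build _ _ _ lebesgue3
  (measure0 l3) (measure_ge0 l3) (@measure_semi_sigma_additive _ _ _ l3).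
Let s3 : sigma_finite setT lebesgue3.
Proof. by apply: sigma_finite_prod; apply: sigma_finite_prod; exact: sigma_finiteT. Qed.
HB.instance Definition _ := Measure_isSigmaFinite.Build _ _ _ lebesgue3 s3.

Definition sphere_measure : set (R3 R) -> \bar R :=
  mrestr hausdorff2 measurable_sphere.

HB.instance Definition _ := Measure.on sphere_measure.

End measures.

Section bounded_operator_on_L2.
Local Open Scope ereal_scope.
Context d (T : measurableType d) (R : realType).
Variables (mu : set T -> \bar R) (D : set T).

Definition square_integrable (f : T -> R) :=
  measurable_fun D f /\ \int[mu]_(x in D) (f x ^+ 2)%:E < +oo.

(* A acts on functions, not on classes: linearity is only required almost
   everywhere, and A respects a.e. equality by the last two clauses *)
Definition bounded_linear_L2 (A : (T -> R) -> (T -> R)) :=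
  [/\ forall f, square_integrable f -> square_integrable (A f),
      forall (a : R) f g, square_integrable f -> square_integrable g ->
        {ae mu, forall x, D x ->
          A (fun y => a * f y + g y)%R x = (a * A f x + A g x)%R} &
      exists C : R, forall f, square_integrable f ->
        \int[mu]_(x in D) (A f x ^+ 2)%:E <=
        C%:E * \int[mu]_(x in D) (f x ^+ 2)%:E].

End bounded_operator_on_L2.

Section transport.
Context {R : realType}.
Implicit Types (X : set (R3 R)) (x w : R3 R) (f : R3 R -> R3 R -> R)
  (phi psi h : R -> R3 R -> R3 R -> R).

(* S at a fixed position x is scattering (g x) *)
Definition scattering (k : R -> R) (u : R3 R -> R) (w : R3 R) : R :=
  \int[sphere_measure]_(w' in sphere) (k (dot w w') * u w').

Definition normalized X (g : R3 R -> R -> R) := forall x, X x ->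
  [/\ lebesgue_measure.-integrable `[-1, 1] (fun s => (g x s)%:E),
      2 * pi * \int[lebesgue_measure]_(s in `[-1, 1]) g x s = 1 &
      forall w, sphere w ->
        sphere_measure.-integrable sphere (fun w' => (g x (dot w w'))%:E) /\
        \int[sphere_measure]_(w' in sphere) g x (dot w w') = 1].

Definition transport_op (sigma_a sigma_s : R) (g : R3 R -> R -> R) f x w : R :=
  sigma_s * scattering (g x) (f x) w - (sigma_a + sigma_s) * f x w.

Definition gradient (u : R3 R -> R) x : R3 R :=
  ('D_e1 u x, 'D_e2 u x, 'D_e3 u x).

Definition closed_cylinder (T : R) X : set (R * R3 R * R3 R) :=
  [set z | [/\ 0 <= z.1.1 <= T, closure X z.1.2 & sphere z.2]].

(* psi_t and psi_x are the time derivative (one-sided at t = 0 and t = T) and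
   the spatial gradient of psi; the latter is a classical gradient on the open
   set X and its values on the boundary are those of its continuous extension *)
Definition C1_up_to_boundary (T : R) X psi (psi_t : R -> R3 R -> R3 R -> R)
    (psi_x : R -> R3 R -> R3 R -> R3 R) :=
  [/\ {within closed_cylinder T X, continuous (fun z => psi z.1.1 z.1.2 z.2)},
      {within closed_cylinder T X, continuous (fun z => psi_t z.1.1 z.1.2 z.2)},
      {within closed_cylinder T X, continuous (fun z => psi_x z.1.1 z.1.2 z.2)},
      forall t x w, closed_cylinder T X (t, x, w) ->
        (psi s x w - psi t x w) / (s - t) @[s --> within `[0, T] t^']
          --> psi_t t x w &
      forall t x w, 0 <= t <= T -> X x -> sphere w ->
        [/\ is_derive x e1 (fun y => psi t y w) (psi_x t x w).1.1,
            is_derive x e2 (fun y => psi t y w) (psi_x t x w).1.2 &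
            is_derive x e3 (fun y => psi t y w) (psi_x t x w).2]].

Definition transport_solution (T : R) X sigma_a sigma_s g (psi0 : R3 R -> R3 R -> R) h psi
    (psi_t : R -> R3 R -> R3 R -> R) (psi_x : R -> R3 R -> R3 R -> R3 R) :=
  [/\ forall t x w, 0 <= t <= T -> X x -> sphere w ->
        psi_t t x w + dot w (psi_x t x w) =
        transport_op sigma_a sigma_s g (psi t) x w,
      forall x w, X x -> sphere w -> psi 0 x w = psi0 x w &
      forall t x w, 0 <= t <= T -> gamma_minus X (x, w) ->
        psi t x w = h t x w].

Local Open Scope ereal_scope.

Definition loss_GE (T : R) X sigma_a sigma_s g phi : \bar R :=
  \int[lebesgue_measure]_(t in `[0%R, T]) \int[lebesgue3]_(x in X)
    \int[sphere_measure]_(w in sphere)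
      ((derive1 (fun s => phi s x w) t + dot w (gradient (fun y => phi t y w) x)
        - transport_op sigma_a sigma_s g (phi t) x w) ^+ 2)%:E.

Definition loss_IC X (psi0 : R3 R -> R3 R -> R) phi : \bar R :=
  \int[lebesgue3]_(x in X) \int[sphere_measure]_(w in sphere)
    ((phi 0%R x w - psi0 x w) ^+ 2)%:E.

Definition loss_BC (T : R) X h phi : \bar R :=
  \int[lebesgue_measure]_(t in `[0%R, T])
    \int[hausdorff2 \x sphere_measure]_(z in gamma_minus X)
      ((phi t z.1 z.2 - h t z.1 z.2) ^+ 2)%:E.

Definition loss_total (T : R) X sigma_a sigma_s g (psi0 : R3 R -> R3 R -> R) h
    phi : \bar R :=
  loss_GE T X sigma_a sigma_s g phi + loss_IC X psi0 phi + loss_BC T X h phi.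

End transport.

Section neural_networks.
Context {R : realType}.

(* m_l, w^(k)_ji and b^(k)_j; layers k are numbered from 1 but the neurons i, j
   of a layer from 0. Entries with an index out of range are not used. *)
Record nn_params := NNParams {
  width : nat -> nat;
  weight : nat -> nat -> nat -> R;
  bias : nat -> nat -> R }.

Definition admissible_params (L : nat) (p : nn_params) :=
  [/\ width p 0 = 7%N, width p L = 1%N &
      forall l, (0 < l < L)%N -> (0 < width p l)%N].

Definition C1_activation (f : R -> R) :=
  (forall x, derivable f x 1) /\ continuous (derive1 f).

Definition nonpolynomial (f : R -> R) :=
  ~ exists q : {poly R}, forall x, f x = q.[x].

(* nn_theta k is theta^(k+1) *)
Fixpoint nn_theta (act : nat -> R -> R) (p : nn_params) (y : seq R)
    (k j : nat) : R :=
  \sum_(i < width p k) (weight p k.+1 j i *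
    (if k is l.+1 then act k (nn_theta act p y l i) else y`_i))
  + bias p k.+1 j.

Definition psi_nn (act : nat -> R -> R) (L : nat) (p : nn_params)
    (t : R) (x w : R3 R) : R :=
  nn_theta act p [:: t; x.1.1; x.1.2; x.2; w.1.1; w.1.2; w.2] L.-1 0%N.

End neural_networks.
Arguments nn_params : clear implicits.

(* Main.v *)
(** A network that is close to [psi] in C^1 on the closed cylinder has a small
    loss: its residual is, up to a uniformly small term, [L] applied to a uniformly
    small function, and [L] is bounded on L^2 of a space of finite measure. The
    density of the networks in C^1 is obtained in three steps.
    - Near a point of the closure of [X], shrinking time and shifting space in the
      direction given by the Lipschitz chart turns [psi] into a function which is
      C^1 on a neighbourhood, hence a limit in C^1 of Bernstein polynomials;
      finitely many of these are glued by polynomials close to smoothed step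
      functions of the squared distance.
    - By a theorem of Frechet an iterated difference of a non-polynomial function
      is not constantly 0, so for every order n the constants are multiples of
      ridge functions of n-th differences of the first activation function.
      Differentiating a primitive of a ridge function with respect to a weight
      multiplies it by a coordinate, at the cost of one difference, so all
      polynomials are limits of networks with one hidden layer.
    - A further layer with one neuron is nearly the identity, after an affine change
      of variables around a point where its activation function has a nonzero
      derivative. *)

Require Import Defs.
From HB Require Import structures.
From mathcomp Require Import all_boot all_order all_algebra.
From mathcomp Require Import all_classical all_reals all_analysis.
From mathcomp Require Import measurable_realfun ring lra.

Set Implicit Arguments.
Unset Strict Implicit.
Unset Printing Implicit Defensive.
Import Order.TTheory GRing.Theory Num.Theory.
Import numFieldNormedType.Exports.

Local Open Scope classical_set_scope.
Local Open Scope ring_scope.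

(** Two obstacles shape the proof. The solution lives on a set with boundary in [t] and [x] and on a
    sphere in the direction. No C^1 extension theorem is invoked: only the derivatives in [t] and
    [x] are approximated, the direction is extended radially with mere continuity, and the shrunken
    solution is set to 0 where it is undefined. The price is a target that is merely bounded away
    from the region of interest, with difference quotients there as large as the number N of nodes.
    A second moment, of order 1/N, would only leave a bounded error; a fourth moment, of order
    1/N^2, makes it vanish. The activation functions are only C^1, so monomials cannot be produced
    by repeated differentiation in the weights. Integrating once before each differentiation keeps
    the regularity at C^1, and increments of a primitive are within reach of the span as Riemann
    sums. In the losses, the data and [gamma_minus X] are not known to be measurable: integrals are
    compared by monotonicity with measurable majorants, possibly on larger sets. *)

(** * Uniform estimates on compact sets and in one variable *)

(** A Heine-Cantor theorem in which only one of the two points has to lie in the compact set: [A] is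
    the whole line for functions on R, and the cylinder itself for the solution, which is unknown
    outside. *)
Lemma compact_unif {R : realType} (T : pseudoMetricType R) (K A : set T)
    (f : T -> R) : compact K -> K `<=` A ->
  (forall y, K y -> f @ within A (nbhs y) --> f y) ->
  forall e, 0 < e -> exists2 d, 0 < d &
    forall y z, K y -> A z -> ball y d z -> `|f z - f y| <= e.
Proof.
move=> /compact_near_coveringP/near_covering_withinP cK KA cf e e0.
have e20 : 0 < e / 2 by rewrite divr_gt0.
have : \forall d \near (0 : R)^'+, K `<=` (fun y => forall z, A z -> ball y d z ->
    `|f z - f y| <= e).
  apply: (cK _ (0 : R)^'+ (fun d y => forall z, A z -> ball y d z -> `|f z - f y| <= e)).
  move=> y Ky.
  have /cvgrPdist_lt/(_ _ e20) := cf y Ky.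
  rewrite near_withinE => /nbhs_ballP[d /= d0 yd].
  exists (ball y (d / 2), [set d' | 0 < d' < d / 2]).
    split => /=; first by apply: nbhsx_ballx; rewrite divr_gt0.
    near=> d'; apply/andP; split; near: d'; first exact: nbhs_right_gt.
    by apply: nbhs_right_lt; rewrite divr_gt0.
  move=> [y' d'] /= [yy'] /andP[d'0 d'd] Ky' z Az y'z.
  have yz : ball y d z.
    by rewrite [d]splitr; apply: ball_triangle yy' (le_ball (ltW d'd) y'z).
  have yy2 : ball y d y' by apply: le_ball yy'; rewrite ler_pdivrMr// ler_peMr// ?ler1n// ltW.
  have := yd _ yz Az; have := yd _ yy2 (KA _ Ky') => /=.
  move=> h1 h2; rewrite [e]splitr.
  rewrite (_ : f z - f y' = (f y - f y') - (f y - f z)); last by ring.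
  by apply: le_trans (ler_normB _ _) _; rewrite lerD// ltW.
move=> H.
have [d [d0 Hd]] : exists d : R, 0 < d /\ K `<=` (fun y => forall z, A z -> ball y d z ->
    `|f z - f y| <= e).
  near (0 : R)^'+ => d; exists d; split; near: d => //.
  exact: nbhs_right_gt.
by exists d => // y z Ky Az; exact: Hd.
Unshelve. all: by end_near. Qed.

Lemma compact_bound {R : realType} (T : topologicalType) (K : set T) (f : T -> R) :
  compact K -> {within K, continuous f} ->
  exists2 B : R, 0 <= B & forall y, K y -> `|f y| <= B.
Proof.
move=> cK cf; have [M [_ MB]] := compact_bounded (continuous_compact cf cK).
exists (Num.max (M + 1) 0); first by rewrite le_max lexx orbT.
move=> y Ky; rewrite le_max MB// ?ltrDl//; by exists y.
Qed.

Section oned.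
Context {R : realType}.
Implicit Types (f df : R -> R).

Lemma uniform_continuity f : continuous f -> forall U e, 0 < e ->
  exists2 d, 0 < d &
    forall x y, `|x| <= U -> `|y - x| < d -> `|f y - f x| <= e.
Proof.
move=> cf U e e0.
have [|||d d0 H] := @compact_unif R R `[- U, U] setT f _ _ _ e e0.
- exact: segment_compact.
- by [].
- by move=> y _; apply: cvg_within_filter; exact: cf.
exists d => // x y xU yxd; apply: H => //.
  by rewrite /= in_itv/= -ler_norml.
by rewrite /ball/= distrC.
Qed.

(** The mean value theorem with [l] as approximate slope, for [a] and [b] in either order. It serves
    both for first-order expansions, with [l] the derivative at [a], and for the difference
    quotients of a Bernstein polynomial. *)
Lemma mvt_dist f df (a b l e : R) :
  (forall x, `|x - a| <= `|b - a| -> is_derive x 1 f (df x)) ->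
  (forall x, `|x - a| <= `|b - a| -> `|df x - l| <= e) ->
  `|f b - f a - l * (b - a)| <= e * `|b - a|.
Proof.
have main (u v : R) : u < v ->
    (forall x, u <= x <= v -> is_derive x 1 f (df x)) ->
    (forall x, u <= x <= v -> `|df x - l| <= e) ->
    `|f v - f u - l * (v - u)| <= e * `|v - u|.
  move=> uv fd dfl.
  have [c cuv ->] : exists2 c, c \in `]u, v[%R & f v - f u = df c * (v - u).
    apply: MVT => // [x|].
      by rewrite in_itv/= => /andP[ux xv]; apply: fd; rewrite !ltW.
    apply: derivable_within_continuous => x; rewrite in_itv/= => /fd.
    by move=> [].
  rewrite -mulrBl normrM ler_wpM2r// dfl//.
  by move: cuv; rewrite in_itv/= => /andP[uc cv]; rewrite !ltW.
move=> fd dfl; have [ab|ba|->] := ltgtP a b.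
- apply: main => // x /andP[ax xb].
    by apply: fd; rewrite !ger0_norm ?subr_ge0 ?(ltW ab)// lerB.
  by apply: dfl; rewrite !ger0_norm ?subr_ge0 ?(ltW ab)// lerB.
- rewrite -normrN (distrC b a).
  rewrite (_ : - (f b - f a - l * (b - a)) = f a - f b - l * (a - b)); last by ring.
  apply: main => // x /andP[bx xa].
    by apply: fd; rewrite !ler0_norm ?subr_le0 ?(ltW ba)// !opprB lerB.
  by apply: dfl; rewrite !ler0_norm ?subr_le0 ?(ltW ba)// !opprB lerB.
- by rewrite !subrr mulr0 subr0 normr0 mulr0.
Qed.

(** The margin 1 keeps the segment from [x] to [y] inside the range where the derivative is known;
    primitives are available only on bounded ranges. *)
Lemma linear_approx f df (U : R) : continuous df ->
  (forall x : R, `|x| <= U + 1 -> is_derive x 1 f (df x)) ->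
  forall e, 0 < e -> exists2 d, 0 < d & forall x y, `|x| <= U -> `|y - x| < d ->
    `|f y - f x - df x * (y - x)| <= e * `|y - x|.
Proof.
move=> cdf fd e e0.
have [d d0 H] := uniform_continuity cdf U e0.
exists (Num.min d 1); first by rewrite lt_min d0 ltr01.
move=> x y xU; rewrite lt_min => /andP[yxd yx1].
apply: (@mvt_dist _ df) => z zx.
  apply: fd; rewrite -(subrK x z) addrC; apply: le_trans (ler_normD _ _) _.
  by rewrite lerD// (le_trans zx)// ltW.
by apply: H => //; exact: le_lt_trans yxd.
Qed.

(** The integral starts at [- W], strictly below [- V], so every point of the range is interior to
    the interval of integration. *)
Lemma primitive f (V : R) : continuous f ->
  exists S : R -> R, forall x : R, `|x| <= V -> is_derive x 1 S (f x).
Proof.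
move=> cf; pose W := Num.max V 0 + 1.
pose S x := \int[lebesgue_measure]_(t in `[- W, x]) f t.
have W0 : 0 < W by rewrite /W -[ltLHS]add0r ler_ltD// le_max lexx orbT.
exists S => x xV.
have xW : `|x| < W by rewrite /W -[ltLHS]addr0 ler_ltD// le_max xV.
have /andP[Wx xW'] : - W < x < W by rewrite -ltr_norml.
have [|dS Sx] := @continuous_FTC1_closed R f (- W) x W xW' _ Wx (cf x).
  apply: continuous_compact_integrable; first exact: segment_compact.
  exact: continuous_subspaceT.
apply: DeriveDef; first exact: dS.
rewrite -derive1E; exact: Sx.
Qed.

End oned.

(** * Frechet's characterization of polynomials by differences *)

Section frechet.
Context {R : realType}.
Implicit Types (f u : R -> R) (q : {poly R}) (h x : R).

Definition fdiff (hs : seq R) f : R -> R :=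
  foldr (fun h g x => g (x + h) - g x) f hs.

(** By the binomial formula, the difference of [x ^+ n.+1] is [n.+1%:R * x ^+ n] plus lower powers,
    whose antidifferences are given by strong induction. *)
Lemma poly_antidifference q :
  exists Q : {poly R}, forall x, Q.[x + 1] - Q.[x] = q.[x].
Proof.
have monom n : exists Q : {poly R}, forall x, Q.[x + 1] - Q.[x] = x ^+ n.
  elim/ltn_ind: n => n ih.
  have [F FE] : {F : nat -> {poly R} &
      forall i, (i < n)%N -> forall x, (F i).[x + 1] - (F i).[x] = x ^+ i}.
    apply: (@choice _ _ (fun i (Q : {poly R}) => (i < n)%N ->
      forall x, Q.[x + 1] - Q.[x] = x ^+ i)) => i.
    by have [/ih[Q QE]|] := ltnP i n; [exists Q|exists 0].
  exists (n.+1%:R^-1 *: ('X^(n.+1) - \sum_(i < n) 'C(n.+1, i)%:R *: F i)) => x.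
  rewrite !hornerE !horner_sum -mulrBr.
  apply: (mulfI (_ : n.+1%:R != 0)); first by rewrite pnatr_eq0.
  rewrite mulVKf ?pnatr_eq0// (addrC x 1) exprDn !big_ord_recr/=.
  rewrite binn subnn !expr1n !mul1r mulr1n.
  rewrite binSn (addrC 1 x).
  rewrite (eq_bigr (fun i : 'I_n => ('C(n.+1, i)%:R *: F i).[x + 1] -
    ('C(n.+1, i)%:R *: F i).[x])) => [|i _]; last first.
    by rewrite !hornerZ -mulrBr FE// expr1n mul1r mulr_natl.
  rewrite sumrB mulr_natl; ring.
have [F FE] : {F : nat -> {poly R} & forall i x, (F i).[x + 1] - (F i).[x] = x ^+ i}.
  exact: (@choice _ _ (fun i (Q : {poly R}) => forall x, Q.[x + 1] - Q.[x] = x ^+ i)).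
exists (\sum_(i < size q) q`_i *: F i) => x.
rewrite !horner_sum -sumrB horner_coef; apply: eq_bigr => i _.
by rewrite !hornerZ -mulrBr FE.
Qed.

(** Otherwise [q - q.[0]%:P] would vanish at all natural numbers, more often than its degree
    allows. *)
Lemma poly_periodic_cst q : (forall x, q.[x + 1] = q.[x]) ->
  forall x, q.[x] = q.[0].
Proof.
move=> q1; have qn (n : nat) : q.[n%:R] = q.[0].
  by elim: n => // n <-; rewrite -natr1 q1.
suff -> : q = (q.[0])%:P by move=> x; rewrite !hornerC.
apply/eqP; rewrite -subr_eq0; apply/negPn/negP => q0.
have := @max_poly_roots _ (q - q.[0]%:P)
  [seq i%:R | i <- iota 0 (size (q - q.[0]%:P))] q0.
rewrite size_map size_iota ltnn => /(_ _ _)/negP; apply => //.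
  apply/allP => _ /mapP[i _ ->].
  by rewrite /root !hornerE qn subrr.
by rewrite map_inj_uniq ?iota_uniq//; exact: mulrIn (oner_neq0 _).
Qed.

(** By induction every difference of [f] is a polynomial. Subtracting an antidifference [Q] of the
    difference with step 1 leaves a continuous 1-periodic [u], hence a bounded one, whose increments
    [u (x + h) - u x] do not depend on [x]. Then [n%:R * (u h - u 0)] is bounded in n, so [u] is
    constant. *)
Lemma frechet (k : nat) f : continuous f ->
  (forall hs, size hs = k -> forall x, fdiff hs f x = 0) ->
  exists q, forall x, f x = q.[x].
Proof.
elim: k f => [|k ih] f cf fk.
  by exists 0 => x; rewrite horner0; exact: (fk [::]).
have fP h : exists q, forall x, f (x + h) - f x = q.[x].
  apply: ih.
    move=> x; apply: cvgB; last exact: cf.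
    by apply: (@cvg_comp _ _ _ (fun y => y + h) f); [|exact: cf];
      apply: cvgD; [exact: cvg_id|exact: cvg_cst].
  move=> hs hsk x; rewrite -(fk (rcons hs h) _ x) ?size_rcons ?hsk//.
  by rewrite /fdiff foldr_rcons.
have [q qE] := fP 1; have [Q QE] := poly_antidifference q.
pose u x := f x - Q.[x].
have u1 x : u (x + 1) = u x.
  by apply/eqP; rewrite -subr_eq0 /u; apply/eqP; move: (qE x) (QE x); lra.
have cu : continuous u.
  by move=> x; apply: cvgB; [exact: cf|exact: continuous_horner].
(* The increment is a polynomial in [x], since those of [f] and [Q] are, and it is 1-periodic: it is
   constant. *)
have uh h : forall x, u (x + h) - u x = u h - u 0.
  have [p pE] := fP h.
  pose p' := p - (Q \Po ('X + h%:P) - Q).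
  have p'E x : u (x + h) - u x = p'.[x].
    rewrite /p' /u !hornerE horner_comp !hornerE -pE; ring.
  move=> x; rewrite p'E poly_periodic_cst -?p'E ?add0r// => y.
  rewrite -!p'E (_ : y + 1 + h = y + h + 1); last by ring.
  by rewrite !u1.
have [B uB] : exists B : R, forall x, `|u x| <= B.
  have [|B _ uB] := @compact_bound R R `[0, 1] u (@segment_compact _ _ _).
    exact: continuous_subspaceT.
  have un (n : nat) y : u (y + n%:R) = u y.
    by elim: n y => [|n ihn] y; rewrite ?addr0// -natr1 addrA u1 ihn.
  exists B => x; have uz (z : int) y : u (y + z%:~R) = u y.
    case: z => n; first by rewrite -pmulrn un.
    by rewrite -[RHS](un n.+1) -[LHS](un n.+1) NegzE mulrNz -pmulrn subrK un.
  rewrite -(subrK (Num.floor x)%:~R x) uz uB//= in_itv/= subr_ge0 floor_le.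
  by have := floorD1_gt x; rewrite intrD => /ltW; rewrite lerBlDl.
have ucst h : u h = u 0.
  have un (n : nat) : u (n%:R * h) - u 0 = n%:R * (u h - u 0).
    elim: n => [|n ihn]; first by rewrite !mul0r subrr.
    by rewrite -natr1 !mulrDl !mul1r -ihn -(uh h (n%:R * h)); ring.
  apply/eqP; rewrite -subr_eq0; apply/negPn/negP; rewrite -normr_gt0 => c0.
  have B0 : 0 <= B := le_trans (normr_ge0 _) (uB 0).
  have := archi_boundP (divr_ge0 (mulr_ge0 (ler0n R 2) B0) (ltW c0)).
  rewrite ltr_pdivrMr// ltNge => /negP; apply.
  set n := Num.bound _; rewrite -[n%:R in X in X <= _]normr_nat -normrM -un.
  by rewrite (le_trans (ler_normB _ _))// mulr2n mulrDl mul1r lerD.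
by exists (Q + (u 0)%:P) => x; rewrite hornerD hornerC -(ucst x) addrC subrK.
Qed.
End frechet.

(** * Density of ridge functions *)

Definition upd {T : Type} (y : nat -> T) i v : nat -> T :=
  fun j => if j == i then v else y j.

Section jets.
Context {R : realType}.
Implicit Types (y a : nat -> R).

(* A function [F 0] of finitely many coordinates of [y] with a candidate
   [F i.+1] for its partial derivative in [y i]. *)
Definition jet := nat -> (nat -> R) -> R.
Implicit Types (F G H : jet) (A : jet -> Prop) (K : set (nat -> R)).

Definition jcst (c : R) : jet := fun j y => if j is _.+1 then 0 else c.
Definition jadd F G : jet := fun j y => F j y + G j y.
Definition jscale c F : jet := fun j y => c * F j y.
Definition jmulX i F : jet := fun j y =>
  if j is k.+1 then (k == i)%:R * F 0 y + y i * F k.+1 y else y i * F 0 y.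

Definition jclose d K (e : R) F G :=
  forall y j, K y -> (j <= d)%N -> `|F j y - G j y| <= e.

Definition approximable d K A F :=
  forall e : R, 0 < e -> exists2 G, A G & jclose d K e G F.

Definition box d (M : R) : set (nat -> R) :=
  [set y | forall i, (i < d)%N -> `|y i| <= M].

(** Multiplication is only by a coordinate, the one product under which the closed spans of ridge
    functions will be seen to be stable. General products are recovered in [jpoly_mul]. *)
Inductive jpoly d : jet -> Prop :=
| jpoly_cst c : jpoly d (jcst c)
| jpoly_add F G : jpoly d F -> jpoly d G -> jpoly d (jadd F G)
| jpoly_mulX i F : (i < d)%N -> jpoly d F -> jpoly d (jmulX i F).

Section approximable.
Variables (d : nat) (K : set (nat -> R)) (A : jet -> Prop).

Lemma approximable_in F : A F -> approximable d K A F.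
Proof. by move=> AF e e0; exists F => // y j _ _; rewrite subrr normr0 ltW. Qed.

Lemma approximable_lim F :
  (forall e : R, 0 < e -> exists2 G, approximable d K A G & jclose d K e G F) ->
  approximable d K A F.
Proof.
move=> H e e0; have e20 : 0 < e / 2 by rewrite divr_gt0.
have [G AG GF] := H _ e20; have [G' AG' GG'] := AG _ e20.
exists G' => // y j Ky jd; rewrite [e]splitr -(subrK (G j y) (G' j y)) -addrA.
by apply: le_trans (ler_normD _ _) _; rewrite lerD ?GG' ?GF.
Qed.

Lemma approximable_ext F G : (forall y j, K y -> (j <= d)%N -> F j y = G j y) ->
  approximable d K A F -> approximable d K A G.
Proof.
move=> FG AF; apply: approximable_lim => e e0; exists F => // y j Ky jd.
by rewrite FG// subrr normr0 ltW.
Qed.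

Lemma approximable_add F G : (forall F G, A F -> A G -> A (jadd F G)) ->
  approximable d K A F -> approximable d K A G -> approximable d K A (jadd F G).
Proof.
move=> AD AF AG e e0; have e20 : 0 < e / 2 by rewrite divr_gt0.
have [F' AF' FF'] := AF _ e20; have [G' AG' GG'] := AG _ e20.
exists (jadd F' G'); first exact: AD.
move=> y j Ky jd; rewrite /jadd opprD addrACA [e]splitr.
by apply: le_trans (ler_normD _ _) _; rewrite lerD ?FF' ?GG'.
Qed.

Lemma approximable_scale c F : (forall c F, A F -> A (jscale c F)) ->
  approximable d K A F -> approximable d K A (jscale c F).
Proof.
move=> AZ AF e e0; have c1 : 0 < `|c| + 1 by rewrite ltr_wpDl.
have [F' AF' FF'] := AF _ (divr_gt0 e0 c1).
exists (jscale c F'); first exact: AZ.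
move=> y j Ky jd; rewrite /jscale -mulrBr normrM.
apply: le_trans (_ : (`|c| + 1) * (e / (`|c| + 1)) <= _).
  by rewrite ler_pM// ?lerDl ?FF'.
by rewrite mulrCA mulfV ?mulr1// gt_eqF.
Qed.

End approximable.

Definition lin d a y : R := \sum_(i < d) a i * y i.

Definition ridge d (f df : R -> R) a b : jet := fun j y =>
  if j is k.+1 then a k * df (lin d a y + b) else f (lin d a y + b).

Section fdiff.
Implicit Types f df : R -> R.

Lemma fdiff_continuous hs f : continuous f -> continuous (fdiff hs f).
Proof.
move=> cf; elim: hs => //= h hs ih x; apply: cvgB; last exact: ih.
by apply: (@cvg_comp _ _ _ (fun z => z + h) (fdiff hs f)); [|exact: ih];
  apply: cvgD; [exact: cvg_id|exact: cvg_cst].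
Qed.

Lemma fdiff_derive hs f df : (forall x : R, is_derive x 1 f (df x)) ->
  forall x : R, is_derive x 1 (fdiff hs f) (fdiff hs df x).
Proof.
move=> fd; elim: hs => //= h hs ih x; apply: is_deriveB.
have := @is_derive1_comp R (fdiff hs f) (fun z => z + h) x
  (fdiff hs df (x + h)) 1 (ih _).
rewrite mulr1; apply; rewrite -[1 in X in is_derive _ _ _ X]addr0.
exact: is_deriveD.
Qed.

End fdiff.

(** The increment of [f] telescopes over [N.+1] equal steps, each close to its first-order term. The
    rank [N0] is uniform in [x], as is necessary when [x] is replaced by the argument of a ridge
    function. *)
Lemma riemann_sum (f df : R -> R) (V h : R) : continuous df ->
  (forall x : R, `|x| <= V + `|h| + 1 -> is_derive x 1 f (df x)) ->
  forall e, 0 < e -> exists N0, forall N, (N0 <= N)%N -> forall x, `|x| <= V ->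
  `|\sum_(m < N.+1) (h / N.+1%:R) * df (x + m%:R * (h / N.+1%:R)) -
     (f (x + h) - f x)| <= e.
Proof.
move=> cdf fd e e0; have h1 : 0 < `|h| + 1 by rewrite ltr_wpDl.
have [d d0 H] := linear_approx cdf fd (divr_gt0 e0 h1).
exists (Num.bound (`|h| / d)) => N N0N x xV.
set k := h / N.+1%:R.
have kd : `|k| < d.
  rewrite /k normrM normfV normr_nat ltr_pdivrMr ?ltr0n// mulrC -ltr_pdivrMr//.
  apply: lt_le_trans (archi_boundP _) _; first by rewrite divr_ge0// ltW.
  by rewrite ler_nat leqW.
have -> : f (x + h) - f x =
    \sum_(m < N.+1) (f (x + m.+1%:R * k) - f (x + m%:R * k)).
  rewrite -(big_mkord xpredT (fun m => f (x + m.+1%:R * k) - f (x + m%:R * k))).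
  rewrite telescope_sumr// mul0r addr0 /k mulrC divfK// pnatr_eq0.
rewrite -sumrB; apply: le_trans (ler_norm_sum _ _ _) _.
apply: le_trans (_ : \sum_(m < N.+1) e / (`|h| + 1) * `|k| <= _).
  apply: ler_sum => m _.
  have kE : x + m.+1%:R * k - (x + m%:R * k) = k by rewrite -natr1; ring.
  have := H (x + m%:R * k) (x + m.+1%:R * k); rewrite kE => /(_ _ kd) Hm.
  rewrite distrC (mulrC k); apply: Hm.
  apply: le_trans (ler_normD _ _) _; rewrite lerD// normrM normr_nat.
  rewrite /k normrM normfV normr_nat mulrCA ler_piMr// ler_pdivrMr ?ltr0n//.
  by rewrite mul1r ler_nat ltnW.
rewrite sumr_const card_ord -mulr_natl mulrCA /k normrM normfV normr_nat.
rewrite (mulrC `|h|) mulVKf ?pnatr_eq0// -mulrA ler_piMr ?(ltW e0)//.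
by rewrite mulrC ler_pdivrMr// mul1r lerDl.
Qed.

End jets.

Section ridge_span.
Context {R : realType}.
Variables (d : nat) (M : R) (f df : R -> R).
Hypothesis M0 : 0 <= M.
Hypothesis fdf : forall x : R, is_derive x 1 f (df x).
Hypothesis cdf : continuous df.
Implicit Types (y a : nat -> R) (F G : @jet R) (n : nat).

Let cf : continuous f.
Proof. by move=> x; apply/differentiable_continuous/derivable1_diffP; case: (fdf x). Qed.

(** The steps [hs] may differ from one generator to the next; only their number [n] is prescribed.
    It counts how many more multiplications by a coordinate are affordable. *)
Inductive rspan n : @jet R -> Prop :=
| rspan0 : rspan n (jcst 0)
| rspan_cons F c hs a b : size hs = n -> rspan n F ->
    rspan n (jadd F (jscale c (ridge d (fdiff hs f) (fdiff hs df) a b))).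

Lemma rspanD n F G : rspan n F -> rspan n G -> rspan n (jadd F G).
Proof.
move=> rF; elim => [|{}G c hs a b hsn _ ih].
  rewrite (_ : jadd _ _ = F)//; apply/funext => -[|j]; apply/funext => y;
  by rewrite /jadd addr0.
rewrite (_ : jadd _ _ = jadd (jadd F G)
  (jscale c (ridge d (fdiff hs f) (fdiff hs df) a b))); first exact: rspan_cons.
by apply/funext => j; apply/funext => y; rewrite /jadd addrA.
Qed.

Lemma rspanZ n c F : rspan n F -> rspan n (jscale c F).
Proof.
elim => [|{}F c' hs a b hsn _ ih].
  rewrite (_ : jscale _ _ = jcst 0); first exact: rspan0.
  by apply/funext => -[|j]; apply/funext => y; rewrite /jscale mulr0.
rewrite (_ : jscale _ _ = jadd (jscale c F)
  (jscale (c * c') (ridge d (fdiff hs f) (fdiff hs df) a b))); first exact: rspan_cons.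
by apply/funext => j; apply/funext => y; rewrite /jadd /jscale mulrDr mulrA.
Qed.

Lemma rspan_ridge hs a b : rspan (size hs) (ridge d (fdiff hs f) (fdiff hs df) a b).
Proof.
rewrite (_ : ridge _ _ _ _ _ =
  jadd (jcst 0) (jscale 1 (ridge d (fdiff hs f) (fdiff hs df) a b))).
  exact/rspan_cons/rspan0.
by apply/funext => -[|j]; apply/funext => y; rewrite /jadd /jscale mul1r add0r.
Qed.

Definition cspan n : @jet R -> Prop := approximable d (box d M) (rspan n).

Lemma cspanD n F G : cspan n F -> cspan n G -> cspan n (jadd F G).
Proof. by apply: approximable_add; exact: rspanD. Qed.

Lemma cspanZ n c F : cspan n F -> cspan n (jscale c F).
Proof. by apply: approximable_scale; exact: rspanZ. Qed.

Lemma cspan_sum n N (F : nat -> @jet R) : (forall m, cspan n (F m)) ->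
  cspan n (fun j y => \sum_(m < N) F m j y).
Proof.
move=> cF; elim: N => [|N ih].
  apply: (@approximable_ext _ _ _ _ (jcst 0)).
    by move=> y [|j] _ _; rewrite big_ord0.
  exact/approximable_in/rspan0.
apply: approximable_ext (cspanD ih (cF N)) => y j _ _.
by rewrite big_ord_recr.
Qed.

Definition delta1 i : nat -> R := fun j => (j == i)%:R.

Lemma linD a a' y : lin d (fun j => a j + a' j) y = lin d a y + lin d a' y.
Proof. by rewrite /lin -big_split; apply: eq_bigr => i _; rewrite mulrDl. Qed.

Lemma linZ (c : R) a y : lin d (fun j => c * a j) y = c * lin d a y.
Proof. by rewrite /lin mulr_sumr; apply: eq_bigr => i _; rewrite mulrA. Qed.

Lemma lin_delta1 i y : (i < d)%N -> lin d (delta1 i) y = y i.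
Proof.
move=> id; rewrite /lin (bigD1 (Ordinal id))//= /delta1 eqxx mul1r big1 ?addr0//.
by move=> j ji; rewrite (_ : _ == _ = false) ?mul0r//; apply: contraNF ji.
Qed.

Lemma lin_bound a : exists2 U, 0 <= U & forall y, box d M y -> `|lin d a y| <= U.
Proof.
exists (\sum_(i < d) `|a i| * M); first by apply: sumr_ge0 => i _; rewrite mulr_ge0.
move=> y yM; apply: le_trans (ler_norm_sum _ _ _) _; apply: ler_sum => i _.
by rewrite normrM ler_wpM2l// yM.
Qed.

Section step.
Variables (hs : seq R) (h b : R).
Let g := fdiff hs f.
Let dg := fdiff hs df.
Let gdg (x : R) : is_derive x 1 g (dg x) := fdiff_derive hs fdf x.
Let cdg : continuous dg := fdiff_continuous cdf.
Let cg : continuous g := fdiff_continuous cf.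

Let window S a : @jet R := fun j y => let u := lin d a y + b in
  if j is k.+1 then a k * (g (u + h) - g u) else S (u + h) - S u.

(** [S (u + h) - S u] is the integral of [g] over a window of length [h]. Its Riemann sums are
    combinations of ridge functions of [g] with shifted biases, and the derivatives of these sums
    are Riemann sums of [dg]; one [N] serves for both. *)
Let cspan_window S a U :
  (forall x : R, `|x| <= U + `|h| + 1 -> is_derive x 1 S (g x)) ->
  (forall y, box d M y -> `|lin d a y + b| <= U) ->
  cspan (size hs) (window S a).
Proof.
move=> Sg aU; apply: approximable_lim => e e0.
have [A A0 aA] : exists2 A : R, 0 < A & forall j, (j < d)%N -> `|a j| <= A.
  exists (1 + \sum_(i < d) `|a i|).
    by rewrite ltr_pwDl// sumr_ge0.
  move=> j jd; rewrite (bigD1 (Ordinal jd))//= addrCA lerDl addr_ge0//.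
  exact: sumr_ge0.
have [N1 H1] := riemann_sum cg Sg e0.
have [N2 H2] := @riemann_sum R g dg U h cdg (fun x _ => gdg x) _ (divr_gt0 e0 A0).
pose N := maxn N1 N2; pose k := h / N.+1%:R.
exists (fun j y => \sum_(m < N.+1)
  jscale k (ridge d g dg a (b + m%:R * k)) j y).
  by apply: (@cspan_sum _ _ (fun m => jscale k (ridge d g dg a (b + m%:R * k)))) => m;
    apply/cspanZ/approximable_in/rspan_ridge.
move=> y [|j] yM jd; rewrite /jscale/=.
  under eq_bigr do rewrite addrA.
  by apply: H1; [exact: leq_maxl|exact: aU].
under eq_bigr do rewrite mulrCA addrA.
rewrite -mulr_sumr -mulrBr normrM.
apply: le_trans (_ : A * (e / A) <= _); last by rewrite mulrC divfK// gt_eqF.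
by apply: ler_pM => //; [exact: aA|apply: H2; [exact: leq_maxr|exact: aU]].
Qed.

(* [S] is a primitive of [g]: the derivative of [S (u + h) - S u] with respect
   to the weight [a i], where [u = lin d a y + b], is [y i] times the ridge
   function of the difference of [g]. *)
Lemma cspan_mulX_ridge i a : (i < d)%N ->
  cspan (size hs) (jmulX i (ridge d (fdiff (h :: hs) f) (fdiff (h :: hs) df) a b)).
Proof.
move=> id; have [U0 U00 aU0] := lin_bound a.
pose U := U0 + `|b| + M.
have aU y (t : R) : `|t| <= 1 -> box d M y ->
    `|lin d (fun j => a j + t * delta1 i j) y + b| <= U.
  move=> t1 yM; rewrite linD linZ lin_delta1// /U addrAC.
  apply: le_trans (ler_normD _ _) _; apply: lerD.
    by apply: le_trans (ler_normD _ _) _; apply: lerD => //; exact: aU0.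
  by rewrite normrM -[M]mul1r ler_pM// yM.
have aUh y : box d M y -> `|lin d a y + b| <= U /\ `|lin d a y + b + h| <= U + `|h|.
  move=> yM; have /(_ _ yM) := aU y 0; rewrite normr0 ler01 => /(_ isT).
  rewrite linD linZ mul0r addr0 => aU1; split => //.
  by apply: le_trans (ler_normD _ _) _; rewrite lerD.
have [S SP] := primitive (U + `|h| + 1) cg.
apply: approximable_lim => e e0.
pose C := `|a 0%N| + \sum_(j < d) `|a j| + 1.
have C1 : 1 <= C by rewrite /C lerDr addr_ge0// sumr_ge0.
have aC j : (j < d)%N -> `|a j| <= C.
  move=> jd; rewrite /C (bigD1 (Ordinal jd))//= addrAC addrCA lerDl.
  by rewrite !addr_ge0// sumr_ge0.
have C0 : 0 < C := lt_le_trans ltr01 C1.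
(* The value will be off by at most [2 * (e' * M)] and a derivative by
   [2 * e' + C * (2 * (e' * M))]; as [C] is at least 1, both are below [e' * (4 * C * (M + 1))]. *)
pose e' := e / (4 * C * (M + 1)).
have e'0 : 0 < e' by rewrite divr_gt0// !mulr_gt0// ltr_wpDl.
have [d1 d10 H1] := linear_approx cg SP e'0.
have [d2 d20 H2] := @linear_approx R g dg (U + `|h|) cdg (fun x _ => gdg x) _ e'0.
have [d3 d30 H3] := uniform_continuity cg (U + `|h|) e'0.
pose t := Num.min 1 (Num.min d1 (Num.min d2 d3) / (M + 1)) / 2.
have M10 : 0 < M + 1 by rewrite ltr_wpDl.
have dd0 : 0 < Num.min d1 (Num.min d2 d3) by rewrite !lt_min d10 d20.
have t0 : 0 < t by rewrite /t divr_gt0// lt_min ltr01 divr_gt0.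
have t1 : `|t| <= 1.
  by rewrite gtr0_norm// /t ler_pdivrMr// mul1r ge_min ler1n.
have tM y : box d M y -> `|t * y i| < Num.min d1 (Num.min d2 d3).
  move=> yM; rewrite normrM (gtr0_norm t0).
  apply: (@le_lt_trans _ _ (t * M)); first by rewrite ler_pM// ?(ltW t0)// yM.
  apply: (@le_lt_trans _ _ (Num.min d1 (Num.min d2 d3) / 2)).
    rewrite /t mulrAC ler_pM2r ?invr_gt0//.
    apply: (@le_trans _ _ (Num.min d1 (Num.min d2 d3) / (M + 1) * M)).
      by rewrite ler_wpM2r// ge_min lexx orbT.
    rewrite mulrAC ler_pdivrMr// ler_pM2l// lerDl//.
  by rewrite ltr_pdivrMr// ltr_pMr// ltr1n.
pose a' j := a j + t * delta1 i j.
(* The difference quotient in the weight [a i], with increment [t], of the window of the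
   primitive. *)
exists (jscale t^-1 (jadd (window S a') (jscale (-1) (window S a)))).
  apply/cspanZ/cspanD; last apply/cspanZ.
    by apply: cspan_window SP _ => y; exact: aU.
  by apply: cspan_window SP _ => y /aUh[].
move=> y j yM jd.
have := tM y yM; rewrite !lt_min => /and3P[ty1 ty2 ty3].
have [u1 u2] := aUh y yM.
rewrite /jscale /jadd /window /jmulX/=.
rewrite /a' linD linZ lin_delta1//.
have -> : lin d a y + t * y i + b = lin d a y + b + t * y i by ring.
set u := lin d a y + b in u1 u2 *.
have shiftE v : v + t * y i - v = t * y i by ring.
have eE : e = e' * (4 * C * (M + 1)).
  by rewrite /e' divfK// !mulf_neq0// gt_eqF.
have tyM : `|t * y i| <= t * M by rewrite normrM (gtr0_norm t0) ler_pM2l// yM.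
have e'M v : v <= e' * `|t * y i| -> v <= e' * (t * M).
  by move=> /le_trans; apply; rewrite ler_pM2l.
have L1 v : `|v| <= U + `|h| ->
    `|S (v + t * y i) - S v - g v * (t * y i)| <= e' * (t * M).
  by move=> vU; have := H1 v (v + t * y i) vU; rewrite shiftE => /(_ ty1)/e'M.
have L2 v : `|v| <= U + `|h| ->
    `|g (v + t * y i) - g v - dg v * (t * y i)| <= e' * (t * M).
  by move=> vU; have := H2 v (v + t * y i) vU; rewrite shiftE => /(_ ty2)/e'M.
have L3 v : `|v| <= U + `|h| -> `|g (v + t * y i) - g v| <= e'.
  by move=> vU; apply: H3 => //; rewrite shiftE.
have sub2 (p q z : R) : `|p| <= z -> `|q| <= z -> `|p - q| <= 2 * z.
  move=> pz qz; rewrite mulr2n mulrDl mul1r.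
  by apply: le_trans (ler_normB _ _) _; rewrite lerD.
have tV z w : t * z = w -> `|w| <= 2 * (e' * (t * M)) -> `|z| <= 2 * (e' * M).
  move=> <- H; rewrite -(ler_pM2l t0) -[t in X in X <= _](gtr0_norm t0) -normrM.
  by apply: le_trans H _; rewrite !(mulrCA t).
have u1h : `|u| <= U + `|h| by rewrite (le_trans u1)// lerDl.
have tn0 : t != 0 by rewrite gt_eqF.
case: j jd => [|k] jd /=.
  apply: (@le_trans _ _ (2 * (e' * M))); last first.
    by rewrite eE mulrCA ler_pM2l//; nra.
  apply: (tV _ _ _ (sub2 _ _ _ (L1 _ u2) (L1 _ u1h))).
  rewrite (addrAC u h) -/g; field.
  exact: tn0.
have id1 : `|(k == i)%:R : R| <= 1 by case: (k == i); rewrite ?normr0 ?normr1.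
apply: (@le_trans _ _ (2 * e' + C * (2 * (e' * M)))); last by rewrite eE; nra.
have T2 := tV _ _ (mulVKf tn0 _) (sub2 _ _ _ (L2 _ u2) (L2 _ u1h)).
have T1 := sub2 _ _ _ (L3 _ u2) (L3 _ u1h).
(* Product rule in the weight: the increment of the factor [a k] occurs for [k = i] only and
   multiplies a difference of [g], estimated by [T1]; the increment of that difference is estimated
   to first order by [T2]. *)
rewrite [X in `|X|](_ : _ = (k == i)%:R *
    (g (u + h + t * y i) - g (u + h) - (g (u + t * y i) - g u)) +
  a k * (t^-1 * (g (u + h + t * y i) - g (u + h) - dg (u + h) * (t * y i) -
     (g (u + t * y i) - g u - dg u * (t * y i))))).
  apply: le_trans (ler_normD _ _) _; rewrite !normrM; apply: lerD.
    by rewrite -[leRHS]mul1r ler_pM.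
  by rewrite -[X in _ * X]normrM; apply: ler_pM => //; exact: aC.
rewrite /delta1 (addrAC u h) -/g -/dg; field.
exact: tn0.
Qed.
End step.

End ridge_span.

Section ridge_density.
Context {R : realType}.
Variables (d : nat) (M : R) (f df : R -> R).
Hypothesis M0 : 0 <= M.
Hypothesis fdf : forall x : R, is_derive x 1 f (df x).
Hypothesis cdf : continuous df.
Implicit Types (F G : @jet R) (n i : nat).

Local Notation cspan := (cspan d M f df).

(** On generators this is [cspan_mulX_ridge], where the first step of the difference is consumed. It
    passes to limits because multiplication by [y i] enlarges a C^1 error on the box by a factor of
    at most [1 + M]. *)
Lemma cspan_mulX n i F : (i < d)%N -> cspan n.+1 F -> cspan n (jmulX i F).
Proof.
move=> id.
have rF G : rspan d f df n.+1 G -> cspan n (jmulX i G).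
  elim => [|{}G c [//|h hs] a b /= [hsn] _ ih].
    apply: (@approximable_ext _ _ _ _ (jcst 0)); last exact/approximable_in/rspan0.
    by move=> y [|j] _ _ /=; rewrite !mulr0 ?addr0.
  rewrite -hsn in ih *.
  have := cspanD ih (cspanZ c (cspan_mulX_ridge M0 fdf cdf hs h b a id)).
  apply: approximable_ext => y [|j] _ _; rewrite /jadd /jscale/=; ring.
move=> cF; apply: approximable_lim => e e0.
have M10 : 0 < 1 + M by rewrite ltr_pwDl.
have [G rG GF] := cF _ (divr_gt0 e0 M10).
exists (jmulX i G); first exact: rF.
have eE : e = e / (1 + M) * (1 + M) by rewrite divfK// gt_eqF.
have e'0 : 0 <= e / (1 + M) by rewrite divr_ge0// ltW.
move=> y [|j] yM jd /=.
  rewrite -mulrBr normrM eE mulrC ler_pM ?GF// (le_trans (yM _ id))//.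
  by rewrite lerDr.
rewrite opprD addrACA -!mulrBr eE [leRHS]mulrDr mulr1.
apply: le_trans (ler_normD _ _) _; rewrite !normrM lerD//.
  rewrite -[leRHS]mul1r ler_pM ?GF//.
  by case: (j == i); rewrite ?normr0 ?normr1.
by rewrite mulrC ler_pM ?GF// yM.
Qed.

Lemma cspan_cst n (c : R) : nonpolynomial f -> cspan n (jcst c).
Proof.
move=> npf.
have [[hs [b [hsn hsb]]]|H] := pselect (exists hs (b : R),
    size hs = n /\ fdiff hs f b != 0); last first.
  exfalso; apply: npf; apply: (@frechet _ n).
    by move=> x; apply/differentiable_continuous/derivable1_diffP; case: (fdf x).
  move=> hs hsn x; apply/eqP/negPn/negP => hsx; apply: H.
  by exists hs, x.
(* With zero weights the ridge function is the nonzero constant [fdiff hs f b], and its derivatives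
   vanish. *)
have := cspanZ (c / fdiff hs f b) (approximable_in d (box d M)
  (rspan_ridge d f df hs (fun=> 0) b)).
rewrite hsn; apply: approximable_ext => y [|j] _ _; rewrite /jscale/= ?mul0r ?mulr0//.
by rewrite /lin big1 ?add0r ?divfK// => i _; rewrite mul0r.
Qed.

(** The order is universally quantified inside the induction because each factor [y i] lowers it by
    one. Networks only use order 0. *)
Lemma jpoly_cspan F : nonpolynomial f -> jpoly d F -> forall n, cspan n F.
Proof.
move=> npf; elim => {F} [c|F G _ ihF _ ihG|i F id _ ih] n.
- exact: cspan_cst.
- exact: cspanD.
- exact: cspan_mulX.
Qed.

End ridge_density.

(** * From ridge functions to networks with any number of layers *)

Section networks.
Context {R : realType}.
Implicit Types (F G : @jet R) (act : nat -> R -> R) (p : nn_params R) (y : nat -> R).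

Lemma jpoly_bounded d (M : R) F : 0 <= M -> jpoly d F ->
  exists2 B : R, 0 <= B & forall y j, box d M y -> (j <= d)%N -> `|F j y| <= B.
Proof.
move=> M0; elim => {F} [c|F G _ [B B0 FB] _ [C C0 GC]|i F id _ [B B0 FB]].
- by exists `|c| => // y [|j] _ _ //=; rewrite normr0.
- exists (B + C); first exact: addr_ge0.
  move=> y j yM jd; apply: le_trans (ler_normD _ _) _.
  by rewrite lerD ?FB ?GC.
- exists ((1 + M) * B); first by rewrite mulr_ge0// addr_ge0.
  move=> y [|j] yM jd /=.
    rewrite normrM ler_pM ?FB// (le_trans (yM _ id))//.
    by rewrite lerDr.
  rewrite mulrDl; apply: le_trans (ler_normD _ _) _; rewrite !normrM lerD//.
    rewrite ler_pM ?FB//.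
    by case: (j == i); rewrite ?normr0 ?normr1.
  by rewrite ler_pM ?FB// yM.
Qed.

Definition jderives d F := forall y j, (j < d)%N ->
  is_derive (y j) 1 (fun s => F 0%N (upd y j s)) (F j.+1 y).

Lemma lin_upd d (a y : nat -> R) j s : (j < d)%N ->
  lin d a (upd y j s) = lin d a y - a j * y j + a j * s.
Proof.
move=> jd; rewrite /lin (bigD1 (Ordinal jd))//= [in RHS](bigD1 (Ordinal jd))//=.
rewrite /upd eqxx (eq_bigr (fun i : 'I_d => a i * y i)); first by ring.
by move=> i ij; rewrite (_ : (_ == _) = false)//; apply: contraNF ij.
Qed.

Lemma upd_id (y : nat -> R) j : upd y j (y j) = y.
Proof. by apply/funext => i; rewrite /upd; case: eqP => [->|]. Qed.

Lemma ridge_derives d (f df : R -> R) a b : (forall x : R, is_derive x 1 f (df x)) ->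
  jderives d (ridge d f df a b).
Proof.
move=> fdf y j jd /=.
rewrite (_ : (fun s => _) = f \o (fun s => (lin d a y - a j * y j + b) + a j * s)).
  have fd := fdf (lin d a y + b).
  rewrite [lin d a y + b](_ : _ = lin d a y - a j * y j + b + a j * y j) in fd; last by ring.
  apply: is_derive_eq; rewrite add0r mul1r [_%:A]mulr1 mulrC.
  by congr (a j * df _); ring.
by apply/funext => s /=; rewrite lin_upd//; congr f; ring.
Qed.

Lemma rspan_sum d (f df : R -> R) F : rspan d f df 0 F ->
  exists (m : nat) (c : nat -> R) (a : nat -> nat -> R) (b : nat -> R),
    F = fun j y => \sum_(i < m) c i * ridge d f df (a i) (b i) j y.
Proof.
elim => [|{}F c [|//] a b _ _ [m [c' [a' [b' ->]]]]].
  exists 0%N, (fun=> 0), (fun _ _ => 0), (fun=> 0).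
  by apply/funext => -[|j]; apply/funext => y; rewrite big_ord0.
exists m.+1, (fun i => if i == m then c else c' i),
  (fun i => if i == m then a else a' i), (fun i => if i == m then b else b' i).
apply/funext => j; apply/funext => y; rewrite big_ord_recr/= eqxx; congr (_ + _).
by apply: eq_bigr => i _; rewrite ltn_eqF.
Qed.

Lemma is_derive_bigsum (m : nat) (h : nat -> R -> R) (x : R) (dh : nat -> R) :
  (forall i, (i < m)%N -> is_derive x 1 (h i) (dh i)) ->
  is_derive x 1 (fun s => \sum_(i < m) h i s) (\sum_(i < m) dh i).
Proof.
move=> hd; rewrite (_ : (fun s => _) = \sum_(i < m) h i).
  by apply: is_derive_sum => i; exact: hd.
by apply/funext => s; rewrite fct_sumE.
Qed.

(** [k] is the number of hidden layers. Closeness of jets says nothing about whether their slots are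
    derivatives; [jderives] adds this for the network, as the loss contains its true derivatives. *)
Definition netjet act k F := exists p, [/\ width p 0 = 7%N,
  forall l, (0 < l <= k)%N -> (0 < width p l)%N, width p k.+1 = 1%N,
  forall y, F 0%N y = nn_theta act p (mkseq y 7) k 0%N & jderives 7 F].

Lemma rspan_netjet act F df : (forall x : R, is_derive x 1 (act 1%N) (df x)) ->
  rspan 7 (act 1%N) df 0 F -> netjet act 1 F.
Proof.
move=> fdf /rspan_sum[m [c [a [b ->]]]].
(* The hidden layer has [m.+1] neurons so that its width is positive even when [m] is 0; the
   outgoing weight of the extra neuron is 0. *)
exists (NNParams (fun l => if l is l'.+1 then if l' is 0 then m.+1 else 1%N else 7%N)
  (fun k j i => if k == 1%N then a j i else if (i < m)%N then c i else 0)
  (fun k j => if k == 1%N then b j else 0)); split=> //.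
- by move=> [|[|l]].
- move=> y; rewrite /= big_ord_recr/= ltnn mul0r !addr0; apply: eq_bigr => i _.
  rewrite ltn_ord; congr (_ * act 1%N (_ + _)).
  by apply: eq_bigr => j _; rewrite nth_mkseq.
- move=> y j jd; apply: (@is_derive_bigsum _
    (fun i s => c i * ridge 7 (act 1%N) df (a i) (b i) 0%N (upd y j s)) _
    (fun i => c i * ridge 7 (act 1%N) df (a i) (b i) j.+1 y)) => i _.
  by have := ridge_derives (a i) (b i) fdf y jd => id; exact: is_deriveZ.
Qed.

Lemma eq_nn_theta act p q Y k : (forall l, (l <= k)%N -> width p l = width q l) ->
  (forall l, (l <= k.+1)%N -> weight p l = weight q l) ->
  (forall l, (l <= k.+1)%N -> bias p l = bias q l) ->
  forall j, nn_theta act p Y k j = nn_theta act q Y k j.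
Proof.
elim: k => [|k ih] wpq gpq bpq j /=; first by rewrite wpq// gpq// bpq.
rewrite wpq// gpq// bpq//; congr (_ + _); apply: eq_bigr => i _.
by rewrite ih// => l lk; [rewrite wpq|rewrite gpq|rewrite bpq]; rewrite // leqW.
Qed.

(* One more layer, with a single neuron: the affine function of
   [act k.+1 (t * theta + b)] with coefficients [c] and [c0]. *)
Lemma netjet_layer act k F df (t b c c0 : R) :
  (forall x : R, is_derive x 1 (act k.+1) (df x)) -> netjet act k F ->
  netjet act k.+1 (fun j y => if j is _.+1 then c * (df (t * F 0%N y + b) * (t * F j y))
    else c * act k.+1 (t * F 0%N y + b) + c0).
Proof.
move=> adf [p [w0 wp wk FE Fd]].
(* The inner affine map with [t] and [b] is absorbed into the former output layer, which becomes the
   incoming map of the new neuron; [c] and [c0] form the new output layer. *)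
pose q := NNParams (fun l => if (l <= k.+1)%N then width p l else 1%N)
  (fun l j i => if (l <= k)%N then weight p l j i
     else if l == k.+1 then t * weight p l j i else c)
  (fun l j => if (l <= k)%N then bias p l j
     else if l == k.+1 then t * bias p l j + b else c0).
have qE y : nn_theta act q (mkseq y 7) k 0%N = t * F 0%N y + b.
  rewrite FE {FE wp Fd wk}; case: k adf @q => [|k] _ q /=.
    by rewrite mulrDr addrA mulr_sumr; congr (_ + _ + _); apply: eq_bigr => i _;
      rewrite mulrA.
  rewrite leqnSn ltnn eqxx mulrDr addrA mulr_sumr; congr (_ + _ + _).
  apply: eq_bigr => i _; rewrite mulrA; congr (_ * act _ _).
  apply: eq_nn_theta => l lk /=; first by rewrite (leq_trans lk) ?leqnSn// ltnW.
    by apply/funext => j'; apply/funext => i'; rewrite lk.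
  by apply/funext => j'; rewrite lk.
exists q; split.
- by rewrite /= w0.
- move=> l /andP[l0 lk] /=; rewrite lk; case: (ltngtP l k.+1) lk => // [lk|->] _.
    by rewrite wp// l0.
  by rewrite wk.
- by rewrite /= ltnn.
- move=> y; rewrite [RHS]/= leqnn wk big_ord1 -qE.
  by rewrite (_ : (k.+1 < k)%N = false) ?(ltnNge, leqnSn)// gtn_eqF.
- move=> y j jd /=.
  have Fj := Fd y j jd.
  have aF : is_derive ((fun s => t * F 0%N (upd y j s) + b) (y j)) 1 (act k.+1)
      (df (t * F 0%N y + b)) by rewrite upd_id.
  have tF : is_derive (y j) 1 (fun s => t * F 0%N (upd y j s) + b) (t * F j.+1 y).
    by apply: is_derive_eq; rewrite addr0.
  have cF := @is_derive1_comp _ _ (fun s => t * F 0%N (upd y j s) + b) _ _ _ aF tF.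
  by apply: is_derive_eq; rewrite addr0.
Qed.

Lemma C1_activation_derive (f : R -> R) : C1_activation f ->
  (forall x : R, is_derive x 1 f (derive1 f x)) /\ continuous (derive1 f).
Proof.
move=> [df cdf]; split=> // x; rewrite derive1E; exact: DeriveDef.
Qed.

Lemma nonpolynomial_derive (f : R -> R) : (forall x : R, is_derive x 1 f (derive1 f x)) ->
  nonpolynomial f -> exists b, derive1 f b != 0.
Proof.
move=> fd npf; apply: contrapT => H; apply: npf; exists (f 0)%:P => x.
rewrite hornerC; apply: is_derive_0_is_cst => y.
have := fd y; rewrite (_ : derive1 f y = 0)//.
by apply/eqP/negPn/negP => fy0; apply: H; exists y.
Qed.

Lemma network_density act k (M : R) F : 0 <= M ->
  (forall l, (0 < l <= k.+1)%N -> C1_activation (act l)) ->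
  (forall l, (0 < l <= k.+1)%N -> nonpolynomial (act l)) ->
  jpoly 7 F -> approximable 7 (box 7 M) (netjet act k.+1) F.
Proof.
move=> M0 actC actN pF; elim: k actC actN => [|k ih] actC actN.
  have [fd cd] := C1_activation_derive (actC 1%N isT).
  move=> e e0; have [G rG GF] := jpoly_cspan M0 fd cd (actN 1%N isT) pF 0 e0.
  by exists G => //; exact: rspan_netjet rG.
have /ih{}ih : forall l, (0 < l <= k.+1)%N -> C1_activation (act l).
  by move=> l /andP[l0 lk]; apply: actC; rewrite l0 leqW.
have {}ih : approximable 7 (box 7 M) (netjet act k.+1) F.
  by apply: ih => l /andP[l0 lk]; apply: actN; rewrite l0 leqW.
have kk : (0 < k.+2 <= k.+2)%N by rewrite leqnn.
set f := act k.+2.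
have [fd cd] := C1_activation_derive (actC _ kk); rewrite -/f in fd cd.
have [b b0] := nonpolynomial_derive fd (actN _ kk).
have [B0 B00 FB0] := jpoly_bounded M0 pF.
pose B := B0 + 1; have B1 : 0 < B by rewrite ltr_wpDl.
have nb0 : 0 < `|derive1 f b| by rewrite normr_gt0.
apply: approximable_lim => e e0.
(* The minimum with 1 bounds the approximating jet [G] by [B0 + 1], a number chosen before [G] and
   [t]. *)
pose e1 := Num.min (e / 2) 1.
have e10 : 0 < e1 by rewrite lt_min ltr01 divr_gt0.
have [G nG GF] := ih _ e10.
have GB y j : box 7 M y -> (j <= 7)%N -> `|G j y| <= B.
  move=> yM jd; rewrite -(subrK (F j y) (G j y)) addrC.
  apply: le_trans (ler_normD _ _) _; rewrite lerD ?FB0//.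
  by apply: le_trans (GF _ _ yM jd) _; rewrite ge_min lexx orbT.
(* Undoing the slope [derive1 f b] divides errors by its absolute value, and first-order errors are
   proportional to [G], hence to [B]: value and derivative both end up within [e / 2]. *)
pose e' := e / 2 * `|derive1 f b| / B.
have e'0 : 0 < e' by rewrite !divr_gt0// mulr_gt0// divr_gt0.
have [d1 d10 H1] := @linear_approx R f (derive1 f) `|b| cd (fun x _ => fd x) _ e'0.
have [d2 d20 H2] := uniform_continuity cd `|b| e'0.
pose t := Num.min d1 d2 / (2 * B).
have t0 : 0 < t by rewrite divr_gt0 ?mulr_gt0// lt_min d10.
pose c := (t * derive1 f b)^-1.
eexists; first by apply/approximable_in/(netjet_layer t b c (- (c * f b)) fd nG).
move=> y j yM jd; rewrite -/f.
have tG : `|t * G 0%N y| < Num.min d1 d2.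
  rewrite normrM gtr0_norm//; apply: le_lt_trans (_ : t * B < _).
    by rewrite ler_pM2l// GB.
  rewrite /t invfM mulrA divfK ?gt_eqF// ltr_pdivrMr// ltr_pMr// ?ltr1n//.
  by rewrite lt_min d10.
have bE : t * G 0%N y + b - b = t * G 0%N y by ring.
rewrite -(subrK (G j y) (if j is _.+1 then _ else _)) -addrA.
apply: le_trans (ler_normD _ _) _; rewrite [leRHS]splitr lerD//; last first.
  by apply: le_trans (GF _ _ yM jd) _; rewrite ge_min lexx.
have eE : e / 2 = `|derive1 f b|^-1 * (e' * B).
  by rewrite /e' divfK ?gt_eqF// [RHS]mulrC mulfK// gt_eqF.
have tn0 : t != 0 by rewrite gt_eqF.
have bb : `|b| <= `|b| by [].
move: tG; rewrite lt_min => /andP[tG1 tG2].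
case: j jd => [|j] jd.
  have := H1 b (t * G 0%N y + b) bb; rewrite bE => /(_ tG1) Hf.
  rewrite (_ : _ - _ = (derive1 f b)^-1 * (t^-1 * (f (t * G 0%N y + b) - f b -
      derive1 f b * (t * G 0%N y)))); last by rewrite /c; field; rewrite b0 tn0.
  rewrite normrM normfV eE ler_pM2l ?invr_gt0//.
  rewrite normrM normfV (gtr0_norm t0) ler_pdivrMl//; apply: le_trans Hf _.
  by rewrite normrM (gtr0_norm t0) mulrCA !ler_pM2l// GB.
have := H2 b (t * G 0%N y + b) bb; rewrite bE => /(_ tG2) Hf.
rewrite (_ : _ - _ = (derive1 f b)^-1 * ((derive1 f (t * G 0%N y + b) - derive1 f b) *
  G j.+1 y)); last by rewrite /c; field; rewrite b0 tn0.
rewrite normrM normfV eE ler_pM2l ?invr_gt0// normrM ler_pM//.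
exact: GB.
Qed.

End networks.

(** * Bernstein polynomials in several variables *)

Section coin_flips.
Context {R : realType}.
Implicit Types (p q : R) (g h : nat -> R) (n : nat).

(* The expectation of [g k], where [k] is the number of successes in [n]
   trials of probability [p]. *)
Fixpoint binexp n p g : R :=
  if n is n'.+1 then p * binexp n' p (g \o succn) + (1 - p) * binexp n' p g
  else g 0%N.

Lemma binexp_lin n p a b g h :
  binexp n p (fun k => a * g k + b * h k) = a * binexp n p g + b * binexp n p h.
Proof.
elim: n g h => //= n ih g h.
by rewrite (ih (g \o succn) (h \o succn)) ih; ring.
Qed.

Lemma binexp_cst n p (c : R) : binexp n p (fun=> c) = c.
Proof. by elim: n => //= n ->; ring. Qed.

Lemma eq_binexp n p g h : (forall k, (k <= n)%N -> g k = h k) ->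
  binexp n p g = binexp n p h.
Proof.
elim: n g h => [|n ih] g h gh /=; first exact: gh.
congr (_ * _ + _ * _); apply: ih => k kn; apply: gh => //.
exact: leqW.
Qed.

Lemma ler_binexp n p g h : 0 <= p <= 1 -> (forall k, (k <= n)%N -> g k <= h k) ->
  binexp n p g <= binexp n p h.
Proof.
move=> /andP[p0 p1]; elim: n g h => [|n ih] g h gh /=; first exact: gh.
apply: lerD; apply: ler_wpM2l; rewrite ?subr_ge0//; apply: ih => k kn; apply: gh => //.
exact: leqW.
Qed.

Section moments.
Variable p : R.
Let u n k : R := k%:R - n%:R * p.

Let binexpE n g : binexp n.+1 p g = p * binexp n p (g \o succn) + (1 - p) * binexp n p g.
Proof. by []. Qed.

Let uS n k : u n.+1 k.+1 = u n k + (1 - p).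
Proof. by rewrite /u -!natr1; ring. Qed.

Let u1 n k : u n.+1 k = u n k - p.
Proof. by rewrite /u -!natr1; ring. Qed.

Lemma binexp_moment1 n : binexp n p (u n) = 0.
Proof.
elim: n => [|n ih]; first by rewrite /= /u mul0r subr0.
rewrite binexpE.
rewrite (@eq_binexp _ _ _ (fun k => 1 * u n k + (1 - p) * 1)); last first.
  by move=> k _ /=; rewrite uS; ring.
rewrite [in X in _ + X](@eq_binexp _ _ _ (fun k => 1 * u n k + (- p) * 1)); last first.
  by move=> k _ /=; rewrite u1; ring.
by rewrite !binexp_lin ih !binexp_cst; ring.
Qed.

Lemma binexp_moment2 n : binexp n p (fun k => u n k ^+ 2) = n%:R * (p * (1 - p)).
Proof.
elim: n => [|n ih]; first by rewrite /= /u !mul0r subr0 expr0n.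
rewrite binexpE.
rewrite (@eq_binexp _ _ _ (fun k => 1 * u n k ^+ 2 + 1 * (2 * (1 - p) * u n k + (1 - p) ^+ 2 * 1))); last first.
  by move=> k _ /=; rewrite uS; ring.
rewrite [in X in _ + X](@eq_binexp _ _ _ (fun k => 1 * u n k ^+ 2 + 1 * (- 2 * p * u n k + p ^+ 2 * 1))); last first.
  by move=> k _ /=; rewrite u1; ring.
by rewrite !binexp_lin ih binexp_moment1 !binexp_cst -natr1; ring.
Qed.

(** With [q = p * (1 - p)], one more trial adds exactly [6 * n%:R * q ^+ 2 + q * (1 - 3 * q)]: the
    third moments cancel and the second is known. As [q] is at most 1/4, this is below
    [2 * n%:R + 1]. *)
Lemma binexp_moment4 n : 0 <= p <= 1 ->
  binexp n p (fun k => u n k ^+ 4) <= n%:R ^+ 2.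
Proof.
move=> /andP[p0 p1]; elim: n => [|n ih]; first by rewrite /= /u !mul0r subr0 !expr0n.
rewrite binexpE.
rewrite (@eq_binexp _ _ _ (fun k => 1 * u n k ^+ 4 + 1 * (4 * (1 - p) * u n k ^+ 3 +
  1 * (6 * (1 - p) ^+ 2 * u n k ^+ 2 + 1 * (4 * (1 - p) ^+ 3 * u n k + (1 - p) ^+ 4 * 1))))); last first.
  by move=> k _ /=; rewrite uS; ring.
rewrite [in X in _ + X](@eq_binexp _ _ _ (fun k => 1 * u n k ^+ 4 + 1 * (- 4 * p * u n k ^+ 3 +
  1 * (6 * p ^+ 2 * u n k ^+ 2 + 1 * (- 4 * p ^+ 3 * u n k + p ^+ 4 * 1))))); last first.
  by move=> k _ /=; rewrite u1; ring.
rewrite !binexp_lin binexp_moment1 binexp_moment2 !binexp_cst -[n.+1%:R]natr1.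
set A := binexp _ _ _ in ih *; set B := binexp _ _ _.
have n0 : 0 <= n%:R :> R by [].
set N := n%:R in ih n0 *; pose q := p * (1 - p).
have q0 : 0 <= q by rewrite mulr_ge0// subr_ge0.
have q4 : q <= 4^-1.
  rewrite -subr_ge0 (_ : _ - _ = (p - 2^-1) ^+ 2); last by rewrite /q; field.
  exact: sqr_ge0.
apply: (@le_trans _ _ (N ^+ 2 + 6 * N * q ^+ 2 + q * (1 - 3 * q))).
  apply: le_trans (_ : A + 6 * N * q ^+ 2 + q * (1 - 3 * q) <= _).
    by rewrite le_eqVlt; apply/orP; left; apply/eqP; rewrite /q; ring.
  by rewrite !lerD2r.
have : q ^+ 2 <= 16^-1.
  by rewrite (_ : 16^-1 = 4^-1 ^+ 2 :> R); [rewrite ler_pXn2r ?nnegrE|field].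
nra.
Qed.

End moments.

(** The shift [c] is for derivatives of Bernstein polynomials, which use one trial less on the same
    grid, so that the mean is off by [p]. The factor 8 comes from the convexity of the fourth
    power. *)
Lemma binexp_moment4_shift n p (c : R) : 0 <= p <= 1 -> `|c| <= 1 ->
  binexp n p (fun k => (k%:R - n%:R * p - c) ^+ 4) <= 8 * (n%:R ^+ 2 + 1).
Proof.
move=> p01 c1; apply: le_trans (_ : binexp n p
    (fun k => 8 * (k%:R - n%:R * p) ^+ 4 + 8 * 1) <= _).
  apply: ler_binexp => // k _; set u := k%:R - _.
  have c4 : c ^+ 4 <= 1.
    by rewrite (_ : c ^+ 4 = `|c| ^+ 4) ?exprn_ile1// -normrX ger0_norm ?exprn_even_ge0.
  apply: le_trans (_ : 8 * u ^+ 4 + 8 * c ^+ 4 <= _).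
    rewrite -subr_ge0 (_ : _ - _ = 4 * (u ^+ 2 - c ^+ 2) ^+ 2 +
      (u + c) ^+ 2 * (2 * (u ^+ 2 + c ^+ 2) + (u - c) ^+ 2)); last by ring.
    by do ![exact: sqr_ge0|exact: ler0n|apply: addr_ge0|apply: mulr_ge0].
  by rewrite lerD2l ler_pM2l.
rewrite binexp_lin binexp_cst mulr1 mulrDr mulr1 lerD2r ler_pM2l//.
exact: binexp_moment4.
Qed.

(** The classical formula for the derivative of a Bernstein polynomial: differences of the node
    values, with one trial less. *)
Lemma binexp_derive n g p :
  is_derive p 1 (fun q => binexp n.+1 q g)
    (n.+1%:R * binexp n p (fun k => g k.+1 - g k)).
Proof.
elim: n g => [|n ih] g.
  rewrite /=; apply: is_derive_eq; rewrite /GRing.scale/=; ring.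
rewrite [X in is_derive _ _ X _](_ : _ = fun q =>
  q * binexp n.+1 q (g \o succn) + (1 - q) * binexp n.+1 q g)//.
have h1 := ih (g \o succn); have h2 := ih g.
apply: is_derive_eq; rewrite /GRing.scale/=.
have dE g' : binexp n p (fun k => g' k.+1 - g' k) =
    binexp n p (g' \o succn) - binexp n p g'.
  rewrite -[in RHS](mul1r (binexp _ _ (g' \o _))) -mulN1r -binexp_lin.
  by apply: eq_binexp => i _; rewrite mul1r mulN1r.
rewrite dE (@eq_binexp n _ _ (fun k => (g \o succn) k.+1 - (g \o succn) k))//.
rewrite dE -!natr1; ring.
Qed.

Lemma binexp_derive_arg n p (x : R) (h dh : nat -> R -> R) :
  (forall k, (k <= n)%N -> is_derive x 1 (h k) (dh k x)) ->
  is_derive x 1 (fun v => binexp n p (h ^~ v)) (binexp n p (dh ^~ x)).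
Proof.
elim: n h dh => [|n ih] h dh hd /=; first exact: hd.
have h1 : is_derive x 1 (fun v => binexp n p ((h ^~ v) \o succn)) (binexp n p ((dh ^~ x) \o succn)).
  by apply: (ih (fun k => h k.+1) (fun k => dh k.+1)) => k kn; apply: hd.
have h2 : is_derive x 1 (fun v => binexp n p (h ^~ v)) (binexp n p (dh ^~ x)).
  by apply: ih => k kn; apply: hd; exact: leqW.
exact: is_deriveD.
Qed.

End coin_flips.

Section grid.
Context {R : realType}.
Implicit Types (m k : nat -> nat) (s : seq nat) (G H : (nat -> nat) -> R)
  (P y : nat -> R).

(* The expectation of [G], where the coordinates [k i] for [i \in s] are replaced
   by independent binomial variables with [m i] trials of probability [P i]. *)
Fixpoint gridexp m s G k P : R :=
  if s is i :: s' then binexp (m i) (P i) (fun l => gridexp m s' G (upd k i l) P)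
  else G k.

Lemma gridexp_lin m s a b G H k P :
  gridexp m s (fun k => a * G k + b * H k) k P =
  a * gridexp m s G k P + b * gridexp m s H k P.
Proof.
elim: s k => //= i s ih k; rewrite -binexp_lin; apply: eq_binexp => l _.
exact: ih.
Qed.

Lemma gridexp_cst m s (c : R) k P : gridexp m s (fun=> c) k P = c.
Proof.
elim: s k => //= i s ih k; rewrite -[RHS](binexp_cst (m i) (P i)).
by apply: eq_binexp => l _; exact: ih.
Qed.

Definition in_grid m s k k' := forall i,
  if i \in s then (k' i <= m i)%N else k' i == k i.

Lemma ler_gridexp m s G H k P : (forall i, i \in s -> 0 <= P i <= 1) ->
  (forall k', in_grid m s k k' -> G k' <= H k') ->
  gridexp m s G k P <= gridexp m s H k P.
Proof.
elim: s k => /= [|i s ih] k P01 GH; first by apply: GH => i; rewrite in_nil eqxx.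
apply: ler_binexp => [|l lm]; first by rewrite P01 ?mem_head.
apply: ih => [j js|k' k'P]; first by rewrite P01// inE js orbT.
apply: GH => j.
have := k'P j; rewrite inE /upd; case: (j \in s); first by rewrite orbT.
by rewrite orbF; case: (eqVneq j i) => [->|//] /eqP ->.
Qed.

Lemma gridexp_marginal_notin m s (u : nat -> R) i k P : i \notin s ->
  gridexp m s (fun k => u (k i)) k P = u (k i).
Proof.
elim: s k => //= j s ih k; rewrite inE negb_or => /andP[ij /ih{}ih].
rewrite -[RHS](binexp_cst (m j) (P j)); apply: eq_binexp => l _.
by rewrite ih /upd (negbTE ij).
Qed.

Lemma gridexp_marginal m s (u : nat -> R) i k P : uniq s -> i \in s ->
  gridexp m s (fun k => u (k i)) k P = binexp (m i) (P i) u.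
Proof.
elim: s k => //= j s ih k /andP[js us]; rewrite inE.
have [->|ij] /= := eqVneq i j => [_|si].
  by apply: eq_binexp => l _; rewrite gridexp_marginal_notin// /upd eqxx.
rewrite -[RHS](binexp_cst (m j) (P j)); apply: eq_binexp => l _.
by rewrite ih.
Qed.

Lemma gridexp_upd m s G j v k P : j \notin s ->
  gridexp m s G k (upd P j v) = gridexp m s G k P.
Proof.
elim: s k => //= i s ih k; rewrite inE negb_or => /andP[ji js].
by rewrite {1}/upd eq_sym (negbTE ji); apply: eq_binexp => l _; rewrite ih.
Qed.

Lemma gridexp_updm m s G j n k P : j \notin s ->
  gridexp (upd m j n) s G k P = gridexp m s G k P.
Proof.
elim: s k => //= i s ih k; rewrite inE negb_or => /andP[ji js].
by rewrite {1}/upd eq_sym (negbTE ji); apply: eq_binexp => l _; rewrite ih.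
Qed.

Lemma updC (T : Type) (z : nat -> T) i j a b : i != j ->
  upd (upd z i a) j b = upd (upd z j b) i a.
Proof.
move=> ij; apply/funext => l; rewrite /upd; case: eqP => // ->.
by rewrite eq_sym (negbTE ij).
Qed.

Lemma updupd (T : Type) (z : nat -> T) i a b : upd (upd z i a) i b = upd z i b.
Proof. by apply/funext => l; rewrite /upd; case: eqP. Qed.

Definition gdiff j G : (nat -> nat) -> R := fun k => G (upd k j (k j).+1) - G k.

Lemma gridexp_shift m s G j l k P : j \notin s -> k j = l ->
  gridexp m s (fun k => G (upd k j (k j).+1)) k P = gridexp m s G (upd k j l.+1) P.
Proof.
move=> + <-; elim: s k => //= i s ih k; rewrite inE negb_or => /andP[ji js].
apply: eq_binexp => a _; rewrite ih//.
have -> : upd k i a j = k j by rewrite /upd (negbTE ji).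
by rewrite updC// eq_sym.
Qed.

(** The expectation over the coordinate [j] is differentiated by [binexp_derive]; those over the
    other coordinates are linear and commute with the derivative. *)
Lemma gridexp_derive m s G j n k P : uniq s -> j \in s -> m j = n.+1 ->
  is_derive (P j) 1 (fun v => gridexp m s G k (upd P j v))
    (n.+1%:R * gridexp (upd m j n) s (gdiff j G) k P).
Proof.
move=> + + mj; elim: s k => //= i s ih k /andP[iS us]; rewrite inE.
have [ij|ji] /= := eqVneq j i => [_|js].
  rewrite -ij in iS *.
  rewrite (_ : (fun v => _) = fun v => binexp n.+1 v
      (fun l => gridexp m s G (upd k j l) P)); last first.
    apply/funext => v; rewrite mj {1}/upd eqxx; apply: eq_binexp => l _.
    by rewrite gridexp_upd.
  apply: is_derive_eq; first exact: binexp_derive.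
  have -> : upd m j n j = n by rewrite /upd eqxx.
  congr (_ * _); apply: eq_binexp => l _.
  rewrite gridexp_updm// /gdiff.
  rewrite (_ : (fun k => _) = fun k => 1 * G (upd k j (k j).+1) + (-1) * G k); last first.
    by apply/funext => k'; ring.
  rewrite gridexp_lin (@gridexp_shift _ _ _ _ l)// ?updupd /upd ?eqxx//; ring.
rewrite (_ : (fun v => _) = fun v => binexp (m i) (P i)
    (fun l => gridexp m s G (upd k i l) (upd P j v))); last first.
  by apply/funext => v; rewrite {1}/upd eq_sym (negbTE ji).
have -> : upd m j n i = m i by rewrite /upd eq_sym (negbTE ji).
rewrite (_ : n.+1%:R * _ = binexp (m i) (P i) (fun l =>
    n.+1%:R * gridexp (upd m j n) s (gdiff j G) (upd k i l) P)); last first.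
  rewrite -[LHS]addr0 -[0](mul0r (binexp (m i) (P i) (fun=> 0))) -binexp_lin.
  by apply: eq_binexp => l _; rewrite mul0r addr0.
apply: (@binexp_derive_arg _ _ _ _ (fun l v => gridexp m s G (upd k i l) (upd P j v))
  (fun l v => n.+1%:R * gridexp (upd m j n) s (gdiff j G) (upd k i l) P)) => l _.
exact: ih.
Qed.

End grid.

Section jpoly.
Context {R : realType}.
Variable d : nat.
Implicit Types (F G : @jet R).

Lemma jpoly_derives F : jpoly d F -> jderives d F.
Proof.
elim => {F} [c|F G _ ihF _ ihG|i F id _ ih] y j jd.
- exact: is_derive_cst.
- by apply: is_deriveD; [exact: ihF|exact: ihG].
- rewrite /jmulX; have Fj := ih y j jd.
  have Xj : is_derive (y j) 1 (fun s => upd y j s i) ((j == i)%:R : R).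
    rewrite /upd (eq_sym i); case: (j == i); first exact: is_derive_id.
    exact: is_derive_cst.
  have := is_deriveM Xj Fj; rewrite upd_id => h.
  by apply: is_derive_eq; rewrite /GRing.scale/= addrC mulrC.
Qed.

Lemma jpoly_scale c F : jpoly d F -> jpoly d (jscale c F).
Proof.
elim => {F} [a|F G _ ihF _ ihG|i F id _ ih].
- rewrite (_ : jscale _ _ = jcst (c * a)); first exact: jpoly_cst.
  by apply/funext => -[|j]; apply/funext => y; rewrite /jscale/= ?mulr0.
- rewrite (_ : jscale _ _ = jadd (jscale c F) (jscale c G)); first exact: jpoly_add.
  by apply/funext => j; apply/funext => y; rewrite /jscale/jadd mulrDr.
- rewrite (_ : jscale _ _ = jmulX i (jscale c F)); first exact: jpoly_mulX.
  by apply/funext => -[|j]; apply/funext => y; rewrite /jscale/=; ring.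
Qed.

Definition jmul F G : jet := fun j y =>
  if j is _.+1 then F 0%N y * G j y + F j y * G 0%N y else F 0%N y * G 0%N y.

Lemma jpoly_mul F G : jpoly d F -> jpoly d G -> jpoly d (jmul F G).
Proof.
move=> + pG; elim => {F} [a|F F' _ ihF _ ihF'|i F id _ ih].
- rewrite (_ : jmul _ _ = jscale a G); first exact: jpoly_scale.
  by apply/funext => -[|j]; apply/funext => y; rewrite /jscale/= ?mul0r ?addr0.
- rewrite (_ : jmul _ _ = jadd (jmul F G) (jmul F' G)); first exact: jpoly_add.
  by apply/funext => -[|j]; apply/funext => y; rewrite /jadd/=; ring.
- rewrite (_ : jmul _ _ = jmulX i (jmul F G)); first exact: jpoly_mulX.
  by apply/funext => -[|j]; apply/funext => y /=; ring.
Qed.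

(** Polynomiality of the value alone, so that the derivative slots of a Bernstein polynomial need
    not be followed; [jpoly_derives] determines them afterwards. *)
Definition is_jpoly (f : (nat -> R) -> R) := exists2 F, jpoly d F & F 0%N = f.

Lemma is_jpoly_binexp n (p : (nat -> R) -> R) (g : nat -> (nat -> R) -> R) :
  is_jpoly p -> (forall l, is_jpoly (g l)) ->
  is_jpoly (fun y => binexp n (p y) (g ^~ y)).
Proof.
move=> [P pP PE]; elim: n g => [|n ih] g hg /=; first exact: hg.
have [|F pF FE] := ih (fun l => g l.+1); first by move=> l; exact: hg.
have [G pG GE] := ih g hg.
exists (jadd (jmul P F) (jmul (jadd (jcst 1) (jscale (-1) P)) G)).
  by apply: jpoly_add; apply: jpoly_mul => //; apply: jpoly_add;
    [exact: jpoly_cst|exact: jpoly_scale].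
by apply/funext => y; rewrite /jadd/jscale/= PE FE GE; congr (_ + _); ring.
Qed.

Lemma is_jpoly_gridexp m (s : seq nat) (G : (nat -> nat) -> R) k (P : nat -> (nat -> R) -> R) :
  (forall i, i \in s -> is_jpoly (P i)) ->
  is_jpoly (fun y => gridexp m s G k (P ^~ y)).
Proof.
elim: s k => [|i s ih] k hP /=; first by exists (jcst (G k)) => //; exact: jpoly_cst.
apply: (@is_jpoly_binexp _ (P i)
  (fun l y => gridexp m s G (upd k i l) (P ^~ y))).
  by apply: hP; rewrite mem_head.
by move=> l; apply: ih => j js; apply: hP; rewrite inE js orbT.
Qed.

End jpoly.

Section bernstein.
Context {R : realType}.
Implicit Types (m k : nat -> nat) (s : seq nat) (G H : (nat -> nat) -> R)
  (P y z : nat -> R).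

Lemma gridexp_sum m s d (g : nat -> (nat -> nat) -> R) k P :
  gridexp m s (fun k => \sum_(i < d) g i k) k P = \sum_(i < d) gridexp m s (g i) k P.
Proof.
elim: d => [|d ih].
  rewrite big_ord0 -[RHS](gridexp_cst m s 0 k P); congr gridexp.
  by apply/funext => k'; rewrite big_ord0.
rewrite big_ord_recr/= -ih -[X in X + _]mul1r -[X in _ + X]mul1r -gridexp_lin.
by congr gridexp; apply/funext => k'; rewrite big_ord_recr/= !mul1r.
Qed.

Lemma ler_norm_gridexp m s G H k P : (forall i, i \in s -> 0 <= P i <= 1) ->
  (forall k', in_grid m s k k' -> `|G k'| <= H k') ->
  `|gridexp m s G k P| <= gridexp m s H k P.
Proof.
move=> P01 GH; rewrite ler_norml; apply/andP; split; last first.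
  by apply: ler_gridexp => // k' /GH; apply: le_trans; exact: ler_norm.
rewrite -mulN1r -[X in X <= _]addr0 -[0](mul0r (gridexp m s H k P)) -gridexp_lin.
apply: ler_gridexp => // k' /GH; rewrite ler_norml => /andP[+ _].
by rewrite mul0r addr0 mulN1r.
Qed.

Variables (d n : nat) (M : R).
Hypothesis M0 : 0 < M.
Let N : R := n.+1%:R.
Let h := 2 * M / N.

Definition node k : nat -> R := fun i => if (i < d)%N then - M + (k i)%:R * h else 0.

(** The probability for which the mean node after [n.+1] trials is exactly [y]. *)
Definition success y : nat -> R := fun i => (2 * M)^-1 * (y i + M).

Let N0 : 0 < N. Proof. by rewrite /N ltr0n. Qed.
Let h0 : 0 < h. Proof. by rewrite /h divr_gt0// mulr_gt0. Qed.

Let success01 y i : box d M y -> i \in iota 0 d -> 0 <= success y i <= 1.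
Proof.
move=> yM; rewrite mem_iota/= add0n => /yM; rewrite ler_norml => /andP[My yM'].
rewrite /success mulr_ge0 ?invr_ge0 ?mulr_ge0 ?(ltW M0)//=; last by rewrite -lerBlDr sub0r.
by rewrite ler_pdivrMl ?mulr_gt0// mulr1 mulr_natl mulr2n lerD2r.
Qed.

(** The case of [n] trials is the coordinate that has been differentiated. The deviation is [h]
    times a binomial one, whose fourth moment is of order [N ^+ 2], and [h] is [2 * M / N]: the
    result is of order [N ^- 2]. *)
Let node_moment y i l : box d M y -> (i < d)%N -> (l = n \/ l = n.+1) ->
  binexp l (success y i) (fun a => (- M + a%:R * h - y i) ^+ 4) <=
  16 * (2 * M) ^+ 4 / N ^+ 2.
Proof.
move=> yM id ln; have p01 := @success01 y i yM _.
have {}p01 : 0 <= success y i <= 1 by apply: p01; rewrite mem_iota.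
set p := success y i in p01 *.
have yE : y i = - M + h * (N * p).
  by rewrite /h /p /success; field; rewrite !gt_eqF.
have MN : 16 * (2 * M) ^+ 4 / N ^+ 2 = h ^+ 4 * (16 * N ^+ 2).
  by rewrite /h; field; rewrite gt_eqF.
pose c := if l == n then p else 0.
have cE : l%:R * p + c = N * p.
  by rewrite /c; case: ln => ->; rewrite ?eqxx ?gtn_eqF// ?addr0// /N -natr1; ring.
rewrite (@eq_binexp _ _ _ _ (fun a => h ^+ 4 * (a%:R - l%:R * p - c) ^+ 4 + 0 * 0)); last first.
  by move=> a _; rewrite yE -cE; ring.
rewrite binexp_lin mul0r addr0 MN ler_pM2l ?exprn_gt0//.
apply: le_trans (binexp_moment4_shift _ p01 _) _.
  by case/andP: p01 => p0 p1; rewrite /c; case: ifP; rewrite ?normr0// ger0_norm.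
rewrite (_ : 16 * N ^+ 2 = 8 * (N ^+ 2 + N ^+ 2)); last by ring.
rewrite ler_pM2l// lerD//; last by rewrite expr_ge1 ?ler1n// ltW.
by rewrite ler_pXn2r ?nnegrE// ?ler_nat; case: ln => ->.
Qed.

(** The sum of fourth powers splits into functions of one coordinate each, and the expectation of
    such a function is that of its marginal. *)
Lemma gridexp_dev m G k y c e B : box d M y -> 0 <= B ->
  (forall i, m i = n \/ m i = n.+1) ->
  (forall k', in_grid m (iota 0 d) k k' ->
    `|G k' - c| <= e + B * \sum_(i < d) (node k' i - y i) ^+ 4) ->
  `|gridexp m (iota 0 d) G k (success y) - c| <=
    e + B * (d%:R * (16 * (2 * M) ^+ 4 / N ^+ 2)).
Proof.
move=> yM B0 mn Gc.
rewrite -[X in X - _]mul1r -[c in X in X <= _](gridexp_cst m (iota 0 d) c k (success y)).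
rewrite -mulN1r -gridexp_lin.
pose u i k' := (node k' i - y i) ^+ 4.
apply: (@le_trans _ _ (gridexp m (iota 0 d)
    (fun k' => 1 * e + B * \sum_(i < d) u i k') k (success y))).
  apply: ler_norm_gridexp => [i|k' k'P]; first exact: success01.
  by rewrite !mul1r mulN1r; exact: Gc.
rewrite gridexp_lin gridexp_cst mul1r gridexp_sum lerD2l ler_wpM2l//.
apply: (@le_trans _ _ (\sum_(i < d) 16 * (2 * M) ^+ 4 / N ^+ 2)).
  apply: ler_sum => i _; apply: le_trans (node_moment yM (ltn_ord i) (mn i)).
  have iS : (i : nat) \in iota 0 d by rewrite mem_iota ltn_ord.
  rewrite -(gridexp_marginal m (fun a => (- M + a%:R * h - y i) ^+ 4) k _ (iota_uniq 0 d) iS).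
  by rewrite /u /node ltn_ord.
by rewrite sumr_const card_ord -[X in X <= _]mulr_natl.
Qed.

Lemma node_box m k : (forall i, (m i <= n.+1)%N) -> in_grid m (iota 0 d) (fun=> 0%N) k ->
  box d M (node k).
Proof.
move=> mn km i id; have := km i; rewrite mem_iota/= add0n id /node id => kmi.
have kN : (k i)%:R <= N by rewrite ler_nat (leq_trans kmi).
have kh : (k i)%:R * h <= 2 * M.
  by rewrite /h mulrCA ler_piMr ?mulr_ge0 ?(ltW M0)// ler_pdivrMr// mul1r.
have kh0 : 0 <= (k i)%:R * h by rewrite mulr_ge0// ltW.
rewrite ler_norml; lra.
Qed.

Lemma box_node_upd m k j : (forall i, (m i <= n.+1)%N) -> (m j <= n)%N -> (j < d)%N ->
  in_grid m (iota 0 d) (fun=> 0%N) k -> box d M (node (upd k j (k j).+1)).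
Proof.
move=> mn mj jd km; apply: (@node_box (fun=> n.+1)) => // i; have := km i.
rewrite /upd; have [->|_] := eqVneq i j; last first.
  by case: ifP => // _ ki; exact: leq_trans ki (mn i).
by rewrite mem_iota/= add0n jd => /leq_ltn_trans; apply.
Qed.

Lemma node_upd k j : (j < d)%N ->
  node (upd k j (k j).+1) = upd (node k) j (node k j + h).
Proof.
move=> jd; apply/funext => i; rewrite /upd /node jd.
by case: eqP => [->|//]; rewrite jd -natr1; ring.
Qed.

End bernstein.

Section bernstein_density.
Context {R : realType}.
Variables (d q : nat) (M C : R) (K : set (nat -> R)) (F : @jet R).
Hypotheses (qd : (q <= d)%N) (M0 : 0 < M) (KM : K `<=` box d M).
Hypothesis F_bounded : forall y, box d M y -> `|F 0%N y| <= C.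
Hypothesis dF_bounded : forall y j, K y -> (j <= q)%N -> `|F j y| <= C.
Hypothesis F_continuous : forall e : R, 0 < e -> exists2 r : R, 0 < r &
  forall y z j, K y -> (forall i, (i < d)%N -> `|z i - y i| < r) -> (j <= q)%N ->
    `|F j z - F j y| <= e.
Hypothesis F_derive : exists2 r : R, 0 < r &
  forall y z j, K y -> (forall i, (i < d)%N -> `|z i - y i| < r) -> (j < q)%N ->
    is_derive (z j) 1 (fun s => F 0%N (upd z j s)) (F j.+1 z).

(* The Bernstein polynomial of [F 0] on the box converges with its partial
   derivatives on [K], although [F 0] is only bounded away from [K]: the error
   is estimated with the fourth moment, as the difference quotients of [F 0]
   are only bounded by the number of nodes. *)
Lemma bernstein_density : approximable q K (jpoly d) F.
Proof.
move=> e e0; have e20 : 0 < e / 2 by rewrite divr_gt0.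
have [[y0 Ky0]|K0] := pselect (exists y, K y); last first.
  by exists (jcst 0); [exact: jpoly_cst|move=> y j Ky; case: K0; exists y].
have C0 : 0 <= C by apply: le_trans (dF_bounded Ky0 (leq0n _)).
have [r1 r10 H1] := F_continuous e20; have [r2 r20 H2] := F_derive.
pose r := Num.min r1 r2 / 2.
have r0 : 0 < r by rewrite divr_gt0// lt_min r10.
(* Away from [y], values differ by at most [2 * C], and a difference quotient is at most
   [2 * C / h = N * (C / M)]. Dividing by [r ^+ 4] prepares the comparison with the fourth
   moment. *)
pose B := (2 * C + C / M) / r ^+ 4.
pose D := (2 * C + C / M) / r ^+ 4 * (d%:R * (16 * (2 * M) ^+ 4)).
have CM0 : 0 <= 2 * C + C / M.
  by apply: addr_ge0; [exact: mulr_ge0|exact: divr_ge0 C0 (ltW M0)].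
have B0 : 0 <= B by rewrite divr_ge0// exprn_ge0// ltW.
have D0 : 0 <= D.
  by apply: mulr_ge0 => //; do 2 apply: mulr_ge0 => //; rewrite exprn_ge0// mulr_ge0// ltW.
have Mr0 : 0 <= 2 * M / r by apply: divr_ge0; [rewrite mulr_ge0 // ltW|exact: ltW].
(* The first summand makes the contribution [D / N] of the far nodes at most [e / 2]; the second
   makes the grid finer than [r]. *)
pose n := Num.bound (D / (e / 2) + 2 * M / r).
pose N : R := n.+1%:R; have N0 : 0 < N by rewrite ltr0n.
pose h := 2 * M / N; have h0 : 0 < h by rewrite divr_gt0// mulr_gt0.
have nN : D / (e / 2) + 2 * M / r < N.
  apply: lt_le_trans (archi_boundP _) _; last by rewrite ler_nat.
  by apply: addr_ge0 => //; apply: divr_ge0; rewrite // ltW.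
have DN : D / N <= e / 2.
  rewrite ler_pdivrMr// [leRHS]mulrC -ler_pdivrMr//; apply: ltW; apply: le_lt_trans nN.
  by rewrite lerDl.
have hr : h < r.
  rewrite /h ltr_pdivrMr// [ltRHS]mulrC -ltr_pdivrMr//; apply: le_lt_trans nN.
  by rewrite lerDr; apply: divr_ge0; rewrite // ltW.
pose G k := F 0%N (node d n M k).
pose m : nat -> nat := fun=> n.+1.
pose k0 : nat -> nat := fun=> 0%N.
pose E y := gridexp m (iota 0 d) G k0 (success M y).
have [P pP PE] : is_jpoly d E.
  apply: (is_jpoly_gridexp m G k0 (P := fun i y => success M y i)) => i.
  rewrite mem_iota/= add0n => id.
  exists (jscale (2 * M)^-1 (jadd (jmulX i (jcst 1)) (jcst M))).
    by apply: jpoly_scale; apply: jpoly_add; [apply: jpoly_mulX => //|];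
      exact: jpoly_cst.
  by apply/funext => y; rewrite /jscale/jadd/= mulr1.
exists P => // y j Ky jq.
have yM := KM Ky.
(* Chebyshev's inequality with the fourth moment *)
have far z : ~ (forall i, (i < d)%N -> `|z i - y i| < r) ->
    1 <= (\sum_(i < d) (z i - y i) ^+ 4) / r ^+ 4.
  move=> zy; rewrite ler_pdivlMr ?exprn_gt0// mul1r.
  have [i id zi] : exists2 i, (i < d)%N & r <= `|z i - y i|.
    apply: contrapT => H; apply: zy => i id; rewrite ltNge; apply/negP => zi.
    by apply: H; exists i.
  rewrite (bigD1 (Ordinal id))//= -[X in X <= _]addr0 lerD//.
    by rewrite -[leRHS]ger0_norm ?exprn_even_ge0// normrX lerXn2r ?nnegrE// ltW.
  by apply: sumr_ge0 => i' _; rewrite exprn_even_ge0.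
have sum0 z : 0 <= \sum_(i < d) (z i - y i) ^+ 4.
  by apply: sumr_ge0 => i' _; rewrite exprn_even_ge0.
have r2E : r + r = Num.min r1 r2 by rewrite -splitr.
have rr1 : r < r1.
  by apply: (@lt_le_trans _ _ (r + r)); rewrite ?ltrDl// r2E ge_min lexx.
have rr2 : r + r <= r2 by rewrite r2E ge_min lexx orbT.
have N1 : 1 <= N by rewrite ler1n.
have NB0 : 0 <= N * B by rewrite mulr_ge0// ltW.
have errE : e / 2 + N * B * (d%:R * (16 * (2 * M) ^+ 4 / N ^+ 2)) <= e.
  rewrite [leRHS]splitr lerD2l (_ : _ * _ = D / N)// /D /B; field.
  by rewrite !gt_eqF.
have farB z : ~ (forall i, (i < d)%N -> `|z i - y i| < r) ->
    N * (2 * C + C / M) <= N * B * \sum_(i < d) (z i - y i) ^+ 4.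
  move=> /far zy; rewrite -mulrA ler_pM2l// /B -mulrA -[leLHS]mulr1 ler_wpM2l//.
  by rewrite [leRHS]mulrC.
have mn k' : in_grid m (iota 0 d) k0 k' -> box d M (node d n M k').
  exact: node_box.
case: j jq => [|j] jq.
  rewrite PE; apply: le_trans errE; apply: gridexp_dev => // [i|k' k'm].
    by right.
  have [zy|zy] := pselect (forall i, (i < d)%N -> `|node d n M k' i - y i| < r).
    apply: (@le_trans _ _ (e / 2)); last by rewrite lerDl mulr_ge0.
    by apply: H1 => // i id; exact: lt_trans (zy _ id) rr1.
  apply: le_trans (_ : N * (2 * C + C / M) <= _); last first.
    by apply: le_trans (farB _ zy) _; rewrite lerDr ltW.
  apply: (@le_trans _ _ (2 * C + C / M)); last by rewrite ler_peMl.
  apply: le_trans (ler_normB _ _) _.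
  apply: (@le_trans _ _ (C + C)).
    by rewrite lerD// ?F_bounded//; exact: mn.
  by rewrite mulr2n mulrDl mul1r lerDl divr_ge0// ltW.
have jd : (j < d)%N by exact: leq_trans jq qd.
pose m' := upd m j n.
pose G' k := h^-1 * gdiff j G k.
(* The slot [j.+1] of [P] is a true derivative, so it can be computed by the chain rule through
   [success]; the resulting factor [n.+1 / (2 * M)] is [h^-1]. *)
have -> : P j.+1 y = gridexp m' (iota 0 d) G' k0 (success M y).
  have Pj := jpoly_derives pP y jd.
  have js : j \in iota 0 d by rewrite mem_iota add0n jd.
  have Ej := @gridexp_derive _ m (iota 0 d) G j n k0 (success M y) (iota_uniq 0 d) js erefl.
  have sj : is_derive (y j) 1 (fun s => (2 * M)^-1 * (s + M)) (2 * M)^-1.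
    by apply: is_derive_eq; rewrite /GRing.scale/= addr0 mulr1.
  have EE : (fun s => P 0%N (upd y j s)) =
      (fun v => gridexp m (iota 0 d) G k0 (upd (success M y) j v)) \o
      (fun s => (2 * M)^-1 * (s + M)).
    rewrite PE; apply/funext => s /=; rewrite /E; congr gridexp.
    by apply/funext => i; rewrite /success /upd; case: eqP.
  rewrite EE in Pj.
  have := @is_derive1_comp _ _ (fun s => (2 * M)^-1 * (s + M)) (y j) _ _ Ej sj.
  move=> Pj'; rewrite -(@derive_val _ _ _ _ _ _ _ Pj) (@derive_val _ _ _ _ _ _ _ Pj').
  rewrite /G' -[RHS](_ : gridexp m' (iota 0 d) (fun k => h^-1 * gdiff j G k + 0 * 0) k0 (success M y) = _); last first.
    by congr gridexp; apply/funext => k; rewrite mul0r addr0.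
  rewrite gridexp_lin mul0r addr0 /h; field.
  by rewrite !gt_eqF.
apply: le_trans errE; apply: gridexp_dev => // [i|k' k'm].
  by rewrite /m' /upd; case: eqP => _; [left|right].
have m'n i : (m' i <= n.+1)%N by rewrite /m' /upd; case: eqP.
have m'j : (m' j <= n)%N by rewrite /m' /upd eqxx.
have zM := node_box M0 m'n k'm.
have zM' := box_node_upd M0 m'n m'j jd k'm.
have zE := node_upd n M k' jd.
rewrite /G' /gdiff /G zE; rewrite zE in zM'.
move: zM zM'; set z := node d n M k' => zM zM'.
have [zy|zy] := pselect (forall i, (i < d)%N -> `|z i - y i| < r).
  apply: (@le_trans _ _ (e / 2)); last by rewrite lerDl mulr_ge0.
  (* A whole grid edge starting at a node within [r] of [y] stays within [2 * r], where [F 0] is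
     differentiable with derivative close to that at [y]; the mean value theorem then handles the
     difference quotient. *)
  have near x : `|x - z j| <= h -> forall i, (i < d)%N -> `|upd z j x i - y i| < r + r.
    move=> xz i id; rewrite /upd; case: eqP => [->|_]; last first.
      by rewrite (lt_trans (zy _ id))// ltrDl.
    rewrite -(subrK (z j) x) -addrA; apply: le_lt_trans (ler_normD _ _) _.
    by rewrite ltrD// ?zy// (le_lt_trans xz).
  have hE : z j + h - z j = h by ring.
  have := @mvt_dist _ (fun s => F 0%N (upd z j s)) (fun s => F j.+1 (upd z j s))
    (z j) (z j + h) (F j.+1 y) (e / 2).
  rewrite hE (gtr0_norm h0) upd_id => mvt.
  rewrite -(ler_pM2r h0) -[X in _ * X](gtr0_norm h0) -normrM mulrBl.
  rewrite mulrAC mulVf ?gt_eqF// mul1r; apply: mvt => x /near xz.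
    have := H2 y (upd z j x) j Ky (fun i id => lt_le_trans (xz i id) rr2) jq.
    have -> : upd z j x j = x by rewrite /upd eqxx.
    by congr is_derive; apply/funext => s; rewrite updupd.
  apply: H1 => // i id; apply: lt_le_trans (xz i id) _.
  by rewrite r2E ge_min lexx.
apply: le_trans (_ : N * (2 * C + C / M) <= _); last first.
  by apply: le_trans (farB _ zy) _; rewrite lerDr ltW.
apply: le_trans (ler_normB _ _) _.
rewrite normrM gtr0_norm ?invr_gt0//.
apply: (@le_trans _ _ (h^-1 * (C + C) + C)).
  apply: lerD; last exact: dF_bounded.
  rewrite ler_pM2l ?invr_gt0//; apply: le_trans (ler_normB _ _) _.
  by rewrite lerD// F_bounded.
have -> : h^-1 * (C + C) = N * (C / M).
  by rewrite /h; field; rewrite !gt_eqF.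
rewrite mulrDr addrC lerD2r; apply: (@le_trans _ _ (2 * C)).
  by rewrite mulr2n mulrDl mul1r lerDl.
by rewrite ler_peMl// mulr_ge0.
Qed.

End bernstein_density.

(** * Gluing of local approximations *)

Section step_function.
Context {R : realType}.
Implicit Types (u x h : R).

(** A quadratic remainder treats the kink of a truncated square at 0 like every other point. *)
Lemma quadratic_is_derive (f : R -> R) x (l C : R) :
  (forall h, `|f (x + h) - f x - l * h| <= C * h ^+ 2) -> is_derive x 1 f l.
Proof.
move=> fC; have fl : h^-1 *: ((f \o shift x) (h *: (1 : R)) - f x) @[h --> 0^'] --> l.
  apply/cvgrPdist_le => e e0; near=> h.
  have h0 : h != 0 by near: h; exact: nbhs_dnbhs_neq.
  have hC : `|h| <= e / (`|C| + 1).
    near: h; apply: dnbhs0_le; rewrite divr_gt0// ltr_wpDl//.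
  rewrite /= (_ : h%:A = h); last exact: mulr1.
  rewrite (addrC h) distrC -(ler_pM2r (_ : 0 < `|h|)) ?normr_gt0//.
  rewrite -normrM mulrBl /GRing.scale/= mulrAC mulVf// mul1r.
  apply: le_trans (fC h) _; rewrite -real_normK ?num_real// expr2 mulrA ler_wpM2r//.
  apply: (@le_trans _ _ ((`|C| + 1) * `|h|)).
    by rewrite ler_wpM2r// (le_trans (ler_norm _))// lerDl.
  by rewrite mulrC -ler_pdivlMr// ltr_wpDl.
have dfx : derivable f x 1 by apply/cvg_ex; exists l.
apply: DeriveDef => //; exact: cvg_lim fl.
Unshelve. all: by end_near. Qed.

Definition pos2 u : R := Num.max 0 u ^+ 2.

Lemma pos2_derive u : is_derive u 1 pos2 (2 * Num.max 0 u).
Proof.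
apply: (@quadratic_is_derive _ _ _ 1) => h; rewrite mul1r /pos2 ler_norml.
by case: (lerP 0 u) => u0; case: (lerP 0 (u + h)) => uh; apply/andP; split; nra.
Qed.

(** A C^1 transition from 0 on [u <= 0] to 1 on [1 <= u]. Each of the two nested truncated squares
    flattens one end. *)
Definition step u : R := pos2 (1 - pos2 (1 - u)).
Definition dstep u : R := 2 * Num.max 0 (1 - pos2 (1 - u)) * (2 * Num.max 0 (1 - u)).

Lemma step_derive u : is_derive u 1 step (dstep u).
Proof.
have d1 : is_derive u 1 (fun v => 1 - v) (-1).
  by apply: is_derive_eq; ring.
have d2 := @is_derive1_comp _ _ (fun v => 1 - v) u _ _ (pos2_derive (1 - u)) d1.
have d3 : is_derive u 1 (fun v => 1 - pos2 (1 - v)) (2 * Num.max 0 (1 - u)).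
  by apply: is_derive_eq; ring.
exact: (@is_derive1_comp _ _ (fun v => 1 - pos2 (1 - v)) u _ _ (pos2_derive _) d3).
Qed.

Lemma dstep_continuous : continuous dstep.
Proof.
have cm : continuous (fun u : R => Num.max 0 u).
  by move=> u; apply: continuous_max; [exact: cvg_cst|exact: cvg_id].
have c1 : continuous (fun u : R => Num.max 0 (1 - u)).
  move=> u; apply: (@continuous_comp _ _ _ (fun v : R => 1 - v) (fun v => Num.max 0 v)); last exact: cm.
  by apply: cvgB; [exact: cvg_cst|exact: cvg_id].
have c2 : continuous (fun u : R => Num.max 0 (1 - pos2 (1 - u))).
  move=> u; apply: (@continuous_comp _ _ _ (fun v : R => 1 - pos2 (1 - v)) (fun v => Num.max 0 v)); last exact: cm.
  apply: cvgB; first exact: cvg_cst.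
  by rewrite /pos2; apply: cvgM; exact: c1.
move=> u; apply: cvgM; first by apply: cvgM; [exact: cvg_cst|exact: c2].
by apply: cvgM; [exact: cvg_cst|exact: c1].
Qed.

Lemma step0 u : u <= 0 -> step u = 0 /\ dstep u = 0.
Proof.
move=> u0; rewrite /step /dstep; have -> : Num.max 0 (1 - pos2 (1 - u)) = 0.
  by apply/max_idPl; rewrite /pos2 max_r; nra.
split; last by rewrite mulr0 mul0r.
by rewrite /pos2 (_ : Num.max 0 (1 - _) = 0) ?expr0n//; apply/max_idPl; rewrite max_r; nra.
Qed.

Lemma step1 u : 1 <= u -> step u = 1 /\ dstep u = 0.
Proof.
move=> u1; have E : Num.max 0 (1 - u) = 0 by apply/max_idPl; lra.
rewrite /step /dstep E !mulr0 /pos2 E expr0n/= subr0.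
by rewrite max_r// expr1n.
Qed.

End step_function.

Section jpoly_comp.
Context {R : realType}.
Implicit Types (F G H Q : @jet R) (y z : nat -> R) (d : nat).

Lemma jpoly_unif d (M : R) F : 0 <= M -> jpoly d F ->
  forall e : R, 0 < e -> exists2 r : R, 0 < r & forall y z j, box d M y ->
    (forall i, (i < d)%N -> `|z i - y i| < r) -> (j <= d)%N -> `|F j z - F j y| <= e.
Proof.
move=> M0; elim => {F} [c|F G _ ihF _ ihG|i F id pF ih] e e0.
- by exists 1 => // y z [|j] *; rewrite /= subrr normr0 ltW.
- have e20 : 0 < e / 2 by rewrite divr_gt0.
  have [r1 r10 H1] := ihF _ e20; have [r2 r20 H2] := ihG _ e20.
  exists (Num.min r1 r2); first by rewrite lt_min r10.
  move=> y z j yM yz jd; rewrite /jadd opprD addrACA [e]splitr.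
  apply: le_trans (ler_normD _ _) _; apply: lerD.
    by apply: H1 => // i id; apply: lt_le_trans (yz i id) _; rewrite ge_min lexx.
  by apply: H2 => // i id; apply: lt_le_trans (yz i id) _; rewrite ge_min lexx orbT.
- have M10 : 0 < M + 1 by rewrite ltr_wpDl.
  have [B B0 FB] := jpoly_bounded (ltW M10) pF.
  have e'0 : 0 < e / (2 * (M + 1)) by rewrite divr_gt0// mulr_gt0.
  have [r1 r10 H1] := ih _ e'0.
  have B1 : 0 < B + 1 by rewrite ltr_wpDl.
  pose r := Num.min 1 (e / (2 * (B + 1))).
  have r0 : 0 < r by rewrite lt_min ltr01 divr_gt0// mulr_gt0.
  exists (Num.min r1 r); first by rewrite lt_min r10.
  move=> y z j yM yz jd.
  have yz1 i' : (i' < d)%N -> `|z i' - y i'| < r1.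
    by move=> /yz /lt_le_trans; apply; rewrite ge_min lexx.
  have yzr i' : (i' < d)%N -> `|z i' - y i'| < r.
    by move=> /yz /lt_le_trans; apply; rewrite ge_min lexx orbT.
  have zM : box d (M + 1) z.
    move=> i' id'; rewrite -(subrK (y i') (z i')) addrC.
    apply: le_trans (ler_normD _ _) _; rewrite lerD ?yM//.
    by apply: le_trans (ltW (yzr _ id')) _; rewrite ge_min lexx.
  have rB : r * B <= e / 2.
    apply: (@le_trans _ _ (e / (2 * (B + 1)) * B)).
      by rewrite ler_wpM2r// ge_min lexx orbT.
    by rewrite -mulrA ler_pM2l// ler_pdivrMl ?mulr_gt0//; lra.
  have main k : (k <= d)%N -> `|z i * F k z - y i * F k y| <= e / 2 + M * (e / (2 * (M + 1))).
    move=> kd; rewrite (_ : _ - _ = (z i - y i) * F k z + y i * (F k z - F k y)); last by ring.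
    apply: le_trans (ler_normD _ _) _; rewrite !normrM; apply: lerD.
      by apply: le_trans rB; rewrite ler_pM ?FB// ltW// yzr.
    by rewrite ler_pM ?yM ?H1.
  have eE : e / 2 + M * (e / (2 * (M + 1))) + e / (2 * (M + 1)) = e.
    by field; rewrite gt_eqF.
  rewrite -[leRHS]eE; case: j jd => [|j] jd /=.
    by apply: le_trans (main _ jd) _; rewrite lerDl ltW.
  rewrite [X in `|X|](_ : _ = (z i * F j.+1 z - y i * F j.+1 y) +
    (j == i)%:R * (F 0%N z - F 0%N y)); last by ring.
  apply: le_trans (ler_normD _ _) _; rewrite lerD ?main// normrM.
  rewrite -[leRHS]mul1r ler_pM//; last by apply: H1.
  by case: (j == i); rewrite ?normr0 ?normr1.
Qed.

Definition jcomp (f df : R -> R) Q : jet := fun j y =>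
  if j is _.+1 then df (Q 0%N y) * Q j y else f (Q 0%N y).

(** [bernstein_density] with the whole box as [K] and all [d] derivatives: composing with a
    polynomial keeps the jet continuous and bounded there. *)
Lemma jpoly_comp d (M : R) (f df : R -> R) Q : 0 < M ->
  (forall u : R, is_derive u 1 f (df u)) -> continuous df -> jpoly d Q ->
  approximable d (box d M) (jpoly d) (jcomp f df Q).
Proof.
move=> M0 fdf cdf pQ.
have cf : continuous f.
  by move=> x; apply/differentiable_continuous/derivable1_diffP; case: (fdf x).
have [B B0 QB] := jpoly_bounded (ltW M0) pQ.
have bound (g : R -> R) : continuous g -> exists2 C : R, 0 <= C & forall x, `|x| <= B -> `|g x| <= C.
  move=> cg; have [|C C0 gC] := @compact_bound R R `[- B, B] g (@segment_compact _ _ _).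
    exact: continuous_subspaceT.
  by exists C => // x xB; apply: gC; rewrite /= in_itv/= -ler_norml.
have [C1 C10 fC] := bound _ cf; have [C2 C20 dfC] := bound _ cdf.
apply: (@bernstein_density _ d d M (C1 + C2 * B)) => //.
- by move=> y yM; rewrite (le_trans (fC _ _)) ?QB// lerDl mulr_ge0.
- move=> y [|j] yM jd /=; first by rewrite (le_trans (fC _ _)) ?QB// lerDl mulr_ge0.
  by rewrite normrM -[leLHS]add0r lerD// ler_pM ?dfC ?QB.
- move=> e e0.
  have e'0 : 0 < e / (2 * (B + 1)) by rewrite divr_gt0// mulr_gt0// ltr_wpDl.
  have e''0 : 0 < e / (2 * (C2 + e / (2 * (B + 1)) + 1)).
    by rewrite divr_gt0// mulr_gt0// ltr_wpDl// addr_ge0// ltW.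
  have [d1 d10 H1] := uniform_continuity cf B e0.
  have [d2 d20 H2] := uniform_continuity cdf B e'0.
  have [r1 r10 H3] := jpoly_unif (ltW M0) pQ e''0.
  have d120 : 0 < Num.min d1 d2 / 2 by rewrite divr_gt0// lt_min d10.
  have [r2 r20 H4] := jpoly_unif (ltW M0) pQ d120.
  exists (Num.min r1 r2); first by rewrite lt_min r10.
  move=> y z j yM yz jd.
  have Q1 k : (k <= d)%N -> `|Q k z - Q k y| <= e / (2 * (C2 + e / (2 * (B + 1)) + 1)).
    by apply: H3 => // i id; apply: lt_le_trans (yz i id) _; rewrite ge_min lexx.
  have Q2 : `|Q 0%N z - Q 0%N y| < Num.min d1 d2.
    apply: (@le_lt_trans _ _ (Num.min d1 d2 / 2)); last first.
      by rewrite ltr_pdivrMr// ltr_pMr ?ltr1n// lt_min d10.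
    by apply: H4 => // i id; apply: lt_le_trans (yz i id) _; rewrite ge_min lexx orbT.
  move: Q2; rewrite lt_min => /andP[Q21 Q22].
  case: j jd => [|j] jd /=; first by apply: H1 => //; exact: QB.
  have dfz := H2 _ _ (QB _ _ yM (leq0n d)) Q22.
  rewrite (_ : _ - _ = (df (Q 0%N z) - df (Q 0%N y)) * Q j.+1 y +
    df (Q 0%N z) * (Q j.+1 z - Q j.+1 y)); last by ring.
  have dfz2 : `|df (Q 0%N z)| <= C2 + e / (2 * (B + 1)).
    rewrite -(subrK (df (Q 0%N y)) (df _)) addrC.
    by apply: le_trans (ler_normD _ _) _; rewrite lerD// dfC// QB.
  apply: le_trans (ler_normD _ _) _; rewrite !normrM [leRHS]splitr; apply: lerD.
    apply: (@le_trans _ _ (e / (2 * (B + 1)) * B)); first by rewrite ler_pM// QB.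
    by rewrite -mulrA ler_pM2l// ler_pdivrMl ?mulr_gt0 ?ltr_wpDl//; lra.
  apply: le_trans (ler_pM _ _ dfz2 (Q1 _ jd)) _ => //.
  set D := C2 + _; have D0 : 0 <= D by rewrite addr_ge0// ltW.
  by rewrite mulrCA ler_pM2l// ler_pdivrMr ?mulr_gt0 ?ltr_wpDl//; lra.
- exists 1 => // y z j _ _ jd /=.
  have Qj := jpoly_derives pQ z jd.
  have fQ : is_derive ((fun s => Q 0%N (upd z j s)) (z j)) 1 f (df (Q 0%N z)).
    by rewrite upd_id.
  exact: (@is_derive1_comp _ _ (fun s => Q 0%N (upd z j s)) _ _ _ fQ Qj).
Qed.

End jpoly_comp.

Section gluing.
Context {R : realType}.
Implicit Types (F G H Q : @jet R) (y z : nat -> R).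
Variables (d q : nat) (M : R) (K : set (nat -> R)) (Psi : @jet R).
Hypotheses (qd : (q <= d)%N) (M0 : 0 < M) (KM : K `<=` box d M).

Lemma approximable_mul F P : jpoly d P ->
  approximable d (box d M) (jpoly d) F ->
  approximable d (box d M) (jpoly d) (jmul F P).
Proof.
move=> pP aF e e0; have [B B0 PB] := jpoly_bounded (ltW M0) pP.
have B1 : 0 < 2 * B + 1 by rewrite ltr_wpDl// mulr_ge0.
have [G pG GF] := aF _ (divr_gt0 e0 B1).
exists (jmul G P); first exact: jpoly_mul.
have main j k y : box d M y -> (j <= d)%N -> (k <= d)%N ->
    `|(G j y - F j y) * P k y| <= e / (2 * B + 1) * B.
  by move=> yM jd kd; rewrite normrM ler_pM ?GF ?PB.
have eB : e / (2 * B + 1) * B + e / (2 * B + 1) * B <= e.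
  by rewrite -mulrDr mulrAC ler_pdivrMr// ler_pM2l//; lra.
move=> y [|j] yM jd /=.
  rewrite -mulrBl; apply: le_trans (main _ _ _ yM jd jd) _.
  by apply: le_trans eB; rewrite lerDl mulr_ge0// divr_ge0// ltW.
rewrite [X in `|X|](_ : _ = (G 0%N y - F 0%N y) * P j.+1 y +
  (G j.+1 y - F j.+1 y) * P 0%N y); last by ring.
by apply: le_trans (ler_normD _ _) _; apply: le_trans eB; rewrite lerD ?main.
Qed.

(** With [H] the step of [Q], the glued function is [H * a1 + (1 - H) * a2]. Only [a1] matters where
    [1 <= Q] and only [a2] where [Q <= 0]. In between both are accurate, so the dangerous term, a
    derivative of [H] times [a1 - a2], is small. *)
Lemma approximable_glue (A : set (nat -> R)) Q : jpoly d Q ->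
  approximable q (K `&` [set y | 0 < Q 0%N y]) (jpoly d) Psi ->
  approximable q (K `&` A) (jpoly d) Psi ->
  approximable q (K `&` ([set y | 1 <= Q 0%N y] `|` A)) (jpoly d) Psi.
Proof.
move=> pQ aQ aA; apply: approximable_lim => e e0.
pose H := jcomp step dstep Q.
have aH := jpoly_comp M0 (@step_derive R) (@dstep_continuous R) pQ.
have [D D0 HD] : exists2 D : R, 0 <= D &
    forall y j, box d M y -> (j <= d)%N -> `|H j y| <= D.
  have [G pG GH] := aH _ (@ltr01 R); have [B B0 GB] := jpoly_bounded (ltW M0) pG.
  exists (B + 1); first by rewrite addr_ge0.
  move=> y j yM jd; rewrite -(subrK (G j y) (H j y)) addrC.
  apply: le_trans (ler_normD _ _) _; rewrite lerD ?GB//.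
  by rewrite distrC GH.
have D1 : 0 < 1 + 4 * D by rewrite ltr_pwDl// mulr_ge0.
pose e' := e / (1 + 4 * D); have e'0 : 0 < e' by rewrite divr_gt0.
have [a1 pa1 a1P] := aQ _ e'0; have [a2 pa2 a2P] := aA _ e'0.
exists (jadd (jmul H a1) (jadd a2 (jscale (-1) (jmul H a2)))).
  move=> e1 e10.
  have aHP P : jpoly d P -> approximable d (box d M) (jpoly d) (jmul H P).
    by move=> pP; exact: approximable_mul.
  have [G pG GF] : exists2 G, jpoly d G & jclose d (box d M) e1 G
      (jadd (jmul H a1) (jadd a2 (jscale (-1) (jmul H a2)))).
    apply: approximable_add e10 => //; [exact: jpoly_add|exact: aHP|].
    apply: approximable_add; [exact: jpoly_add|exact: approximable_in|].
    by apply: approximable_scale; [exact: jpoly_scale|exact: aHP].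
  exists G => // y j [Ky _] jq; apply: GF; [exact: KM|exact: leq_trans qd].
move=> y j [Ky yA] jq; have yM := KM Ky; have jd := leq_trans jq qd.
have eE : e = e' + 2 * (D * e') + 2 * (D * e').
  by rewrite /e'; field; rewrite gt_eqF.
have De'0 : 0 <= D * e' by rewrite mulr_ge0// ltW.
have e'e : e' <= e by rewrite [leRHS]eE; lra.
have jmulE : jadd (jmul H a1) (jadd a2 (jscale (-1) (jmul H a2))) j y =
  H 0%N y * a1 j y + (1 - H 0%N y) * a2 j y +
  (if j is _.+1 then H j y * (a1 0%N y - a2 0%N y) else 0).
  by case: j {jq jd} => [|j]; rewrite /jadd/jscale/jmul; ring.
rewrite jmulE.
have [Q1|Q1] := leP 1 (Q 0%N y).
  have [s1 s2] := step1 Q1.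
  have h1 : `|a1 j y - Psi j y| <= e'.
    by apply: a1P => //; split=> //=; exact: lt_le_trans Q1.
  have -> : H 0%N y = 1 by rewrite /H/= s1.
  have -> : (if j is _.+1 then H j y * (a1 0%N y - a2 0%N y) else 0) = 0.
    by case: j {jq jd jmulE h1} => // j; rewrite /H/= s2 !mul0r.
  by rewrite subrr mul0r mul1r !addr0 (le_trans h1).
have {yA} Ay : A y by case: yA => //=; rewrite leNgt Q1.
have h2 k : (k <= q)%N -> `|a2 k y - Psi k y| <= e' by move=> kq; apply: a2P.
have [Q0|Q0] := leP (Q 0%N y) 0.
  have [s1 s2] := step0 Q0.
  have -> : H 0%N y = 0 by rewrite /H/= s1.
  have -> : (if j is _.+1 then H j y * (a1 0%N y - a2 0%N y) else 0) = 0.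
    by case: j {jq jd jmulE} => // j; rewrite /H/= s2 !mul0r.
  by rewrite subr0 mul0r mul1r add0r addr0 (le_trans (h2 _ jq)).
have h1 k : (k <= q)%N -> `|a1 k y - Psi k y| <= e' by move=> kq; apply: a1P.
have HD0 := HD _ _ yM (leq0n d).
rewrite [X in `|X|](_ : _ = (a2 j y - Psi j y) +
  H 0%N y * ((a1 j y - Psi j y) - (a2 j y - Psi j y)) +
  (if j is _.+1 then H j y * ((a1 0%N y - Psi 0%N y) - (a2 0%N y - Psi 0%N y)) else 0)).
  have two k : (k <= q)%N -> `|(a1 k y - Psi k y) - (a2 k y - Psi k y)| <= 2 * e'.
    move=> kq; apply: le_trans (ler_normB _ _) _.
    by rewrite mulr2n mulrDl mul1r lerD ?h1 ?h2.
  have De k l : (k <= d)%N -> (l <= q)%N ->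
      `|H k y * ((a1 l y - Psi l y) - (a2 l y - Psi l y))| <= 2 * (D * e').
    by move=> kd lq; rewrite normrM mulrCA ler_pM ?HD ?two.
  rewrite eE; apply: le_trans (ler_normD _ _) _; apply: lerD; last first.
    case: j jq jd jmulE => [|j] jq jd _; first by rewrite normr0 mulr_ge0.
    exact: De.
  by apply: le_trans (ler_normD _ _) _; rewrite lerD ?h2 ?De.
by case: j {jq jd jmulE} => [|j]; ring.
Qed.

End gluing.

(** * Polynomial approximation of the solution *)

Section euclidean_norm.
Context {R : realType}.
Implicit Types (x y z a : R3 R) (k : R).

Lemma dotC x y : dot x y = dot y x.
Proof. by rewrite /dot; ring. Qed.

Lemma dotDl x y z : dot (x + y) z = dot x z + dot y z.
Proof. by rewrite /dot/=; ring. Qed.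

Lemma dotBl x y z : dot (x - y) z = dot x z - dot y z.
Proof. by rewrite /dot/=; ring. Qed.

Lemma dotZl k x z : dot (k *: x) z = k * dot x z.
Proof. by rewrite /dot/= /GRing.scale/=; ring. Qed.

Lemma dot_ge0 x : 0 <= dot x x.
Proof. by rewrite /dot -!expr2 !addr_ge0 ?sqr_ge0. Qed.

Lemma sqr_enorm x : enorm x ^+ 2 = dot x x.
Proof. by rewrite sqr_sqrtr// dot_ge0. Qed.

(** Lagrange's identity: the defect in the squared Cauchy-Schwarz inequality is the squared norm of
    the cross product. *)
Lemma dot_enorm x y : `|dot x y| <= enorm x * enorm y.
Proof.
rewrite -(@ler_pXn2r _ 2)// ?nnegrE ?mulr_ge0 ?enorm_ge0//.
rewrite real_normK ?num_real// exprMn !sqr_enorm -subr_ge0.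
rewrite (_ : _ - _ = (x.1.1 * y.1.2 - x.1.2 * y.1.1) ^+ 2 +
  (x.1.1 * y.2 - x.2 * y.1.1) ^+ 2 + (x.1.2 * y.2 - x.2 * y.1.2) ^+ 2).
  by rewrite !addr_ge0 ?sqr_ge0.
by rewrite /dot; ring.
Qed.

Lemma enormD x y : enorm (x + y) <= enorm x + enorm y.
Proof.
rewrite -(@ler_pXn2r _ 2)// ?nnegrE ?addr_ge0 ?enorm_ge0//.
rewrite sqr_enorm sqrrD !sqr_enorm.
have -> : dot (x + y) (x + y) = dot x x + 2 * dot x y + dot y y by rewrite /dot/=; ring.
have := le_trans (ler_norm _) (dot_enorm x y); lra.
Qed.

Lemma enormZ k x : enorm (k *: x) = `|k| * enorm x.
Proof.
rewrite /enorm dotZl dotC dotZl mulrA -expr2 sqrtrM ?sqr_ge0//.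
by rewrite sqrtr_sqr.
Qed.

Lemma enormN x : enorm (- x) = enorm x.
Proof. by rewrite -scaleN1r enormZ normrN normr1 mul1r. Qed.

Lemma enorm_dist_triangle y x z : enorm (x - z) <= enorm (x - y) + enorm (y - z).
Proof. by rewrite (_ : x - z = (x - y) + (y - z)) ?enormD// addrA subrK. Qed.

Lemma enorm_distC x y : enorm (x - y) = enorm (y - x).
Proof. by rewrite -enormN opprB. Qed.

Lemma enorm_le_coord x (e : R) : `|x.1.1| <= e -> `|x.1.2| <= e -> `|x.2| <= e ->
  enorm x <= 3 * e.
Proof.
move=> x1 x2 x3; have e0 : 0 <= e := le_trans (normr_ge0 _) x1.
rewrite -(@ler_pXn2r _ 2)// ?nnegrE ?mulr_ge0 ?enorm_ge0//.
have sq (t : R) : `|t| <= e -> t ^+ 2 <= e ^+ 2.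
  by move=> te; rewrite -real_normK ?num_real// ler_pXn2r ?nnegrE.
rewrite sqr_enorm /dot -!expr2.
have := sq _ x1; have := sq _ x2; have := sq _ x3; have := sqr_ge0 e; lra.
Qed.

Lemma open_enorm (X : set (R3 R)) x : open X -> X x ->
  exists2 r : R, 0 < r & forall y, enorm (y - x) < r -> X y.
Proof.
move=> oX Xx; have /nbhs_ballP[r /= r0 rX] := open_nbhs_nbhs (conj oX Xx).
exists r => // y yr; apply: rX; split; [split|]; rewrite /ball/= distrC.
- exact: le_lt_trans (le_enorm1 (y - x)) yr.
- exact: le_lt_trans (le_enorm2 (y - x)) yr.
- exact: le_lt_trans (le_enorm3 (y - x)) yr.
Qed.

Lemma closure_enorm (X : set (R3 R)) x : closure X x ->
  forall r : R, 0 < r -> exists2 y, X y & enorm (y - x) < r.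
Proof.
move=> cX r r0; have r40 : 0 < r / 4 by rewrite divr_gt0.
have [y [Xy [[y1 y2] y3]]] := cX _ (nbhsx_ballx x (PosNum r40)%:num r40).
exists y => //; apply: le_lt_trans (_ : 3 * (r / 4) < r); last by lra.
by apply: enorm_le_coord; rewrite distrC ltW.
Qed.

Lemma lipschitz_bound (zeta : R * R -> R) : lipschitz zeta ->
  exists2 k : R, 0 <= k & forall u v, `|zeta u - zeta v| <= k * `|u - v|.
Proof.
move=> [k [_ kz]]; exists (Num.max 0 (k + 1)); first by rewrite le_max lexx.
move=> u v; have := kz (Num.max 0 (k + 1)) _ (u, v); apply => //.
by rewrite lt_max ltrDl ltr01 orbT.
Qed.

(* [c] is the vertical direction of a boundary chart, or 0 if [p] is in [X]. *)
Lemma local_shift (X : set (R3 R)) p : open X -> lipschitz_boundary X ->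
  closure X p -> exists (c : R3 R) (r e0 : R), [/\ 0 < r, 0 < e0 &
    forall e, 0 < e < e0 -> exists2 del : R, 0 < del &
      forall x z, closure X x -> enorm (x - p) < r -> enorm (z - x) < del ->
        X (z + e *: c)].
Proof.
move=> oX lX cXp; have [Xp|Xp] := pselect (X p).
  have [r r0 rX] := open_enorm oX Xp.
  exists 0, (r / 2), 1; split; [by rewrite divr_gt0|exact: ltr01|].
  move=> e _; exists (r / 2); first by rewrite divr_gt0.
  move=> x z _ xp zx; rewrite scaler0 addr0; apply: rX.
  by apply: le_lt_trans (enorm_dist_triangle x _ _) _; rewrite [r]splitr ltrD.
have bp : boundary X p by split => // /interior_subset.
have [a [b [c [zeta [r [[a1 b1 c1] [ab ac bc] /lipschitz_bound[k k0 zk] r0 Xr]]]]]] := lX _ bp.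
exists c, (r / 4), (r / 4); split; [by rewrite divr_gt0|by rewrite divr_gt0|].
move=> e /andP[e0 er].
(* A point [x'] of [X] is taken within [del] of [x], so [z] is within [2 * del] of [x']. Passing to
   [z] raises the graph by at most [2 * k * del] and lowers the height by at most [2 * del]; the
   vertical gain [e] compensates both. The bound [r / 8] keeps all points in the chart. *)
pose del := Num.min (e / (2 * (k + 1))) (r / 8).
have k1 : 0 < k + 1 by rewrite ltr_wpDl.
have del0 : 0 < del by rewrite lt_min !divr_gt0// mulr_gt0.
exists del => // x z cXx xp zx.
have [x' Xx' x'x] := closure_enorm cXx del0.
have delr : del <= r / 8 by rewrite ge_min lexx orbT.
have delk : del * (2 * (k + 1)) <= e.
  by rewrite -ler_pdivlMr ?mulr_gt0// ge_min lexx.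
have zx' : enorm (z - x') < 2 * del.
  apply: le_lt_trans (enorm_dist_triangle x _ _) _.
  by rewrite (enorm_distC x); lra.
have x'p : enorm (x' - p) < r.
  by apply: le_lt_trans (enorm_dist_triangle x _ _) _; lra.
have zp : enorm (z + e *: c - p) < r.
  rewrite (_ : _ - p = (z - x) + (x - p) + e *: c); last first.
    by rewrite addrA subrK addrAC.
  apply: le_lt_trans (enormD _ _) _; rewrite enormZ c1 mulr1 gtr0_norm//.
  by have := enormD (z - x) (x - p); lra.
have {x'p} Xx'' := (Xr _ x'p).1 Xx'.
apply/(Xr _ zp).
have shift (v : R3 R) : dot (z + e *: c - p) v = dot (z - x') v + dot (x' - p) v + e * dot c v.
  by rewrite !dotBl dotDl dotZl; ring.
rewrite !shift (dotC c a) (dotC c b) ac bc mulr0 !addr0.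
rewrite (_ : dot c c = 1) ?mulr1; last by rewrite -sqr_enorm c1 expr1n.
have da v : enorm v = 1 -> `|dot (z - x') v| <= enorm (z - x').
  by move=> v1; apply: le_trans (dot_enorm _ _) _; rewrite v1 mulr1.
have := zk (dot (z - x') a + dot (x' - p) a, dot (z - x') b + dot (x' - p) b)
  (dot (x' - p) a, dot (x' - p) b).
have : `|(dot (z - x') a + dot (x' - p) a, dot (z - x') b + dot (x' - p) b) -
  (dot (x' - p) a, dot (x' - p) b) : R * R| <= 2 * del.
  by rewrite prod_normE/= !addrK ge_max !(le_trans (da _ _)) ?ltW.
move=> /(ler_wpM2l k0) h1 /(le_trans (ler_norm _)) h2.
have := da _ c1; rewrite ler_norml => /andP[h3 _].
move: h1 h2 h3 zx' Xx'' delk; nra.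
Qed.

End euclidean_norm.

Section one_variable_derivatives.
Context {R : realType}.
Implicit Types (u : R3 R -> R) (x : R3 R) (l : R).

Lemma is_derive_along (V : normedModType R) (u : V -> R) (x v : V) (g : R -> R) (a l : R) :
  (forall h, u (h *: v + x) = g (h + a)) -> u x = g a ->
  is_derive x v u l <-> is_derive a 1 g l.
Proof.
move=> ug uga.
have E : (fun h => h^-1 *: ((u \o shift x) (h *: v) - u x)) =
    (fun h => h^-1 *: ((g \o shift a) (h *: (1 : R)) - g a)).
  apply/funext => h /=; rewrite ug uga.
  by rewrite (_ : h%:A = h)//; exact: mulr1.
by split=> -[d1 d2]; apply: DeriveDef; move: d1 d2; rewrite /derivable /derive E.
Qed.

Lemma is_derive_e1 u x l :
  is_derive x e1 u l <-> is_derive (x.1.1 : R) 1 (fun s => u ((s, x.1.2), x.2)) l.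
Proof.
apply: is_derive_along => [h|]; last by case: x => [[]].
congr u; case: x => [[x1 x2] x3]; rewrite /e1 /=.
by congr ((_, _), _); rewrite /= ?scaler0 ?add0r//; exact: (congr1 (+%R^~ _) (mulr1 h)).
Qed.

Lemma is_derive_e2 u x l :
  is_derive x e2 u l <-> is_derive (x.1.2 : R) 1 (fun s => u ((x.1.1, s), x.2)) l.
Proof.
apply: is_derive_along => [h|]; last by case: x => [[]].
congr u; case: x => [[x1 x2] x3]; rewrite /e2 /=.
by congr ((_, _), _); rewrite /= ?scaler0 ?add0r//; exact: (congr1 (+%R^~ _) (mulr1 h)).
Qed.

Lemma is_derive_e3 u x l :
  is_derive x e3 u l <-> is_derive (x.2 : R) 1 (fun s => u ((x.1.1, x.1.2), s)) l.
Proof.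
apply: is_derive_along => [h|]; last by case: x => [[]].
congr u; case: x => [[x1 x2] x3]; rewrite /e3 /=.
by congr ((_, _), _); rewrite /= ?scaler0 ?add0r//; exact: (congr1 (+%R^~ _) (mulr1 h)).
Qed.

(** At an interior time, the restriction to [[0, T]] does not change small punctured
    neighbourhoods. *)
Lemma is_derive_within (g : R -> R) (T t l : R) : 0 < t < T ->
  (g s - g t) / (s - t) @[s --> within `[0, T] t^'] --> l -> is_derive t 1 g l.
Proof.
move=> /andP[t0 tT] gl.
have gl' : h^-1 *: ((g \o shift t) (h *: (1 : R)) - g t) @[h --> 0^'] --> l.
  apply/cvgrPdist_lt => e e0.
  move/cvgrPdist_lt : gl => /(_ _ e0).
  rewrite near_withinE /dnbhs near_withinE => /nbhs_ballP[r /= r0 rH].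
  near=> h.
  have h0 : h != 0 by near: h; exact: nbhs_dnbhs_neq.
  have hr : `|h| < Num.min r (Num.min t (T - t)).
    by near: h; apply: dnbhs0_lt; rewrite !lt_min r0 t0 subr_gt0.
  move: hr; rewrite !lt_min => /and3P[hr ht hT].
  have := rH (h + t); rewrite /ball/= opprD addrCA subrr addr0 normrN => /(_ hr).
  rewrite /= (_ : h%:A = h) ?[_%:A]mulr1// => /(_ _ _)/=.
  rewrite addrK /GRing.scale/= mulrC; apply.
    by rewrite -subr_eq0 addrK.
  move: ht hT; rewrite !ltr_norml in_itv/= => /andP[? ?] /andP[? ?].
  apply/andP; split; lra.
have dg : derivable g t 1 by apply/cvg_ex; exists l.
apply: DeriveDef => //; exact: cvg_lim gl'.
Unshelve. all: by end_near. Qed.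

End one_variable_derivatives.

Section cylinder.
Context {R : realType}.
Variables (T : R) (X : set (R3 R)).
Hypothesis bX : bounded_set X.
Implicit Types (x w : R3 R).

Definition cube (M : R) : set (R3 R) := (`[- M, M] `*` `[- M, M]) `*` `[- M, M].

Lemma cube_compact M : compact (cube M).
Proof.
apply: compact_setX; last exact: (@segment_compact R).
by apply: compact_setX; exact: (@segment_compact R).
Qed.

Lemma closure_cube : exists2 M : R, 0 <= M & closure X `<=` cube M.
Proof.
have [M [_ MX]] := bX; exists (Num.max 0 (M + 1)); first by rewrite le_max lexx.
have XM : X `<=` cube (Num.max 0 (M + 1)).
  move=> x Xx; have := MX (Num.max 0 (M + 1)) _ x Xx.
  rewrite lt_max ltrDl ltr01 orbT => /(_ isT).
  rewrite /= prod_normE/= ge_max prod_normE/= ge_max => /andP[/andP[x1 x2] x3].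
  by split; [split|]; rewrite /= in_itv/= -ler_norml.
have cc : closed (cube (Num.max 0 (M + 1))).
  by apply: compact_closed; [exact: norm_hausdorff|exact: cube_compact].
by rewrite ((closure_id _).1 cc); exact: closureS.
Qed.

Lemma closure_compact : compact (closure X).
Proof.
have [M _ XM] := closure_cube.
by apply: subclosed_compact (cube_compact (M := M)) XM; exact: closed_closure.
Qed.

Lemma sphere_closed : closed (@sphere R).
Proof.
move=> x clx; apply/eqP; rewrite eq_le; apply/andP; split.
  apply/ler_addgt0Pr => e e0; have [y y1 yx] := closure_enorm clx e0.
  rewrite -y1 -[x](subrK y) addrC; apply: le_trans (enormD _ _) _.
  by rewrite lerD2l enorm_distC ltW.
apply/ler_addgt0Pr => e e0; have [y y1 yx] := closure_enorm clx e0.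
rewrite -y1 -[y](subrK x) addrC; apply: le_trans (enormD _ _) _.
by rewrite lerD2l ltW.
Qed.

Lemma sphere_cube : @sphere R `<=` cube 1.
Proof.
move=> x x1; split; [split|]; rewrite /= in_itv/= -ler_norml -x1.
- exact: le_enorm1.
- exact: le_enorm2.
- exact: le_enorm3.
Qed.

Lemma sphere_compact : compact (@sphere R).
Proof. by apply: subclosed_compact sphere_closed (cube_compact (M := 1)) sphere_cube. Qed.

Lemma closed_cylinderE : closed_cylinder T X = (`[0, T] `*` closure X) `*` sphere.
Proof.
apply/seteqP; split=> -[[t x] w] /=; first by move=> [tT Xx w1]; split; [split|]; rewrite /= ?in_itv.
by move=> [[/=]]; rewrite in_itv => tT Xx w1; split.
Qed.

Lemma closed_cylinder_compact : compact (closed_cylinder T X).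
Proof.
rewrite closed_cylinderE; apply: compact_setX; last exact: sphere_compact.
by apply: compact_setX; [exact: segment_compact|exact: closure_compact].
Qed.

End cylinder.

Lemma finite_radius {R : realType} (P : nat -> R -> Prop) n :
  (forall j r r', P j r -> r' <= r -> P j r') ->
  (forall j, (j <= n)%N -> exists2 r : R, 0 < r & P j r) ->
  exists2 r : R, 0 < r & forall j, (j <= n)%N -> P j r.
Proof.
move=> Ple; elim: n => [|n ih] H.
  have [r r0 Pr] := H 0%N isT; exists r => // j.
  by rewrite leqn0 => /eqP ->.
have [j jn|r r0 Pr] := ih; first by apply: H; exact: leqW.
have [r' r'0 Pr'] := H n.+1 (leqnn _).
exists (Num.min r r'); first by rewrite lt_min r0.
move=> j; rewrite leq_eqVlt => /predU1P[->|jn].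
  by apply: Ple Pr' _; rewrite ge_min lexx orbT.
by apply: Ple (Pr j jn) _; rewrite ge_min lexx.
Qed.

(** Near-covering compactness is applied to the filter of tails on finite lists of points of [K],
    directed by inclusion. *)
Lemma compact_finite_subcover (T : topologicalType) (K : set T) (B : T -> set T) :
  compact K -> (forall p, K p -> nbhs p (B p)) ->
  exists2 s : seq T, {in s, forall p, K p} &
    K `<=` [set x | exists2 p, p \in s & B p x].
Proof.
move=> /compact_near_coveringP cK KB.
pose F : set_system (seq T) := fun U => exists2 s0 : seq T, {in s0, forall p, K p} &
  forall s : seq T, {in s, forall p, K p} -> {subset s0 <= s} -> U s.
have FF : Filter F.
  split; first by exists [::].
    move=> U V [s0 K0 sU] [s1 K1 sV]; exists (s0 ++ s1).
      by move=> p; rewrite mem_cat => /orP[/K0|/K1].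
    move=> s Ks ss; split; [apply: sU => // p ps|apply: sV => // p ps];
      by apply: ss; rewrite mem_cat ps ?orbT.
  by move=> U V UV [s0 K0 sU]; exists s0 => // s Ks ss; apply/UV/sU.
have [p Kp|s0 K0 /(_ s0 K0)] := cK _ F (fun (s : seq T) x => exists2 p, p \in s & B p x) FF.
  exists (B p, [set s : seq T | p \in s]) => /=; last by move=> [x s] /= [Bx ps]; exists p.
  split; first exact: KB.
  exists [:: p]; first by move=> q; rewrite inE => /eqP ->.
  by move=> s _ /(_ p); rewrite inE eqxx; apply.
by move=> H; exists s0 => //; exact: H.
Qed.

(** Normalizing moves [w] by the distance of its norm to 1, which is at most its distance to the
    unit vector [w']. *)
Lemma enorm_normalize {R : realType} (w w' : R3 R) : enorm w' = 1 -> 0 < enorm w ->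
  enorm ((enorm w)^-1 *: w - w') <= 2 * enorm (w - w').
Proof.
move=> w'1 w0; rewrite (_ : _ - w' = ((enorm w)^-1 - 1) *: w + (w - w')); last first.
  by rewrite scalerBl scale1r addrA subrK.
apply: le_trans (enormD _ _) _; rewrite enormZ mulr2n mulrDl mul1r lerD2r.
rewrite -{2}[enorm w](gtr0_norm w0) -normrM mulrBl mulVf ?gt_eqF// mul1r.
rewrite ler_norml; apply/andP; split.
  rewrite lerNl opprB lerBlDr -w'1 -{1}[w](subrK w').
  exact: enormD.
rewrite lerBlDr -w'1 -{1}[w'](subrK w); apply: le_trans (enormD _ _) _.
by rewrite enorm_distC.
Qed.

Section solution_approximation.
Context {R : realType}.
Variables (T : R) (X : set (R3 R)) (psi psi_t : R -> R3 R -> R3 R -> R)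
  (psi_x : R -> R3 R -> R3 R -> R3 R).
Hypotheses (T0 : 0 < T) (oX : open X) (bX : bounded_set X) (lX : lipschitz_boundary X).
Hypothesis psi_C1 : C1_up_to_boundary T X psi psi_t psi_x.
Implicit Types (y : nat -> R) (z : R * R3 R * R3 R) (p : R3 R).

Local Notation cyl := (closed_cylinder T X).

Definition ptx y : R3 R := ((y 1%N, y 2%N), y 3%N).
Definition ptw y : R3 R := ((y 4%N, y 5%N), y 6%N).
Definition pt y : R * R3 R * R3 R := ((y 0%N, ptx y), ptw y).

(** The slots follow the coordinates of [pt]: the value, then the derivatives in [t] and the three
    components of [x]. The direction has no slot, hence 4 derivatives for 7 variables in what
    follows. *)
Definition psi_data (j : nat) z : R :=
  match j with
  | 0 => psi z.1.1 z.1.2 z.2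
  | 1 => psi_t z.1.1 z.1.2 z.2
  | 2 => (psi_x z.1.1 z.1.2 z.2).1.1
  | 3 => (psi_x z.1.1 z.1.2 z.2).1.2
  | _ => (psi_x z.1.1 z.1.2 z.2).2
  end.

Definition psi_jet : @jet R := fun j y => psi_data j (pt y).

Definition cyl_pts : set (nat -> R) := [set y | cyl (pt y)].

Let cylK := closed_cylinder_compact (T := T) bX.

Lemma psi_data_continuous j : {within cyl, continuous (psi_data j)}.
Proof.
have [c0 c1 c2 _ _] := psi_C1.
have c11 : continuous (fun x : R3 R => x.1.1 : R).
  move=> x; apply: (@continuous_comp _ _ _ (fst : R3 R -> _) fst); exact: cvg_fst.
have c12 : continuous (fun x : R3 R => x.1.2 : R).
  move=> x; apply: (@continuous_comp _ _ _ (fst : R3 R -> _) snd); [exact: cvg_fst|exact: cvg_snd].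
have c22 : continuous (fun x : R3 R => x.2 : R) by move=> x; exact: cvg_snd.
case: j => [|[|[|[|j]]]] //= z.
- exact: (@continuous_comp _ _ _ _ (fun x : R3 R => x.1.1 : R) z (c2 z) (c11 _)).
- exact: (@continuous_comp _ _ _ _ (fun x : R3 R => x.1.2 : R) z (c2 z) (c12 _)).
- exact: (@continuous_comp _ _ _ _ (fun x : R3 R => x.2 : R) z (c2 z) (c22 _)).
Qed.

Lemma psi_data_unif (e : R) : 0 < e -> exists2 r : R, 0 < r & forall j, (j <= 4)%N ->
  forall z z', cyl z -> cyl z' -> ball z r z' -> `|psi_data j z' - psi_data j z| <= e.
Proof.
move=> e0; apply: finite_radius.
  by move=> j r r' H r'r z z' Cz Cz' zz'; apply: H => //; exact: le_ball zz'.
move=> j _; have [|||r r0 rH] := @compact_unif R _ cyl cyl (psi_data j) _ _ _ e e0.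
- exact: cylK.
- by [].
- move=> z Cz; have := @psi_data_continuous j z.
  by rewrite /continuous_at nbhs_subspace_in.
by exists r => // z z' Cz Cz' zz'; exact: rH.
Qed.

Lemma psi_data_bound : exists2 C : R, 0 <= C & forall j, (j <= 4)%N ->
  forall z, cyl z -> `|psi_data j z| <= C.
Proof.
have H j : exists2 C : R, 0 <= C & forall z, cyl z -> `|psi_data j z| <= C.
  exact: compact_bound cylK (@psi_data_continuous j).
have [C0 C00 H0] := H 0%N; have [C1 C10 H1] := H 1%N; have [C2 C20 H2] := H 2%N.
have [C3 C30 H3] := H 3%N; have [C4 C40 H4] := H 4%N.
exists (C0 + C1 + C2 + C3 + C4); first by rewrite !addr_ge0.
move=> j + z Cz; case: j => [|[|[|[|[|//]]]]] _.
- have := H0 z Cz; lra.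
- have := H1 z Cz; lra.
- have := H2 z Cz; lra.
- have := H3 z Cz; lra.
- have := H4 z Cz; lra.
Qed.

Lemma cyl_pts_box : exists2 M : R, 0 < M & cyl_pts `<=` box 7 M.
Proof.
have [M M0 XM] := closure_cube bX; exists (M + T + 1); first by rewrite ltr_wpDl// addr_ge0// ltW.
move=> y [/andP[t0 tT] /XM[[x1 x2] x3] /sphere_cube[[w1 w2] w3]].
move: x1 x2 x3 w1 w2 w3; rewrite /= !in_itv/= -!ler_norml => x1 x2 x3 w1 w2 w3.
move: t0 tT => /= t0 tT.
have xM v : `|v| <= M -> `|v| <= M + T + 1.
  by move=> /le_trans; apply; rewrite -addrA lerDl addr_ge0// ltW.
have wM v : `|v| <= 1 -> `|v| <= M + T + 1.
  by move=> /le_trans; apply; rewrite lerDr addr_ge0// ltW.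
do 7?[case=> [|i]; last move: i] => //= _; try solve [exact: xM|exact: wM].
rewrite ger0_norm//; apply: le_trans tT _; rewrite addrAC lerDr addr_ge0//.
Qed.

Section local.
Variables (p c : R3 R) (r e0 : R).
Hypothesis e00 : 0 < e0.
Hypothesis shiftX : forall e : R, 0 < e < e0 -> exists2 del : R, 0 < del &
  forall x u : R3 R, closure X x -> enorm (x - p) < r -> enorm (u - x) < del ->
    X (u + e *: c).

Let K := cyl_pts `&` [set y | enorm (ptx y - p) < r].

(* Shrinks time towards [T / 2], shifts space inwards and extends the direction
   radially: a neighbourhood of [K] is mapped into the cylinder. *)
Let shrink (e : R) y : R * R3 R * R3 R :=
  ((T / 2 + (1 - e) * (y 0%N - T / 2), ptx y + e *: c), (enorm (ptw y))^-1 *: ptw y).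

(** The factor 7 is dictated by the direction: coordinate errors [r'] give a norm error of at most
    [3 * r'], and normalizing doubles it. *)
Let shrink_near (e : R) : 0 < e < e0 -> e <= 1 / 2 -> exists2 del : R, 0 < del &
  forall y (z' : nat -> R), K y -> (forall i, (i < 7)%N -> `|z' i - y i| < del) ->
    [/\ 0 < (shrink e z').1.1 < T, X (shrink e z').1.2, cyl (shrink e z') &
        forall r', r' <= del -> (forall i, (i < 7)%N -> `|z' i - y i| < r') ->
          ball (shrink e y) (7 * r') (shrink e z')].
Proof.
move=> e0e e2; have [del0 del00 H] := shiftX e0e.
have /andP[e_gt0 _] := e0e.
(* [del0 / 4] keeps the position within reach of the inward shift, [e * T / 4] the time inside the
   margin [e * T / 2] gained by shrinking, and 1/8 the direction away from the origin. *)
pose del := Num.min (del0 / 4) (Num.min (e * T / 4) (1 / 8)).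
have del_gt0 : 0 < del by rewrite !lt_min !divr_gt0// mulr_gt0.
exists del => // y z' [[/andP[/= t0 tT] clx w1] xp] near.
have del1 : del <= del0 / 4 by rewrite ge_min lexx.
have del2 : del <= e * T / 4 by rewrite !ge_min lexx orbT.
have del3 : del <= 1 / 8 by rewrite !ge_min lexx !orbT.
have xz r' : (forall i, (i < 7)%N -> `|z' i - y i| < r') ->
    enorm (ptx z' - ptx y) <= 3 * r'.
  by move=> nr; apply: enorm_le_coord => /=; apply: ltW; exact: nr.
have wz r' : (forall i, (i < 7)%N -> `|z' i - y i| < r') ->
    enorm (ptw z' - ptw y) <= 3 * r'.
  by move=> nr; apply: enorm_le_coord => /=; apply: ltW; exact: nr.
have t'T : 0 < (shrink e z').1.1 < T.
  have := near 0%N isT; rewrite ltr_norml /= => /andP[n1 n2].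
  by apply/andP; split; nra.
have Xz : X (shrink e z').1.2.
  apply: (H (ptx y)) => //; apply: le_lt_trans (xz _ near) _; lra.
have w'0 : 0 < enorm (ptw z').
  have := enormD (ptw y - ptw z') (ptw z'); rewrite subrK w1 enorm_distC.
  have := wz _ near; lra.
have w'1 : enorm ((shrink e z').2) = 1.
  by rewrite /= enormZ gtr0_norm ?invr_gt0// mulVf// gt_eqF.
split => //.
  split => //=; last exact: subset_closure.
  by case/andP: t'T => t'0 t'T; rewrite !ltW.
move=> r' r'del nr.
have r'0 : 0 < r' by apply: le_lt_trans (nr 0%N isT).
have yw : (shrink e y).2 = ptw y by rewrite /shrink/= w1 invr1 scale1r.
have ww : enorm ((shrink e z').2 - (shrink e y).2) < 7 * r'.
  rewrite yw; apply: le_lt_trans (enorm_normalize w1 w'0) _.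
  by have := wz _ nr; lra.
have r'7 (u : R) : `|u| < r' -> `|u| < 7 * r'.
  by move=> /lt_trans; apply; rewrite ltr_pMl// ltr1n.
split; [split; [|split; [split|]]|split; [split|]]; rewrite /ball/=.
- rewrite distrC (_ : _ - _ = (1 - e) * (z' 0%N - y 0%N)); last by ring.
  rewrite normrM ger0_norm; last by lra.
  apply: le_lt_trans (r'7 _ (nr 0%N isT)); rewrite ler_piMl//; lra.
- by rewrite opprD addrACA subrr addr0 distrC; exact: r'7 (nr 1%N isT).
- by rewrite opprD addrACA subrr addr0 distrC; exact: r'7 (nr 2%N isT).
- by rewrite opprD addrACA subrr addr0 distrC; exact: r'7 (nr 3%N isT).
- by rewrite distrC; apply: le_lt_trans ww; exact: (le_enorm1 ((shrink e z').2 - (shrink e y).2)).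
- by rewrite distrC; apply: le_lt_trans ww; exact: (le_enorm2 ((shrink e z').2 - (shrink e y).2)).
- by rewrite distrC; apply: le_lt_trans ww; exact: (le_enorm3 ((shrink e z').2 - (shrink e y).2)).
Qed.

(** The value is cut to 0 where [shrink] leaves the cylinder, because a Bernstein polynomial
    evaluates it on the whole box. The factor [1 - e] is the chain rule in time. *)
Let shrunk (e : R) : @jet R := fun j y =>
  match j with
  | 0 => if `[< cyl (shrink e y) >] then psi_data 0 (shrink e y) else 0
  | 1 => (1 - e) * psi_data 1 (shrink e y)
  | _ => psi_data j (shrink e y)
  end.

Let shrunk_psi_data e j y : cyl (shrink e y) ->
  shrunk e j y = (if j == 1%N then 1 - e else 1) * psi_data j (shrink e y).
Proof. by move=> Cy; case: j => [|[|j]] /=; rewrite ?mul1r// asboolT. Qed.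

Let time_derive t x w : 0 < t < T -> closure X x -> sphere w ->
  is_derive t 1 (fun s => psi s x w) (psi_t t x w).
Proof.
have [_ _ _ dt _] := psi_C1; move=> /[dup] tT /andP[t0 tT'] clx w1.
by apply: is_derive_within tT _; apply: dt; split => //=; rewrite !ltW.
Qed.

Let is_derive_translate (g : R -> R) (a l b : R) : is_derive (a + b) 1 g l ->
  is_derive a 1 (fun s => g (s + b)) l.
Proof.
move=> gl; have tr : is_derive a 1 (fun s : R => s + b) 1.
  by apply: is_derive_eq; rewrite addr0.
have := @is_derive1_comp _ g (fun s => s + b) a l 1 gl tr.
by rewrite mulr1.
Qed.

Let shrunk_derive e : 0 < e < e0 -> e <= 1 / 2 -> exists2 del : R, 0 < del &
  forall y (z : nat -> R) j, K y -> (forall i, (i < 7)%N -> `|z i - y i| < del) ->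
    (j < 4)%N -> is_derive (z j) 1 (fun s => shrunk e 0%N (upd z j s)) (shrunk e j.+1 z).
Proof.
move=> e0e e2; have [del del0 H] := shrink_near e0e e2.
have [_ _ _ _ dx] := psi_C1.
exists del => // y z j Ky yz j4.
have [t'T Xz cz _] := H y z Ky yz.
have j7 : (j < 7)%N by apply: ltn_trans j4 _.
(* Points near [z] are still mapped into the cylinder, so the cut-off is inactive for the
   derivative. *)
suff H1 : is_derive (z j) 1 (fun s => psi_data 0 (shrink e (upd z j s))) (shrunk e j.+1 z).
  have zj : `|z j - y j| < del by exact: yz.
  apply: (near_eq_is_derive _ H1); near=> s.
  have nears i : (i < 7)%N -> `|upd z j s i - y i| < del.
    move=> i7; rewrite /upd; case: eqP => [->|_]; last exact: yz.
    near: s; apply/nbhs_ballP; exists (del - `|z j - y j|) => /=.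
      by rewrite subr_gt0.
    move=> s; rewrite /ball/= => zs.
    rewrite -(subrK (z j) s) -addrA; apply: le_lt_trans (ler_normD _ _) _.
    by rewrite distrC -ltrBrDr.
  have [_ _ cs _] := H y _ Ky nears.
  by rewrite /= asboolT.
have [_ _ w1] := cz; have tT : 0 <= (shrink e z).1.1 <= T.
  by case/andP: t'T => ? ?; rewrite !ltW.
have [d1 d2 d3] := dx (shrink e z).1.1 (shrink e z).1.2 (shrink e z).2 tT Xz w1.
case: j {j7} j4 => [|[|[|[|//]]]] _.
- have dt := time_derive t'T (subset_closure Xz) w1.
  have tau : is_derive (z 0%N) 1 (fun s => T / 2 + (1 - e) * (s - T / 2)) (1 - e).
    by apply: is_derive_eq; rewrite /GRing.scale/=; ring.
  have := @is_derive1_comp _ (fun s => psi s (shrink e z).1.2 (shrink e z).2)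
    (fun s => T / 2 + (1 - e) * (s - T / 2)) (z 0%N) _ _ dt tau.
  by rewrite [X in is_derive _ _ _ X -> _]mulrC.
- by move/is_derive_e1 : d1 => /= /is_derive_translate.
- by move/is_derive_e2 : d2 => /= /is_derive_translate.
- by move/is_derive_e3 : d3 => /= /is_derive_translate.
Unshelve. all: by end_near. Qed.

Lemma psi_jet_local_approximable : approximable 4 K (jpoly 7) psi_jet.
Proof.
apply: approximable_lim => eps eps0.
have eps20 : 0 < eps / 2 by rewrite divr_gt0.
have [r1 r10 H1] := psi_data_unif eps20.
have [C C0 HC] := psi_data_bound.
have C1 : 0 < C + 1 by rewrite ltr_wpDl.
have c1 : 0 < enorm c + T + 1 by rewrite ltr_wpDl// addr_ge0 ?enorm_ge0// ltW.
(* The first two bounds make the shift admissible. The third absorbs the factor [1 - e] of the time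
   derivative, and the fourth brings the shrunken point within the modulus of continuity [r1] of the
   original one. *)
pose e := Num.min (Num.min (e0 / 2) (1 / 2))
  (Num.min (eps / (2 * (C + 1))) (r1 / (2 * (enorm c + T + 1)))).
have e_gt0 : 0 < e by rewrite !lt_min !divr_gt0 ?mulr_gt0.
have ee0 : e <= e0 / 2 by rewrite !ge_min lexx.
have e2 : e <= 1 / 2 by rewrite !ge_min lexx orbT.
have eC : e * C <= eps / 2.
  have : e <= eps / (2 * (C + 1)) by rewrite !ge_min lexx !orbT.
  rewrite ler_pdivlMr ?mulr_gt0// => H; nra.
have er1 : e * (enorm c + T) < r1.
  have : e <= r1 / (2 * (enorm c + T + 1)) by rewrite !ge_min lexx !orbT.
  rewrite ler_pdivlMr ?mulr_gt0// => H.
  have := enorm_ge0 c; nra.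
have e0e : 0 < e < e0 by rewrite e_gt0/=; apply: le_lt_trans ee0 _; rewrite ltr_pdivrMr// ltr_pMr// ltr1n.
have [M M0 KM] := cyl_pts_box.
have [del del0 Hn] := shrink_near e0e e2.
have self y : K y -> forall i, (i < 7)%N -> `|y i - y i| < del.
  by move=> _ i _; rewrite subrr normr0.
have cy y : K y -> cyl (shrink e y).
  by move=> Ky; have [] := Hn y y Ky (self y Ky).
have factor j : 0 <= (if j == 1%N then 1 - e else 1) <= 1.
  by case: (j == 1%N); rewrite ?ler01 ?lexx//; apply/andP; split; lra.
have factorB j u v : `|(if j == 1%N then 1 - e else 1) * u - (if j == 1%N then 1 - e else 1) * v| <= `|u - v|.
  have /andP[f0 f1] := factor j.
  by rewrite -mulrBr normrM ger0_norm// ler_piMl.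
exists (shrunk e); last first.
  move=> y j Ky j4; rewrite shrunk_psi_data; last exact: cy.
  have [[tT clx w1] _] := Ky.
  rewrite (_ : _ - _ = (psi_data j (shrink e y) - psi_data j (pt y)) -
    (1 - (if j == 1%N then 1 - e else 1)) * psi_data j (shrink e y)); last by rewrite /psi_jet; ring.
  apply: le_trans (ler_normB _ _) _; rewrite [leRHS]splitr; apply: lerD.
    apply: H1 => //; first exact: cy.
    have small (u : R) : `|u| <= enorm c + T -> `|e * u| < r1.
      by move=> uc; rewrite normrM gtr0_norm//; apply: le_lt_trans er1; rewrite ler_pM2l.
    have ec (u : R) : `|u| <= enorm c -> `|e * u| < r1.
      by move=> uc; apply: small; apply: le_trans uc _; rewrite lerDl ltW.
    have ball0 (u : R) : `|u - u| < r1 by rewrite subrr normr0.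
    have yw : (shrink e y).2 = ptw y by rewrite /shrink/= w1 invr1 scale1r.
    split; last by rewrite yw; split; [split|]; rewrite /ball/=; exact: ball0.
    split; [|split; [split|]]; rewrite /ball/=.
    - rewrite (_ : _ - _ = e * (y 0%N - T / 2)); last by ring.
      case/andP: tT => /= t0 tT; apply: small; rewrite ler_norml.
      have := enorm_ge0 c; move=> c0; apply/andP; split; lra.
    - by rewrite opprD addrA subrr add0r normrN; exact: ec (le_enorm1 c).
    - by rewrite opprD addrA subrr add0r normrN; exact: ec (le_enorm2 c).
    - by rewrite opprD addrA subrr add0r normrN; exact: ec (le_enorm3 c).
  rewrite normrM; case: (j == 1%N); last by rewrite subrr normr0 mul0r ltW.
  rewrite opprB addrC subrK gtr0_norm//; apply: le_trans eC.
  by rewrite ler_pM2l// HC//; exact: cy.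
apply: (@bernstein_density _ 7 4 M C) => //.
- by move=> y [/KM].
- move=> y yM /=; case: asboolP => [Cy|_]; last by rewrite normr0.
  exact: HC 0%N isT _ Cy.
- move=> y j Ky j4; rewrite shrunk_psi_data; last exact: cy.
  have /andP[f0 f1] := factor j.
  by rewrite normrM ger0_norm//; apply: le_trans (HC _ j4 _ (cy _ Ky)); rewrite ler_piMl.
- move=> e' e'0; have [r2 r20 H2] := psi_data_unif e'0.
  exists (Num.min del (r2 / 7)); first by rewrite lt_min del0 divr_gt0.
  move=> y z j Ky near j4.
  have neardel i : (i < 7)%N -> `|z i - y i| < del.
    by move=> /near /lt_le_trans; apply; rewrite ge_min lexx.
  have [_ _ cz bz] := Hn y z Ky neardel.
  rewrite !shrunk_psi_data//; last exact: cy.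
  apply: le_trans (factorB _ _ _) _; apply: H2 => //; first exact: cy.
  have := bz (Num.min del (r2 / 7)); rewrite ge_min lexx => /(_ isT near).
  apply: le_ball; rewrite mulrC -ler_pdivlMr// ge_min lexx orbT//.
- exact: shrunk_derive e0e e2.
Qed.

End local.

(** The polynomial 2 minus the square of [enorm (ptx y - p) / r]: at least 1 on the ball of radius
    [r], and positive only inside the ball of radius [2 * r], as gluing requires. *)
Let bump (p : R3 R) (r : R) : @jet R :=
  let sq i (a : R) := let L := jadd (jmulX i (jcst 1)) (jcst (- a)) in jmul L L in
  jadd (jcst 2) (jscale (- (r ^+ 2)^-1) (jadd (jadd (sq 1%N p.1.1) (sq 2%N p.1.2)) (sq 3%N p.2))).

Let jpoly_bump p r : jpoly 7 (bump p r).
Proof.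
have sqP i (a : R) : (i < 7)%N -> jpoly 7 (jmul (jadd (jmulX i (jcst 1)) (jcst (- a)))
    (jadd (jmulX i (jcst 1)) (jcst (- a)))).
  move=> i7; have L : jpoly 7 (jadd (jmulX i (jcst 1)) (jcst (- a))).
    by apply: jpoly_add; [apply: jpoly_mulX i7 _|]; exact: jpoly_cst.
  exact: jpoly_mul.
apply: jpoly_add; first exact: jpoly_cst.
by apply: jpoly_scale; apply: jpoly_add; [apply: jpoly_add|]; exact: sqP.
Qed.

Let bumpE p r y : bump p r 0%N y = 2 - (enorm (ptx y - p) / r) ^+ 2.
Proof.
by rewrite expr_div_n sqr_enorm /dot/= /bump/jadd/jscale/jmul/=; ring.
Qed.

Let good (p : R3 R) (r : R) := 0 < r /\
  approximable 4 (cyl_pts `&` [set y | enorm (ptx y - p) < r]) (jpoly 7) psi_jet.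

Let approximable_sub (K K' : set (nat -> R)) : K' `<=` K ->
  approximable 4 K (jpoly 7) psi_jet -> approximable 4 K' (jpoly 7) psi_jet.
Proof. by move=> K'K aK e /aK[G pG GK]; exists G => // y j /K'K; exact: GK. Qed.

Lemma psi_jet_approximable : approximable 4 cyl_pts (jpoly 7) psi_jet.
Proof.
have [M M0 KM] := cyl_pts_box.
have [rho rhoP] : {rho : R3 R -> R & forall p, closure X p -> good p (rho p)}.
  apply: (@choice _ _ (fun p r => closure X p -> good p r)) => p.
  have [clp|] := pselect (closure X p); last by exists 0.
  have [c [r [e0 [r0 e00 sh]]]] := local_shift oX lX clp.
  by exists r => _; split=> //; exact: psi_jet_local_approximable e00 sh.
(* This ball is for the maximum norm. Its points are within [3 * (rho p / 6) = rho p / 2] in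
   Euclidean norm, where the bump of radius [rho p / 2] is at least 1. *)
pose B p := ball p (rho p / 6).
have [p clp|s sX XB] := @compact_finite_subcover _ (closure X) B (closure_compact bX).
  by apply: nbhsx_ballx; rewrite divr_gt0//; have [] := rhoP _ clp.
have cover (s' : seq (R3 R)) : (forall p, p \in s' -> closure X p) ->
    approximable 4 (cyl_pts `&` [set y | exists2 p, p \in s' & B p (ptx y)]) (jpoly 7) psi_jet.
  elim: s' => [|p s' ih] s'X.
    by move=> e e0; exists (jcst 0); [exact: jpoly_cst|move=> y j [_ []]].
  have [r0 ap] := rhoP p (s'X p (mem_head _ _)).
  have r20 : 0 < rho p / 2 by rewrite divr_gt0.
  have := @approximable_glue _ 7 4 M cyl_pts psi_jet isT M0 KM _ _
    (jpoly_bump p (rho p / 2)) _ (ih _).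
  move=> /(_ _ _)/(approximable_sub _); apply.
  - move=> y [Ky [q]]; rewrite inE => /predU1P[->{q} Bp|qs Bq]; split=> //; last first.
      by right; exists q.
    left; rewrite /= bumpE; have [[b1 b2] b3] := Bp.
    have : enorm (ptx y - p) <= 3 * (rho p / 6).
      by apply: enorm_le_coord; rewrite distrC; apply: ltW.
    move=> b4; have : enorm (ptx y - p) / (rho p / 2) <= 1.
      by rewrite ler_pdivrMr// mul1r; lra.
    have : 0 <= enorm (ptx y - p) / (rho p / 2) by rewrite divr_ge0 ?enorm_ge0 ?ltW.
    by move: (_ / _) => t t0 t1; nra.
  - apply: approximable_sub ap => y [Ky]; rewrite /= bumpE => b; split=> //=.
    rewrite ltNge; apply/negP => r1.
    have : 2 <= enorm (ptx y - p) / (rho p / 2).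
      by rewrite ler_pdivlMr//; lra.
    by move: b; move: (_ / _) => t b t2; nra.
  - by move=> q qs; apply: s'X; rewrite inE qs orbT.
apply: approximable_sub (cover s sX) => y Ky; split=> //=.
by have [_ clx _] := Ky; exact: XB.
Qed.

End solution_approximation.

(** * Finiteness of the surface measures *)

Section hausdorff_finite.
Context {R : realType}.
Implicit Types (A B : set (R3 R)) (x y p : R3 R).

Lemma cell (r v : R) N : 0 < r -> `|v| <= r -> exists2 i, (i <= N)%N &
  - r + i%:R * (2 * r / N.+1%:R) <= v <= - r + i.+1%:R * (2 * r / N.+1%:R).
Proof.
move=> r0; rewrite ler_norml => /andP[rv vr].
have N0 : 0 < N.+1%:R :> R by rewrite ltr0n.
have h0 : 0 < 2 * r / N.+1%:R by rewrite divr_gt0// mulr_gt0.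
suff H n : v <= - r + n.+1%:R * (2 * r / N.+1%:R) -> exists2 i, (i <= n)%N &
  - r + i%:R * (2 * r / N.+1%:R) <= v <= - r + i.+1%:R * (2 * r / N.+1%:R).
  by apply: H; rewrite mulrC divfK ?gt_eqF//; lra.
elim: n => [|n ih] vn; first by exists 0%N => //; rewrite vn mul0r addr0 rv.
have [/ih[i ni iv]|nv] := leP v (- r + n.+1%:R * (2 * r / N.+1%:R)).
  by exists i => //; exact: leqW.
by exists n.+1 => //; rewrite vn ltW.
Qed.

(** [A] is the image of a part of a square under a [k]-Lipschitz map, the inverse of [(u1, u2)].
    Cutting the square into [N.+1 * N.+1] cells covers [A] by pieces of diameter at most [k * h],
    whose total area bound does not depend on N. *)
Lemma hausdorff2_le A (u1 u2 : R3 R -> R) (r k : R) : 0 < r -> 0 < k ->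
  (forall x, A x -> `|u1 x| <= r /\ `|u2 x| <= r) ->
  (forall x y e, A x -> A y -> `|u1 x - u1 y| <= e -> `|u2 x - u2 y| <= e ->
    enorm (x - y) <= k * e) ->
  (hausdorff2 A < +oo)%E.
Proof.
move=> r0 k0 Ar Ak.
apply: (@le_lt_trans _ _ (pi / 4 * (2 * r * k) ^+ 2)%:E); last exact: ltry.
apply: ge_ereal_sup => _ [d /= d0 <-].
pose N := Num.bound (2 * r * k / d); pose h := 2 * r / N.+1%:R.
have N0 : 0 < N.+1%:R :> R by rewrite ltr0n.
have h0 : 0 < h by rewrite divr_gt0// mulr_gt0.
have khd : k * h <= d.
  rewrite /h mulrA ler_pdivrMr// [leRHS]mulrC -ler_pdivrMr//.
  rewrite (mulrC k); apply: ltW; apply: lt_le_trans (archi_boundP _) _.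
    by rewrite divr_ge0 ?mulr_ge0 ?ltW.
  by rewrite ler_nat.
pose side i v := - r + i%:R * h <= v <= - r + i.+1%:R * h.
pose U n := if (n < N.+1 * N.+1)%N then
  [set x | [/\ A x, side (n %/ N.+1)%N (u1 x) & side (n %% N.+1)%N (u2 x)]] else set0.
have side_dist i v w : side i v -> side i w -> `|v - w| <= h.
  rewrite /side -natr1 mulrDl mul1r => /andP[v1 v2] /andP[w1 w2].
  by rewrite ler_norml; apply/andP; split; lra.
have dU n : (diam (U n) <= (k * h)%:E)%E.
  apply: ge_ereal_sup => z [->|]; first by rewrite lee_fin mulr_ge0 ?ltW.
  move=> [x Ux [y Uy <-]]; rewrite lee_fin; move: Ux Uy; rewrite /U.
  case: ifP => // _ [Ax x1 x2] [Ay y1 y2].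
  by apply: Ak => //; apply: side_dist; eassumption.
have UA : A `<=` \bigcup_i U i.
  move=> x Ax; have [r1 r2] := Ar _ Ax.
  have [i iN i1] := cell N r0 r1; have [j jN j2] := cell N r0 r2.
  exists (i * N.+1 + j)%N => //; rewrite /U ifT; last first.
    apply: (@leq_trans (i.+1 * N.+1)%N); last by rewrite leq_mul2r ltnS iN orbT.
    by rewrite mulSn (addnC _ j) ltn_add2r ltnS.
  by split; rewrite // ?divnMDl// ?divn_small ?addn0// modnMDl modn_small.
apply: (@le_trans _ _ (\sum_(i <oo) disk_area (U i))%E).
  by apply: ereal_inf_lbound; exists U => //; split=> // i; rewrite (le_trans (dU i))// lee_fin.
have area n : (disk_area (U n) <= (pi / 4 * (k * h) ^+ 2)%:E)%E.
  rewrite /disk_area [leRHS]EFinM; apply: lee_wpmul2l; first by rewrite lee_fin divr_ge0 ?pi_ge0.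
  by rewrite expe2 expr2 EFinM; apply: lee_pmul; rewrite ?diam_ge0.
apply: lime_le; first by apply: is_cvg_nneseries => i _ _; exact: disk_area_ge0.
near=> m.
have main j : (\sum_(0 <= i < j) disk_area (U i) <=
    ((minn j (N.+1 * N.+1))%:R * (pi / 4 * (k * h) ^+ 2))%:E)%E.
  elim: j => [|j ih]; first by rewrite big_geq// min0n mul0r.
  rewrite big_nat_recr//=; have [jN|jN] := ltnP j (N.+1 * N.+1)%N.
    rewrite (minn_idPl jN) -natr1 mulrDl mul1r EFinD leeD ?area//.
    by rewrite (minn_idPl (ltnW jN)) in ih.
  rewrite /U ltnNge jN/= disk_area0 adde0 (minn_idPr _); last exact: leqW.
  by rewrite (minn_idPr jN) in ih.
apply: le_trans (main m) _; rewrite lee_fin.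
apply: (@le_trans _ _ ((N.+1 * N.+1)%:R * (pi / 4 * (k * h) ^+ 2))).
  apply: ler_wpM2r; last by rewrite ler_nat geq_minr.
  by apply: mulr_ge0; [rewrite divr_ge0 ?pi_ge0|exact: sqr_ge0].
rewrite le_eqVlt; apply/orP; left; apply/eqP; rewrite /h natrM; field.
by rewrite gt_eqF.
Unshelve. all: by end_near. Qed.

Lemma hausdorff2U_lty A B : (hausdorff2 A < +oo)%E -> (hausdorff2 B < +oo)%E ->
  (hausdorff2 (A `|` B) < +oo)%E.
Proof.
move=> Ao Bo; apply: le_lt_trans (outer_measureU2 _ _ _) _.
by rewrite lte_add_pinfty.
Qed.

Lemma hausdorff2_subset A B : A `<=` B -> (hausdorff2 B < +oo)%E -> (hausdorff2 A < +oo)%E.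
Proof. by move=> AB; apply: le_lt_trans; exact: le_outer_measure. Qed.

(** On the cap the sphere is a Lipschitz graph over the other two coordinates: differences of
    [c ^+ 2] are at most [4 * e], and [c x + c y] is at least 1. The squared distance is then at
    most [18 * e ^+ 2], below [(6 * e) ^+ 2]. *)
Let sphere_cap (c u1 u2 : R3 R -> R) :
  (forall x, dot x x = c x ^+ 2 + u1 x ^+ 2 + u2 x ^+ 2) ->
  (forall x y, c (x - y) = c x - c y) ->
  (forall x y, u1 (x - y) = u1 x - u1 y) ->
  (forall x y, u2 (x - y) = u2 x - u2 y) ->
  (hausdorff2 [set x | sphere x /\ (1 / 2 <= c x)%R] < +oo)%E.
Proof.
move=> dotE cB u1B u2B.
have sphereE x : sphere x -> c x ^+ 2 + u1 x ^+ 2 + u2 x ^+ 2 = 1.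
  by rewrite -dotE -sqr_enorm => ->; rewrite expr1n.
have u1le x : sphere x -> `|u1 x| <= 1.
  move=> /sphereE E; rewrite -(@ler_pXn2r _ 2)// ?nnegrE// real_normK ?num_real// expr1n.
  by have := sqr_ge0 (c x); have := sqr_ge0 (u2 x); lra.
have u2le x : sphere x -> `|u2 x| <= 1.
  move=> /sphereE E; rewrite -(@ler_pXn2r _ 2)// ?nnegrE// real_normK ?num_real// expr1n.
  by have := sqr_ge0 (c x); have := sqr_ge0 (u1 x); lra.
apply: (@hausdorff2_le _ u1 u2 1 6) => //.
  by move=> x [sx _]; split; [exact: u1le|exact: u2le].
move=> x y e [sx cx] [sy cy_] h1 h2.
have e0 : 0 <= e := le_trans (normr_ge0 _) h1.
have sq (t : R) : `|t| <= e -> t ^+ 2 <= e ^+ 2.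
  by move=> te; rewrite -real_normK ?num_real// ler_pXn2r ?nnegrE.
have prod u : (forall x, sphere x -> `|u x| <= 1) -> `|u x - u y| <= e ->
    `|u x ^+ 2 - u y ^+ 2| <= 2 * e.
  move=> ule uxy; rewrite subr_sqr normrM mulrC ler_pM//.
  by apply: le_trans (ler_normD _ _) _; rewrite mulr2n lerD// ule.
have ch : `|c x - c y| <= 4 * e.
  have cc : `|(c x - c y) * (c x + c y)| <= 4 * e.
    rewrite -subr_sqr (_ : _ - _ = - ((u1 x ^+ 2 - u1 y ^+ 2) + (u2 x ^+ 2 - u2 y ^+ 2))).
      rewrite normrN; apply: le_trans (ler_normD _ _) _.
      by have := prod _ u1le h1; have := prod _ u2le h2; lra.
    by have := sphereE _ sx; have := sphereE _ sy; lra.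
  apply: le_trans cc; rewrite normrM ler_peMr// ger0_norm; lra.
rewrite -(@ler_pXn2r _ 2)// ?nnegrE ?mulr_ge0 ?enorm_ge0//.
rewrite sqr_enorm dotE cB u1B u2B.
have : (c x - c y) ^+ 2 <= (4 * e) ^+ 2.
  by rewrite -real_normK ?num_real// ler_pXn2r ?nnegrE ?mulr_ge0.
have := sq _ h1; have := sq _ h2; have := sqr_ge0 e; nra.
Qed.

(** Six caps cover the sphere: outside all of them the squared norm would be less than 3/4. *)
Lemma hausdorff2_sphere : (hausdorff2 (@sphere R) < +oo)%E.
Proof.
pose x1 (x : R3 R) : R := x.1.1; pose x2 (x : R3 R) : R := x.1.2; pose x3 (x : R3 R) : R := x.2.
pose n (f : R3 R -> R) x := - f x.
pose cap (c : R3 R -> R) := [set x | sphere x /\ 1 / 2 <= c x].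
apply: (@hausdorff2_subset _ (cap x1 `|` cap x2 `|` cap x3 `|`
    (cap (n x1) `|` cap (n x2) `|` cap (n x3)))).
  move=> x sx; apply: contrapT => H.
  have capN (c : R3 R -> R) : ~ cap c x -> ~ cap (n c) x -> c x ^+ 2 < 1 / 4.
    move=> h1 h2; have c1 : c x < 1 / 2 by rewrite ltNge; apply/negP => h; apply: h1.
    have c2 : - c x < 1 / 2 by rewrite ltNge; apply/negP => h; apply: h2.
    nra.
  have : enorm x ^+ 2 = 1 by rewrite sx expr1n.
  rewrite sqr_enorm /dot.
  have := capN x1 (fun h => H (or_introl (or_introl (or_introl h))))
    (fun h => H (or_intror (or_introl (or_introl h)))).
  have := capN x2 (fun h => H (or_introl (or_introl (or_intror h))))
    (fun h => H (or_intror (or_introl (or_intror h)))).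
  have := capN x3 (fun h => H (or_introl (or_intror h)))
    (fun h => H (or_intror (or_intror h))).
  rewrite /x1 /x2 /x3; lra.
do !apply: hausdorff2U_lty.
- by apply: (@sphere_cap x1 x2 x3) => [x|x y|x y|x y]; rewrite /x1 /x2 /x3 /dot//; ring.
- by apply: (@sphere_cap x2 x1 x3) => [x|x y|x y|x y]; rewrite /x1 /x2 /x3 /dot//; ring.
- by apply: (@sphere_cap x3 x1 x2) => [x|x y|x y|x y]; rewrite /x1 /x2 /x3 /dot//; ring.
- by apply: (@sphere_cap (n x1) x2 x3) => [x|x y|x y|x y]; rewrite /n /x1 /x2 /x3 /dot/=//; ring.
- by apply: (@sphere_cap (n x2) x1 x3) => [x|x y|x y|x y]; rewrite /n /x1 /x2 /x3 /dot/=//; ring.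
- by apply: (@sphere_cap (n x3) x1 x2) => [x|x y|x y|x y]; rewrite /n /x1 /x2 /x3 /dot/=//; ring.
Qed.

(** Parseval's identity. The remainder [w] of the expansion of [z] is orthogonal to all three
    vectors, and Cramer's rule with the nonzero determinant [D] annihilates it. *)
Lemma orthonormal_dot (a b c z : R3 R) :
  [/\ enorm a = 1, enorm b = 1 & enorm c = 1] ->
  [/\ dot a b = 0, dot a c = 0 & dot b c = 0] ->
  dot z z = dot z a ^+ 2 + dot z b ^+ 2 + dot z c ^+ 2.
Proof.
move=> [a1 b1 c1] [ab ac bc].
have aa : dot a a = 1 by rewrite -sqr_enorm a1 expr1n.
have bb : dot b b = 1 by rewrite -sqr_enorm b1 expr1n.
have cc : dot c c = 1 by rewrite -sqr_enorm c1 expr1n.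
pose D := a.1.1 * (b.1.2 * c.2 - b.2 * c.1.2) - a.1.2 * (b.1.1 * c.2 - b.2 * c.1.1) +
  a.2 * (b.1.1 * c.1.2 - b.1.2 * c.1.1).
(* [D ^+ 2] is the Gram determinant of [a], [b] and [c] *)
have D2 : D ^+ 2 = 1.
  rewrite (_ : D ^+ 2 = dot a a * dot b b * dot c c + 2 * dot a b * dot a c * dot b c -
    dot a a * dot b c ^+ 2 - dot b b * dot a c ^+ 2 - dot c c * dot a b ^+ 2).
    by rewrite aa bb cc ab ac bc; ring.
  by rewrite /D /dot; ring.
have D0 : D != 0 by apply/eqP => D0; move: D2; rewrite D0 expr0n/= => /eqP; rewrite eq_sym oner_eq0.
pose w : R3 R := z - (dot z a *: a + dot z b *: b + dot z c *: c).
have wa : dot w a = 0.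
  by rewrite /w dotBl !dotDl !dotZl aa (dotC b a) ab (dotC c a) ac; ring.
have wb : dot w b = 0.
  by rewrite /w dotBl !dotDl !dotZl bb ab (dotC c b) bc; ring.
have wc : dot w c = 0.
  by rewrite /w dotBl !dotDl !dotZl cc ac bc; ring.
have w1 : w.1.1 = 0.
  apply: (mulfI D0); rewrite mulr0.
  rewrite (_ : D * _ = dot w a * (b.1.2 * c.2 - b.2 * c.1.2) + dot w b * (c.1.2 * a.2 - c.2 * a.1.2)
    + dot w c * (a.1.2 * b.2 - a.2 * b.1.2)); first by rewrite wa wb wc; ring.
  by rewrite /D /dot; ring.
have w2 : w.1.2 = 0.
  apply: (mulfI D0); rewrite mulr0.
  rewrite (_ : D * _ = dot w a * (b.2 * c.1.1 - b.1.1 * c.2) + dot w b * (c.2 * a.1.1 - c.1.1 * a.2)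
    + dot w c * (a.2 * b.1.1 - a.1.1 * b.2)); first by rewrite wa wb wc; ring.
  by rewrite /D /dot; ring.
have w3 : w.2 = 0.
  apply: (mulfI D0); rewrite mulr0.
  rewrite (_ : D * _ = dot w a * (b.1.1 * c.1.2 - b.1.2 * c.1.1) + dot w b * (c.1.1 * a.1.2 - c.1.2 * a.1.1)
    + dot w c * (a.1.1 * b.1.2 - a.1.2 * b.1.1)); first by rewrite wa wb wc; ring.
  by rewrite /D /dot; ring.
have zw : dot w z = 0 by rewrite /dot w1 w2 w3; ring.
move: zw; rewrite /w dotBl !dotDl !dotZl (dotC a) (dotC b) (dotC c); lra.
Qed.

(** In a chart, a boundary point lies on the graph: not being in the open set [X] gives one
    inequality, being a limit of points of [X] the other. The chart coordinates then satisfy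
    [hausdorff2_le], since [2 + k ^+ 2] is at most [(k + 2) ^+ 2]. *)
Lemma boundary_graph (X : set (R3 R)) p : open X -> lipschitz_boundary X ->
  boundary X p -> exists2 r : R, 0 < r &
    (hausdorff2 (boundary X `&` [set x : R3 R | (enorm (x - p) < r)%R]) < +oo)%E.
Proof.
move=> oX lX bp.
have [a [b [c [zeta [r [abc1 abc0 /lipschitz_bound[k k0 zk] r0 Xr]]]]]] := lX _ bp.
exists r => //; have [a1 b1 c1] := abc1.
have unit_le (u v : R3 R) : enorm v = 1 -> `|dot u v| <= enorm u.
  by move=> v1; apply: le_trans (dot_enorm _ _) _; rewrite v1 mulr1.
have zetaE x : boundary X x -> enorm (x - p) < r ->
    dot (x - p) c = zeta (dot (x - p) a, dot (x - p) b).
  move=> [clx nXx] xp.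
  have {}nXx : ~ X x by move=> Xx; apply: nXx; apply: open_nbhs_nbhs.
  apply/eqP; rewrite eq_le; apply/andP; split.
    by rewrite leNgt; apply/negP => h; apply: nXx; apply/(Xr _ xp).
  apply/ler_addgt0Pr => e e0.
  have s0 : 0 < r - enorm (x - p) by rewrite subr_gt0.
  have k1 : 0 < k + 1 by rewrite ltr_wpDl.
  have m0 : 0 < Num.min (r - enorm (x - p)) (e / (k + 1)) by rewrite lt_min s0 divr_gt0.
  have [x' Xx' x'x] := closure_enorm clx m0.
  move: x'x; rewrite lt_min ltr_pdivlMr// => /andP[x'r x'e].
  have x'p : enorm (x' - p) < r.
    by apply: le_lt_trans (enorm_dist_triangle x _ _) _; rewrite -ltrBrDr.
  have h1 := (Xr _ x'p).1 Xx'.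
  have h2 := zk (dot (x - p) a, dot (x - p) b) (dot (x' - p) a, dot (x' - p) b).
  have h3 : `|(dot (x - p) a, dot (x - p) b) - (dot (x' - p) a, dot (x' - p) b) : R * R| <= enorm (x' - x).
    rewrite prod_normE/= ge_max -!dotBl opprB addrA subrK enorm_distC.
    by rewrite !unit_le.
  have h4 : `|dot (x' - x) c| <= enorm (x' - x) by exact: unit_le.
  move: h4; rewrite ler_norml => /andP[_ h4].
  have h5 := ler_wpM2l k0 h3.
  have h6 := le_trans (ler_norm _) h2.
  have h7 : dot (x' - x) c = dot (x' - p) c - dot (x - p) c by rewrite !dotBl; ring.
  move: h1 h4 h5 h6 x'e; rewrite h7; lra.
apply: (@hausdorff2_le _ (fun x => dot (x - p) a) (fun x => dot (x - p) b) r (k + 2)) => //.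
- by rewrite ltr_wpDl.
- by move=> x [_ xp]; split; apply: le_trans (unit_le _ _ _) (ltW _).
move=> x y e [bx xp] [by_ yp] h1 h2.
have e0 : 0 <= e := le_trans (normr_ge0 _) h1.
have h3 : `|dot (x - p) c - dot (y - p) c| <= k * e.
  rewrite !zetaE//; apply: le_trans (zk _ _) _; apply: ler_wpM2l => //.
  by rewrite prod_normE/= ge_max h1 h2.
have dB v : dot (x - y) v = dot (x - p) v - dot (y - p) v by rewrite !dotBl; ring.
rewrite -(@ler_pXn2r _ 2)// ?nnegrE ?mulr_ge0 ?addr_ge0 ?enorm_ge0//.
rewrite sqr_enorm (orthonormal_dot _ abc1 abc0) !dB.
have sq (t s : R) : 0 <= s -> `|t| <= s -> t ^+ 2 <= s ^+ 2.
  by move=> s0 ts; rewrite -real_normK ?num_real// ler_pXn2r ?nnegrE.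
have := sq _ _ e0 h1; have := sq _ _ e0 h2.
have := sq _ _ (mulr_ge0 k0 e0) h3.
have : 0 <= k * e ^+ 2 by rewrite mulr_ge0 ?sqr_ge0.
have := sqr_ge0 e; nra.
Qed.

Lemma hausdorff2_boundary (X : set (R3 R)) : open X -> bounded_set X -> lipschitz_boundary X ->
  (hausdorff2 (boundary X) < +oo)%E.
Proof.
move=> oX bX lX.
have cb : compact (boundary X).
  apply: subclosed_compact (closure_compact bX) _; last by move=> x [].
  by apply: closedI; [exact: closed_closure|apply: open_closedC; exact: open_interior].
have [r rP] : {r : R3 R -> R & forall p, boundary X p -> 0 < r p /\ (hausdorff2 (boundary X `&` [set x : R3 R | (enorm (x - p) < r p)%R]) < +oo)%E}.
  apply: (@choice _ _ (fun p (r : R) => boundary X p -> 0 < r /\ (hausdorff2 (boundary X `&` [set x : R3 R | (enorm (x - p) < r)%R]) < +oo)%E)) => p.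
  have [/(boundary_graph oX lX)[r r0 H]|] := pselect (boundary X p); last by exists 0.
  by exists r.
have [p bp|s sb bs] := @compact_finite_subcover _ _ (fun p => ball p (r p / 4)) cb.
  by apply: nbhsx_ballx; rewrite divr_gt0//; have [] := rP _ bp.
suff H (s' : seq (R3 R)) : {in s', forall p, boundary X p} ->
    (hausdorff2 [set x | boundary X x /\ exists2 p, p \in s' & ball p (r p / 4)%R x] < +oo)%E.
  by apply: hausdorff2_subset (H s sb) => x bx; split => //; exact: bs.
elim: s' => [|p s' ih] s'b.
  rewrite (_ : mkset _ = set0) ?outer_measure0//.
  by apply/seteqP; split => // x [_ []].
have [r0 Hp] := rP p (s'b p (mem_head _ _)).
have ihs : {in s', forall p, boundary X p} by move=> q qs; apply: s'b; rewrite inE qs orbT.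
apply: hausdorff2_subset (hausdorff2U_lty Hp (ih ihs)) => x [bx [q]].
rewrite inE => /predU1P[->|qs] qx; last by right; split => //; exists q.
left; split=> //=; have [[q1 q2] q3] := qx.
apply: le_lt_trans (_ : 3 * (r p / 4) < _); last by lra.
by apply: enorm_le_coord; rewrite distrC; apply: ltW.
Qed.

End hausdorff_finite.

(** * Measurability and finiteness for product measures *)

Section measurability.
Context {R : realType}.
Implicit Types (X : set (R3 R)).

(** The sigma-algebra of [R3 R] is a product one, so an open set has to be written as a countable
    union of boxes, here cubes with rational centre and half-side. *)
Lemma open_measurable_R3 X : open X -> measurable X.
Proof.
move=> oX.
pose box4 (q : rat * rat * rat * rat) : set (R3 R) :=
  let r : R := ratr q.2 in
  (`]ratr q.1.1.1 - r, ratr q.1.1.1 + r[ `*` `]ratr q.1.1.2 - r, ratr q.1.1.2 + r[)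
    `*` `]ratr q.1.2 - r, ratr q.1.2 + r[.
pose F q := if `[< box4 q `<=` X >] then box4 q else set0.
have -> : X = \bigcup_q F q.
  apply/seteqP; split=> [x Xx|x [q _]]; last first.
    by rewrite /F; case: asboolP => // qX /qX.
  have /nbhs_ballP[r /= r0 rX] := open_nbhs_nbhs (conj oX Xx).
  have [q4 /andP[q40 q4r]] : exists q : rat, 0 < (ratr q : R) < r / 2.
    have [|q] := @rat_in_itvoo R 0 (r / 2) _; first by rewrite divr_gt0.
    by rewrite in_itv/=; exists q.
  have near (v : R) : exists q : rat, v - ratr q4 < (ratr q : R) < v.
    have [|q] := @rat_in_itvoo R (v - ratr q4) v; first by rewrite ltrBlDr ltrDl.
    by rewrite in_itv/=; exists q.
  have [q1 /andP[h1 h1']] := near x.1.1; have [q2 /andP[h2 h2']] := near x.1.2.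
  have [q3 /andP[h3 h3']] := near x.2.
  exists (q1, q2, q3, q4) => //; rewrite /F asboolT; last first.
    move=> z [[/=]]; rewrite !in_itv/= => /andP[a1 b1] /andP[a2 b2] /andP[a3 b3].
    apply: rX; split; [split|]; rewrite /ball/= ltr_norml; apply/andP; split; lra.
  by split; [split|]; rewrite /= in_itv/=; apply/andP; split; lra.
apply: countable_bigcupT_measurable => [|q]; first exact: countableP.
rewrite /F; case: asboolP => // _.
by apply: measurableX; [apply: measurableX|]; exact: measurable_itv.
Qed.

Lemma closed_measurable_R3 X : closed X -> measurable X.
Proof.
by move=> /closed_openC/open_measurable_R3/measurableC; rewrite setCK.
Qed.

Lemma boundary_measurable X : measurable (boundary X).
Proof.
apply: measurableD; first by apply: closed_measurable_R3; exact: closed_closure.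
by apply: open_measurable_R3; exact: open_interior.
Qed.

End measurability.

Section sphere_measure_finite.
Context {R : realType}.

(** The resulting instance lets product measures with the sphere as second factor be evaluated on
    rectangles, and Fubini-Tonelli be applied to them. *)
Let sphere_measure_finite : fin_num_fun (@sphere_measure R).
Proof.
apply: lty_fin_num_fun.
by change (hausdorff2 (setT `&` @sphere R) < +oo)%E; rewrite setTI; exact: hausdorff2_sphere.
Qed.

HB.instance Definition _ := @Measure_isFinite.Build _ _ _
  (@sphere_measure R) sphere_measure_finite.

End sphere_measure_finite.

Section integral_bounds.
Local Open Scope ereal_scope.
Import HBNNSimple.

(* No measurability is needed: the integral of a nonnegative function is the
   supremum of the integrals of the simple functions below it. *)
Lemma ge0_subset_le_integral d (T : measurableType d) (R : realType)
    (mu : {measure set T -> \bar R}) (D E : set T) (f g : T -> \bar R) :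
  D `<=` E -> (forall x, D x -> 0 <= f x) -> (forall x, E x -> 0 <= g x) ->
  (forall x, D x -> f x <= g x) ->
  \int[mu]_(x in D) f x <= \int[mu]_(x in E) g x.
Proof.
move=> DE f0 g0 fg; rewrite ge0_integralE// [leRHS]ge0_integralE//.
apply: ge_ereal_sup => _ [h /= hf <-]; apply: ereal_sup_ubound.
exists h => // x /=; apply: le_trans (hf x) _; rewrite /patch.
case: ifPn => [|_]; first by rewrite inE => Dx; rewrite mem_set ?fg//; exact: DE.
by case: ifPn => // ; rewrite inE => /g0.
Qed.

End integral_bounds.

(** * Bounds on the loss functions *)

Section iterated_integral.
Local Open Scope ereal_scope.
Context {R : realType}.
Variable X : set (R3 R).
Hypothesis mX : measurable X.

Local Notation mu := (@lebesgue3 R \x @sphere_measure R).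
Local Notation XS := (X `*` @sphere R).

Let mXS : measurable XS.
Proof. by apply: measurableX => //; exact: measurable_sphere. Qed.

Lemma measure_XS : mu XS = lebesgue3 X * sphere_measure sphere.
Proof. by apply: product_measure1E => //; exact: measurable_sphere. Qed.

Lemma integral_XS_cst (c : R) : \int[mu]_(z in XS) c%:E = c%:E * mu XS.
Proof. exact: (integral_cst mu mXS). Qed.

(** Tonelli is applied to the measurable majorant [a + 2 * B ^+ 2], extended by 0, rather than to
    [u], about whose measurability nothing is known. The shape of the majorant is that of
    [(Z - B) ^+ 2] with [Z] bounded. *)
Lemma iterated_integral_le (u : R3 R -> R3 R -> R) (a : R) (B : R3 R * R3 R -> R) :
  (0 <= a)%R -> measurable_fun XS B ->
  (forall x w, X x -> sphere w -> (u x w ^+ 2 <= a + 2 * B (x, w) ^+ 2)%R) ->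
  \int[lebesgue3]_(x in X) \int[sphere_measure]_(w in sphere) (u x w ^+ 2)%:E <=
  a%:E * mu XS + 2%:E * \int[mu]_(z in XS) (B z ^+ 2)%:E.
Proof.
move=> a0 mB uB.
pose f z : \bar R := (a + 2 * B z ^+ 2)%:E.
have f0 z : 0 <= f z.
  by rewrite lee_fin; apply: addr_ge0 => //; apply: mulr_ge0 => //; exact: sqr_ge0.
have mB2 : measurable_fun XS (fun z => (B z ^+ 2)%:E).
  by apply/measurable_EFinP; exact: measurable_funX.
have mf : measurable_fun XS f.
  apply/measurable_EFinP; apply: measurable_funD => //; apply: measurable_funM => //.
  exact: measurable_funX.
have fXS0 z : 0 <= (f \_ XS) z by rewrite /patch; case: ifP.
apply: (@le_trans _ _ (\int[lebesgue3]_x \int[sphere_measure]_w (f \_ XS) (x, w))).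
  apply: ge0_subset_le_integral => // [x _|x _|x Xx].
  - by apply: integral_ge0 => w _; rewrite lee_fin sqr_ge0.
  - by apply: integral_ge0.
  apply: ge0_subset_le_integral => // [w _|w Sw]; first by rewrite lee_fin sqr_ge0.
  by rewrite /patch mem_set// lee_fin uB.
have := fubini_tonelli1 (m1 := lebesgue3) (m2 := sphere_measure) (f \_ XS)
  ((measurable_restrictT f mXS).1 mf) fXS0.
rewrite /fubini_F => <-.
rewrite -integral_mkcond /f.
under eq_integral do rewrite EFinD EFinM.
rewrite ge0_integralD//=; last 2 first.
- by move=> z _; rewrite -EFinM lee_fin mulr_ge0 ?sqr_ge0.
- exact: measurable_funeM.
by rewrite integral_XS_cst ge0_integralZl// => z _; rewrite lee_fin sqr_ge0.
Qed.

End iterated_integral.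

Section network_functions.
Context {R : realType}.
Implicit Types (act : nat -> R -> R) (x w : R3 R) (t : R).

Lemma measurable_nn_theta d (T : measurableType d) act (p : nn_params R)
    (Y : T -> seq R) k j :
  (forall i, measurable_fun setT (fun z => (Y z)`_i)) ->
  (forall l, (0 < l <= k)%N -> continuous (act l)) ->
  measurable_fun setT (fun z => nn_theta act p (Y z) k j).
Proof.
move=> mY; elim: k j => [|k ih] j actc /=.
  apply: measurable_funD => //; apply: measurable_sum => i.
  by apply: measurable_funM.
apply: measurable_funD => //; apply: measurable_sum => i.
apply: measurable_funM => //.
apply: (@measurableT_comp _ _ _ _ _ _ (act k.+1)).
  by apply: continuous_measurable_fun; apply: actc; rewrite leqnn.
by apply: ih => l /andP[l0 lk]; apply: actc; rewrite l0 leqW.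
Qed.

Definition nn_input t x w : seq R := [:: t; x.1.1; x.1.2; x.2; w.1.1; w.1.2; w.2].

Lemma measurable_psi_nn act L (p : nn_params R) t :
  (forall l, (0 < l < L)%N -> continuous (act l)) ->
  measurable_fun setT (fun z : R3 R * R3 R => psi_nn act L p t z.1 z.2).
Proof.
move=> actc.
apply: (@measurable_nn_theta _ _ act p (fun z => nn_input t z.1 z.2) L.-1 0%N); last first.
  move=> l /andP[l0 lL]; apply: actc; rewrite l0 (leq_ltn_trans lL)// ltn_predL.
  by apply: leq_trans (leq_trans l0 lL) (leq_pred L).
have m11 : measurable_fun setT (fun x : R3 R => x.1.1 : R).
  exact: (measurableT_comp measurable_fst measurable_fst).
have m12 : measurable_fun setT (fun x : R3 R => x.1.2 : R).
  exact: (measurableT_comp measurable_snd measurable_fst).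
have m2 : measurable_fun setT (fun x : R3 R => x.2 : R) by exact: measurable_snd.
case=> [|[|[|[|[|[|[|i]]]]]]] //=.
- exact: (measurableT_comp m11 measurable_fst).
- exact: (measurableT_comp m12 measurable_fst).
- exact: (measurableT_comp m2 measurable_fst).
- exact: (measurableT_comp m11 measurable_snd).
- exact: (measurableT_comp m12 measurable_snd).
- exact: (measurableT_comp m2 measurable_snd).
Qed.

Definition vec t x w : nat -> R := fun i => (nn_input t x w)`_i.

Lemma netjet_psi_nn act k (F : @jet R) : netjet act k F ->
  exists2 p, admissible_params k.+1 p & forall t x w,
    [/\ psi_nn act k.+1 p t x w = F 0%N (vec t x w),
        derive1 (fun s => psi_nn act k.+1 p s x w) t = F 1%N (vec t x w) &
        gradient (fun y => psi_nn act k.+1 p t y w) x =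
          (F 2 (vec t x w), F 3 (vec t x w), F 4 (vec t x w))].
Proof.
move=> [p [w0 wp wk FE Fd]]; exists p.
  by split=> // l /andP[l0 lk]; apply: wp; rewrite l0.
move=> t x w; have psiE s y : psi_nn act k.+1 p s y w = F 0%N (vec s y w) by rewrite FE.
split; first exact: psiE.
  rewrite derive1E; have := Fd (vec t x w) 0%N isT.
  rewrite (_ : (fun s => _) = fun s => psi_nn act k.+1 p s x w).
    by move=> h; exact: derive_val.
  by apply/funext => s; rewrite FE.
rewrite /gradient; congr ((_, _), _).
- have : is_derive x e1 (fun y => psi_nn act k.+1 p t y w) (F 2 (vec t x w)).
    apply/is_derive_e1; have := Fd (vec t x w) 1%N isT.
    by congr is_derive; apply/funext => s; rewrite FE.
  by move=> h; exact: derive_val.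
- have : is_derive x e2 (fun y => psi_nn act k.+1 p t y w) (F 3 (vec t x w)).
    apply/is_derive_e2; have := Fd (vec t x w) 2%N isT.
    by congr is_derive; apply/funext => s; rewrite FE.
  by move=> h; exact: derive_val.
- have : is_derive x e3 (fun y => psi_nn act k.+1 p t y w) (F 4 (vec t x w)).
    apply/is_derive_e3; have := Fd (vec t x w) 3%N isT.
    by congr is_derive; apply/funext => s; rewrite FE.
  by move=> h; exact: derive_val.
Qed.

Lemma pt_vec t x w : pt (vec t x w) = ((t, x), w).
Proof. by case: x => [[x1 x2] x3]; case: w => [[w1 w2] w3]. Qed.

End network_functions.

Section loss_bounds.
Context {R : realType}.
Variables (X : set (R3 R)) (T : R).
Hypotheses (X_domain : bounded_lipschitz_domain X) (T0 : 0 < T).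
Local Notation mu := (@lebesgue3 R \x @sphere_measure R)%E.
Local Notation XS := (X `*` @sphere R).

Let oX : open X. Proof. by case: X_domain. Qed.
Let bX : bounded_set X. Proof. by case: X_domain. Qed.
Let mX : measurable X. Proof. exact: open_measurable_R3. Qed.
Let mXS : measurable XS.
Proof. by apply: measurableX => //; exact: measurable_sphere. Qed.

Lemma measure_XS_fin : exists2 v : R, 0 <= v & (mu XS = v%:E)%E.
Proof.
suff : (mu XS \is a fin_num)%E.
  move=> f; exists (fine (mu XS)); last by rewrite fineK.
  by apply: fine_ge0; exact: (measure_ge0 mu).
rewrite measure_XS//; apply: fin_numM; last first.
  by apply: fin_num_measure; exact: measurable_sphere.
have [M M0 XM] := closure_cube bX.
pose I : set (measurableTypeR R) := [set` `[- M, M]].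
have lM : (lebesgue_measure I < +oo)%E.
  by rewrite /I lebesgue_measure_itv/=; case: ifP => _; rewrite ?ltry// -EFinB ltry.
rewrite ge0_fin_numE ?measure_ge0//.
apply: (@le_lt_trans _ _ (lebesgue3 (cube M))).
  apply: le_measure; rewrite ?inE//; last exact: subset_trans (@subset_closure _ X) XM.
  by apply: measurableX; [apply: measurableX|]; exact: measurable_itv.
rewrite /lebesgue3 product_measure1E//=; last exact: measurableX.
rewrite product_measure1E//=.
by rewrite lte_mul_pinfty ?mule_ge0 ?fin_numM ?ge0_fin_numE.
Qed.

Local Notation nu := (@hausdorff2 R \x @sphere_measure R)%E.

Lemma boundary_measure_fin :
  exists2 h : R, 0 <= h & (nu (boundary X `*` sphere) = h%:E)%E.
Proof.
have [_ _ _ _ lX] := X_domain.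
suff : (nu (boundary X `*` sphere) \is a fin_num)%E.
  move=> f; exists (fine (nu (boundary X `*` sphere))); last by rewrite fineK.
  by apply: fine_ge0; exact: (measure_ge0 nu).
rewrite product_measure1E//; [|exact: boundary_measurable|exact: measurable_sphere].
apply: fin_numM; last by apply: fin_num_measure; exact: measurable_sphere.
by rewrite ge0_fin_numE ?measure_ge0//; exact: hausdorff2_boundary.
Qed.

Lemma integral_time_le (f : R -> \bar R) (c : R) : 0 <= c ->
  (forall t : R, (0 <= t <= T)%R -> 0 <= f t <= c%:E)%E ->
  (\int[lebesgue_measure]_(t in `[0%R, T]) f t <= (T * c)%:E)%E.
Proof.
move=> c0 fc.
apply: (@le_trans _ _ (\int[lebesgue_measure]_(t in `[0%R, T]) (cst c%:E) t)%E).
  by apply: ge0_subset_le_integral => // t /=; rewrite in_itv/= => /fc/andP[].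
rewrite integral_cst; last exact: measurable_itv.
by rewrite /= lebesgue_measure_itv/= lte_fin T0 sube0 -EFinM mulrC.
Qed.

Section approximate_solution.
Variables (sigma_a sigma_s : R) (g : R3 R -> R -> R) (psi0 : R3 R -> R3 R -> R)
  (h psi psi_t : R -> R3 R -> R3 R -> R) (psi_x : R -> R3 R -> R3 R -> R3 R).
Hypothesis psi_solution :
  transport_solution T X sigma_a sigma_s g psi0 h psi psi_t psi_x.
Variables (phi : R -> R3 R -> R3 R -> R) (e : R).
Hypothesis phi_close : forall t x w, closed_cylinder T X (t, x, w) ->
  `|phi t x w - psi t x w| <= e.

Let sqr_le (a b : R) : `|a| <= b -> a ^+ 2 <= b ^+ 2.
Proof.
by move=> ab; rewrite -real_normK ?num_real// ler_pXn2r ?nnegrE// (le_trans _ ab).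
Qed.

Let time_start : 0 <= (0 : R) <= T. Proof. by rewrite lexx ltW. Qed.

Lemma loss_IC_le : (loss_IC X psi0 phi <= (e ^+ 2)%:E * mu XS)%E.
Proof.
have [_ psi00 _] := psi_solution.
apply: le_trans (iterated_integral_le mX (sqr_ge0 e) (B := fun=> 0) _ _) _ => //.
  move=> x w Xx Sw; rewrite expr0n/= mulr0 addr0 -psi00// sqr_le//.
  by apply: phi_close; split => //=; exact: subset_closure.
rewrite (_ : (\int[mu]_(z in XS) _)%E = 0%E) ?mule0 ?adde0//.
by under eq_integral do rewrite expr0n/=; rewrite integral0.
Qed.

(** By monotonicity [gamma_minus X] is enlarged to all of [boundary X] times the sphere, a
    measurable set of finite measure. *)
Lemma loss_BC_le (b : R) : 0 <= b -> (nu (boundary X `*` sphere) = b%:E)%E ->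
  (loss_BC T X h phi <= (T * (e ^+ 2 * b))%:E)%E.
Proof.
move=> b0 nub; have [_ _ psih] := psi_solution.
apply: integral_time_le => [|t tT]; first by rewrite mulr_ge0 ?sqr_ge0.
apply/andP; split.
  by apply: integral_ge0 => z _; rewrite lee_fin sqr_ge0.
apply: (@le_trans _ _ (\int[nu]_(z in boundary X `*` sphere) (cst (e ^+ 2)%:E) z)%E).
  apply: ge0_subset_le_integral => /= [z [bz Sz _]|z _|z _|z [bz Sz nz]] //; rewrite ?lee_fin ?sqr_ge0//.
  case: z bz Sz nz => x w /= bz Sz nz.
  have -> : h t x w = psi t x w by rewrite psih//; split.
  by apply: sqr_le; apply: phi_close; split=> //=; case: bz.
rewrite integral_cst; last first.
  by apply: measurableX; [exact: boundary_measurable|exact: measurable_sphere].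
rewrite [leRHS]EFinM -nub; exact: lexx.
Qed.

Let residual_difference (a b c d : R) (w G H : R3 R) : b + dot w H = d ->
  a + dot w G - c = ((a - b) + w.1.1 * (G.1.1 - H.1.1)
    + w.1.2 * (G.1.2 - H.1.2) + w.2 * (G.2 - H.2)) - (c - d).
Proof. by move=> <-; rewrite /dot; ring. Qed.

Hypothesis L_bounded : bounded_linear_L2 mu XS
  (fun f z => transport_op sigma_a sigma_s g (fun x w => f (x, w)) z.1 z.2).
Hypothesis phi_t_close : forall t x w, closed_cylinder T X (t, x, w) ->
  `|derive1 (fun s => phi s x w) t - psi_t t x w| <= e.
Hypothesis phi_x_close : forall t x w, closed_cylinder T X (t, x, w) ->
  let G := gradient (fun y => phi t y w) x in
  [/\ `|G.1.1 - (psi_x t x w).1.1| <= e, `|G.1.2 - (psi_x t x w).1.2| <= e &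
      `|G.2 - (psi_x t x w).2| <= e].
Hypothesis mphi : forall t, measurable_fun setT (fun z => phi t z.1 z.2).
Hypothesis mpsi : forall t, 0 <= t <= T -> measurable_fun XS (fun z => psi t z.1 z.2).
Variable C0 : R.
Hypothesis psi_bounded : forall t x w, closed_cylinder T X (t, x, w) ->
  `|psi t x w| <= C0.

Let A (f : R3 R * R3 R -> R) : R3 R * R3 R -> R :=
  fun z => transport_op sigma_a sigma_s g (fun x w => f (x, w)) z.1 z.2.

Let bounded_square_integrable (f : R3 R * R3 R -> R) (c : R) : measurable_fun XS f ->
  (forall z, XS z -> `|f z| <= c) ->
  square_integrable mu XS f /\
  (\int[mu]_(z in XS) (f z ^+ 2)%:E <= (c ^+ 2)%:E * mu XS)%E.
Proof.
move=> mf fc; have le : (\int[mu]_(z in XS) (f z ^+ 2)%:E <= (c ^+ 2)%:E * mu XS)%E.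
  rewrite -(integral_XS_cst mX).
  apply: ge0_subset_le_integral => // z zX; rewrite lee_fin ?sqr_ge0//.
  by apply: sqr_le; exact: fc.
split => //; split => //; apply: le_lt_trans le _.
by have [v v0 ->] := measure_XS_fin; rewrite -EFinM ltry.
Qed.

(** Subtracting the equation of [psi], the residual is [Z - B]: [Z] gathers the time derivative and
    three transport terms, so [Z ^+ 2 <= 16 * e ^+ 2], and [B] is the operator applied to the error.
    Then [(Z - B) ^+ 2 <= 2 * Z ^+ 2 + 2 * B ^+ 2] gives 32 and [2 * C]. *)
Lemma loss_GE_le (C v : R) : 0 <= C -> 0 <= v -> (mu XS = v%:E)%E ->
  (forall f, square_integrable mu XS f ->
    \int[mu]_(z in XS) (A f z ^+ 2)%:E <= C%:E * \int[mu]_(z in XS) (f z ^+ 2)%:E)%E ->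
  (loss_GE T X sigma_a sigma_s g phi <= (T * ((32 + 2 * C) * (e ^+ 2 * v)))%:E)%E.
Proof.
move=> C00 v0 muv AC; have [psiE _ _] := psi_solution.
have [AL2 Alin _] := L_bounded.
apply: integral_time_le => [|t tT].
  by apply: mulr_ge0; [lra|apply: mulr_ge0 => //; exact: sqr_ge0].
apply/andP; split.
  apply: integral_ge0 => x _; apply: integral_ge0 => w _.
  by rewrite lee_fin sqr_ge0.
pose phit z := phi t z.1 z.2; pose psit z := psi t z.1 z.2.
(* Written as [-1 * psit z + phit z] to match the combination [a * f + g] in the linearity
   clause. *)
pose D z := -1 * psit z + phit z.
have mphit : measurable_fun XS phit by apply: measurable_funS (mphi t).
have mpsit : measurable_fun XS psit by exact: mpsi.
have cylXS z : XS z -> closed_cylinder T X ((t, z.1), z.2).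
  by move=> [Xx Sw]; split => //=; exact: subset_closure.
have psit_le z : XS z -> `|psit z| <= C0 by move=> /cylXS; exact: psi_bounded.
have D_le z : XS z -> `|D z| <= e.
  by move=> /cylXS/phi_close; rewrite /D mulN1r addrC.
have phit_le z : XS z -> `|phit z| <= C0 + e.
  move=> zX; rewrite -(subrK (psit z) (phit z)) addrC.
  apply: le_trans (ler_normD _ _) _; apply: lerD; first exact: psit_le.
  exact: phi_close (cylXS _ zX).
have mD : measurable_fun XS D.
  by apply: measurable_funD => //; apply: measurable_funM.
have [sphi _] := bounded_square_integrable mphit phit_le.
have [spsi _] := bounded_square_integrable mpsit psit_le.
have [sD DL2] := bounded_square_integrable mD D_le.
have [mAphi _] := AL2 _ sphi; have [mApsi _] := AL2 _ spsi; have [mAD _] := AL2 _ sD.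
pose B z := A phit z - A psit z.
have mB : measurable_fun XS B by exact: measurable_funB.
have BL2 : (\int[mu]_(z in XS) (B z ^+ 2)%:E <= (C * (e ^+ 2 * v))%:E)%E.
  (* Linearity holds only almost everywhere, so the identification of [B] with the image of [D] is
     made under the integral. *)
  have -> : (\int[mu]_(z in XS) (B z ^+ 2)%:E = \int[mu]_(z in XS) (A D z ^+ 2)%:E)%E.
    apply: ge0_ae_eq_integral => //.
    - by apply/measurable_EFinP; exact: measurable_funX.
    - by apply/measurable_EFinP; exact: measurable_funX.
    - by move=> z _; rewrite lee_fin sqr_ge0.
    - by move=> z _; rewrite lee_fin sqr_ge0.
    have := Alin (-1) _ _ spsi sphi; apply: filterS => z Az zX.
    by have := Az zX; rewrite /B /A => ->; rewrite mulN1r addrC.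
  apply: le_trans (AC _ sD) _; rewrite [in leRHS]EFinM; apply: lee_wpmul2l; first by rewrite lee_fin.
  by rewrite [in leRHS]EFinM -muv.
apply: le_trans (iterated_integral_le mX (a := 32 * e ^+ 2) _ mB _) _.
- by rewrite mulr_ge0 ?sqr_ge0.
- move=> x w Xx Sw.
  have Cz : closed_cylinder T X ((t, x), w) by exact: (cylXS (x, w)).
  have e0 : 0 <= e := le_trans (normr_ge0 _) (phi_close Cz).
  have [d1 d2 d3] := phi_x_close Cz; have dt := phi_t_close Cz.
  set G := gradient _ _ in d1 d2 d3 *; set dphi := derive1 _ _ in dt *.
  rewrite (_ : _ - _ = ((dphi - psi_t t x w) + w.1.1 * (G.1.1 - (psi_x t x w).1.1)
    + w.1.2 * (G.1.2 - (psi_x t x w).1.2) + w.2 * (G.2 - (psi_x t x w).2)) - B (x, w)); last first.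
    exact: (residual_difference dphi (A phit (x, w)) G (psiE t x w tT Xx Sw)).
  set Z := (X in (X - B (x, w)) ^+ 2).
  have Ze : `|Z| <= 4 * e.
    have w1 : `|w.1.1| <= 1 by rewrite -Sw le_enorm1.
    have w2 : `|w.1.2| <= 1 by rewrite -Sw le_enorm2.
    have w3 : `|w.2| <= 1 by rewrite -Sw le_enorm3.
    have we (a b : R) : `|a| <= 1 -> `|b| <= e -> `|a * b| <= e.
      by move=> a1 b1; rewrite normrM -[leRHS]mul1r ler_pM.
    have E : 4 * e = e + e + e + e by ring.
    rewrite E; apply: le_trans (ler_normD _ _) _; apply: lerD; last exact: (we _ _ w3 d3).
    apply: le_trans (ler_normD _ _) _; apply: lerD; last exact: (we _ _ w2 d2).
    by apply: le_trans (ler_normD _ _) _; apply: lerD; [exact: dt|exact: (we _ _ w1 d1)].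
  have Z2 := sqr_le Ze.
  have := sqr_ge0 (Z + B (x, w)); move: Z2 (B (x, w)) => {Ze}; move: Z => {}Z Z2 Y; nra.
rewrite muv; apply: le_trans (leeD2l _ (lee_wpmul2l _ BL2)) _ => //.
by rewrite -!EFinM -EFinD lee_fin; lra.
Qed.

End approximate_solution.
End loss_bounds.

Lemma C1_activation_continuous {R : realType} (f : R -> R) :
  C1_activation f -> continuous f.
Proof.
by move=> [df _] x; apply: differentiable_continuous; exact/derivable1_diffP.
Qed.

(** * C^1 density of the networks and convergence of the loss *)

Section convergence.
Context {R : realType}.
Variables (X : set (R3 R)) (sigma_a sigma_s : R) (g : R3 R -> R -> R)
  (L : nat) (act : nat -> R -> R) (T : R) (psi0 : R3 R -> R3 R -> R)
  (h psi psi_t : R -> R3 R -> R3 R -> R) (psi_x : R -> R3 R -> R3 R -> R3 R).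
Hypotheses (X_domain : bounded_lipschitz_domain X) (T_gt0 : 0 < T)
  (act_C1 : forall l, (0 < l < L)%N -> C1_activation (act l))
  (psi_C1 : C1_up_to_boundary T X psi psi_t psi_x).

Definition C1_close (e : R) (phi : R -> R3 R -> R3 R -> R) :=
  forall t x w, closed_cylinder T X (t, x, w) ->
    let G := gradient (fun y => phi t y w) x in
    [/\ `|phi t x w - psi t x w| <= e,
        `|derive1 (fun s => phi s x w) t - psi_t t x w| <= e,
        `|G.1.1 - (psi_x t x w).1.1| <= e,
        `|G.1.2 - (psi_x t x w).1.2| <= e &
        `|G.2 - (psi_x t x w).2| <= e].

(** Half of the error goes to a polynomial on the cylinder and half to a network approximating it on
    a box around the cylinder; the 4 slots of the first are among the 7 of the second. *)
Lemma psi_nn_C1_dense (e : R) : (2 <= L)%N ->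
  (forall l, (0 < l < L)%N -> nonpolynomial (act l)) -> 0 < e ->
  exists2 p, admissible_params L p & C1_close e (psi_nn act L p).
Proof.
case: L act_C1 => [//|[//|k]] aC1 _ aNP e0.
have [_ oX _ bX lX] := X_domain.
have [M M0 KM] := cyl_pts_box T_gt0 bX.
have e20 : 0 < e / 2 by rewrite divr_gt0.
have [P jP PC] := psi_jet_approximable T_gt0 oX bX lX psi_C1 e20.
have [F nF FP] := network_density (ltW M0) aC1 aNP jP e20.
have [p ap pF] := netjet_psi_nn nF; exists p => // t x w cyl G.
have Ky : cyl_pts T X (vec t x w) by rewrite /cyl_pts /= pt_vec.
have close j : (j <= 4)%N ->
    `|F j (vec t x w) - psi_data psi psi_t psi_x j (t, x, w)| <= e.
  move=> j4; rewrite -(subrKA (P j (vec t x w))).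
  rewrite [leRHS](_ : e = e / 2 + e / 2); last by rewrite -splitr.
  apply: le_trans (ler_normD _ _) _; apply: lerD.
    by apply: FP => //; [exact: KM|exact: leq_trans j4 _].
  by have := PC _ _ Ky j4; rewrite /psi_jet pt_vec.
have [-> -> GE] := pF t x w; rewrite {}/G GE.
by split; [have := close 0%N isT|have := close 1%N isT|have := close 2%N isT|
  have := close 3%N isT|have := close 4%N isT].
Qed.

Hypothesis psi_solution :
  transport_solution T X sigma_a sigma_s g psi0 h psi psi_t psi_x.
Hypothesis L_bounded :
  bounded_linear_L2 (lebesgue3 \x sphere_measure)%E (X `*` sphere)
    (fun f z => transport_op sigma_a sigma_s g (fun x w => f (x, w)) z.1 z.2).
Variable params : nat -> nn_params R.
Hypothesis params_close : forall j, C1_close (harmonic j) (psi_nn act L (params j)).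

Let measurable_network j t :
  measurable_fun setT (fun z => psi_nn act L (params j) t z.1 z.2).
Proof.
by apply: measurable_psi_nn => l /act_C1; exact: C1_activation_continuous.
Qed.

(** The solution at a fixed time is the pointwise limit of the approximating networks, which are
    measurable for the product sigma-algebra. *)
Let measurable_solution t : 0 <= t <= T ->
  measurable_fun (X `*` sphere) (fun z => psi t z.1 z.2).
Proof.
move=> tT; apply: (@measurable_fun_cvg _ _ _ _
  (fun j z => psi_nn act L (params j) t z.1 z.2)) => [j|[x w] [/= Xx Sw]].
  by apply: measurable_funS (measurable_network j t).
have cyl : closed_cylinder T X (t, x, w) by split=> //=; exact: subset_closure.
apply/cvgrPdist_le => e e0.
have := @cvg_harmonic R => /cvgrPdist_le /(_ e e0); apply: filterS => j.
rewrite sub0r normrN ger0_norm ?harmonic_ge0// distrC.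
by apply: le_trans; have [] := params_close j cyl.
Qed.

Lemma loss_total_cvg0 :
  loss_total T X sigma_a sigma_s g psi0 h (psi_nn act L (params j))
    @[j --> \oo] --> 0%E.
Proof.
have [_ _ _ bX _] := X_domain.
have [v v0 vE] := measure_XS_fin X_domain.
have [b b0 bE] := boundary_measure_fin X_domain.
have [C0 _ psiC0] := psi_data_bound bX psi_C1.
have [_ _ [C AC]] := L_bounded.
(* The constant of the boundedness clause comes without a sign. *)
pose C' := Num.max C 0.
have AC' f : square_integrable (lebesgue3 \x sphere_measure)%E (X `*` sphere) f ->
    (\int[lebesgue3 \x sphere_measure]_(z in X `*` sphere)
      (transport_op sigma_a sigma_s g (fun x w => f (x, w)) z.1 z.2 ^+ 2)%:E <=
    C'%:E * \int[lebesgue3 \x sphere_measure]_(z in X `*` sphere) (f z ^+ 2)%:E)%E.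
  move=> /AC fC; apply: le_trans fC _; apply: lee_wpmul2r.
    by apply: integral_ge0 => z _; rewrite lee_fin sqr_ge0.
  by rewrite lee_fin le_max lexx.
pose K := T * ((32 + 2 * C') * v) + v + T * b.
apply: (@squeeze_cvge _ _ _ _ (fun=> 0%E) _
  (fun j => (K * (harmonic j ^+ 2 : R))%:E)).
- apply: nearW => j; apply/andP; split.
    apply: adde_ge0; first apply: adde_ge0.
    + apply: integral_ge0 => t _; apply: integral_ge0 => x _.
      by apply: integral_ge0 => w _; rewrite lee_fin sqr_ge0.
    + apply: integral_ge0 => x _; apply: integral_ge0 => w _.
      by rewrite lee_fin sqr_ge0.
    + apply: integral_ge0 => t _; apply: integral_ge0 => z _.
      by rewrite lee_fin sqr_ge0.
  have c0 t x w : closed_cylinder T X (t, x, w) ->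
      `|psi_nn act L (params j) t x w - psi t x w| <= harmonic j.
    by move=> /(params_close j)[].
  have -> : (K * harmonic j ^+ 2)%:E =
      ((T * ((32 + 2 * C') * (harmonic j ^+ 2 * v)))%:E +
      (harmonic j ^+ 2)%:E * v%:E + (T * (harmonic j ^+ 2 * b))%:E)%E.
    by rewrite -EFinM -!EFinD; congr EFin; rewrite /K; ring.
  apply: leeD; first apply: leeD.
  + apply: (loss_GE_le X_domain T_gt0 psi_solution c0 L_bounded _ _ _ _ _ _ v0 vE AC').
    * by move=> t x w /(params_close j)[].
    * by move=> t x w /(params_close j)[].
    * exact: measurable_network.
    * exact: measurable_solution.
    * by move=> t x w cyl; exact: (psiC0 0%N isT _ cyl).
    * by rewrite /C' le_max lexx orbT.
  + by rewrite -vE; exact: (loss_IC_le X_domain T_gt0 psi_solution c0).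
  + exact: (loss_BC_le T_gt0 psi_solution c0 b0 bE).
- exact: cvg_cst.
- apply: cvg_EFin; first by apply: nearW => j.
  rewrite (_ : 0 = K * (0 * 0)); last by rewrite !mulr0.
  apply: cvgM; first exact: cvg_cst.
  by under eq_fun do rewrite expr2; apply: cvgM; exact: cvg_harmonic.
Qed.

End convergence.

Theorem theorem4p3 (R : realType) (X : set (R3 R))
  (sigma_a sigma_s : R) (g : R3 R -> R -> R)
  (L : nat) (act : nat -> R -> R)
  (T : R) (psi0 : R3 R -> R3 R -> R) (h : R -> R3 R -> R3 R -> R)
  (psi psi_t : R -> R3 R -> R3 R -> R) (psi_x : R -> R3 R -> R3 R -> R3 R)
  (X_domain : bounded_lipschitz_domain X)
  (sigma_a_ge0 : 0 <= sigma_a) (sigma_s_ge0 : 0 <= sigma_s)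
  (g_normalized : normalized X g)
  (S_bounded : forall x, X x ->
     bounded_linear_L2 sphere_measure sphere (scattering (g x)))
  (L_bounded :
     bounded_linear_L2 (lebesgue3 \x sphere_measure)%E (X `*` sphere)
       (fun f z => transport_op sigma_a sigma_s g
                     (fun x w => f (x, w)) z.1 z.2))
  (L_ge2 : (2 <= L)%N)
  (act_C1 : forall l, (0 < l < L)%N -> C1_activation (act l))
  (act_nonpolynomial : forall l, (0 < l < L)%N -> nonpolynomial (act l))
  (T_gt0 : 0 < T)
  (psi_C1 : C1_up_to_boundary T X psi psi_t psi_x)
  (psi_solution :
     transport_solution T X sigma_a sigma_s g psi0 h psi psi_t psi_x) :
  exists params : nat -> nn_params R,
    (forall j, admissible_params L (params j)) /\
    loss_total T X sigma_a sigma_s g psi0 h (psi_nn act L (params j))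
      @[j --> \oo] --> 0%E.
Proof.
have dense j : exists p, admissible_params L p /\
    C1_close X T psi psi_t psi_x (harmonic j) (psi_nn act L p).
  have hj : (0 : R) < harmonic j by exact: harmonic_gt0.
  have [p ap pc] := psi_nn_C1_dense X_domain T_gt0 act_C1 psi_C1 L_ge2
    act_nonpolynomial hj.
  by exists p.
have [params paramsE] := choice dense; exists params; split.
  by move=> j; have [] := paramsE j.
apply: (loss_total_cvg0 X_domain T_gt0 act_C1 psi_C1 psi_solution L_bounded).
by move=> j; have [] := paramsE j.
Qed.
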